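(* With the density functions $\delta_1,\delta_2,\delta_3$ defined in the context, the maximum of $\delta_i(\mathcal{C}^r(x,p))$ over $i\in\{1,2,3\}$, integers $p\ge7$ and admissible $x$ is attained at $p=7$, $x=s(7)-h(7)\approx0.41108$ (for $i=3$). Therefore the density upper bound of these congruent and non-congruent hyperball packings related to the truncated cube tilings $\{4,3,p\}$ ($p\ge7$ integer) is $\approx0.84931$.
   Context: Work in the Beltrami–Cayley–Klein (projective) model of hyperbolic $3$-space $\mathbb{H}^3$ of curvature $-1$: the interior of the unit ball of $\mathbb{R}^3$, with the polarity induced by the unit sphere. For a point $B$ outside the closed unit ball, its polar plane $\mathrm{pol}(B)$ meets $\mathbb{H}^3$ in a hyperbolic plane orthogonal to every line through $B$. For $y>1/\sqrt3$ let $B_1=(y,-y,-y)$, $B_2=(y,y,-y)$, $B_3=(-y,y,-y)$, $B_4=(-y,-y,-y)$, $B_5=(y,-y,y)$, $B_6=(y,y,y)$, $B_7=(-y,y,y)$, $B_8=(-y,-y,y)$ and $\beta_i=\mathrm{pol}(B_i)$. For real $p>6$, $\mathcal{C}^r(p)$ is the truncated regular cube obtained by cutting this cube by $\beta_1,\dots,\beta_8$, with $y=y(p)$ chosen so that the dihedral angle between two adjacent faces coming from faces of the cube is $2\pi/p$; for integers $p\ge7$ its reflection images tile $\mathbb{H}^3$ ($\{4,3,p\}$ tiling). The hyperball $\mathcal{H}^s_i$ (base plane $\beta_i$, height $s>0$) is the set of points at distance at most $s$ from $\beta_i$; $\mathrm{Vol}(\mathcal{H}^s\cap\mathcal{C}^r(p))$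 is the volume of $\mathcal{H}^s_i\cap\mathcal{C}^r(p)$. $2h(p)$: distance between $\beta_i,\beta_j$ for vertices joined by an edge; $t(p)$: distance from $\beta_i$ to the origin; $s(p)$: distance from $\beta_i$ to the centre of a face of the cube containing $B_i$; $w(p)$: distance from $\beta_i$ to the plane of a face of $\mathcal{C}^r(p)$ coming from a cube face not containing $B_i$. Write $V(s)=\mathrm{Vol}(\mathcal{H}^s\cap\mathcal{C}^r(p))$, $V_0=\mathrm{Vol}(\mathcal{C}^r(p))$. Density functions: $\delta_1(\mathcal{C}^r(x,p))=(2V(h+x)+6V(h-x))/V_0$ for $x\in[0,\min\{2h,w,t\}-h]$; $\delta_2(\mathcal{C}^r(x,p))=(V(t+x)+V(t-x)+3V(2h-t-x)+3V(2h-t+x))/V_0$ for $x\in[0,\min\{2h-t,t,w-t,s-h\}]$; $\delta_3(\mathcal{C}^r(x,p))=(4V(h+x)+4V(h-x))/V_0$ for $x\in[0,\min\{h,s-h\}]$ (all quantities evaluated at $p$). They are the densities in $\mathcal{C}^r(p)$ of the following hyperball arrangements: ($\delta_1$) heights $h+x$ at $B_2,B_8$ and $h-x$ elsewhere; ($\delta_2$) height $t+x$ at $B_2$, $t-x$ at $B_8$, $2h-t-x$ at $B_1,B_3,B_6$, $2h-t+x$ at $B_4,B_5,B_7$; ($\delta_3$) height $h+x$ at $B_1,B_3,B_6,B_8$ and $h-x$ at $B_2,B_4,B_5,B_7$. *)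

(* Defs.v *)
From HB Require Import structures.
From mathcomp Require Import all_boot all_order all_algebra.
From mathcomp Require Import all_classical all_reals all_analysis.
Set Implicit Arguments. Unset Strict Implicit. Unset Printing Implicit Defensive.
Import Order.TTheory GRing.Theory Num.Theory.
Import numFieldNormedType.Exports.
Local Open Scope classical_set_scope.
Local Open Scope ring_scope.

Section Klein.
Variable R : realType.

Definition pt := (R * R * R)%type.
Definition mkpt (a b c : R) : pt := (a, b, c).
Definition px (z : pt) : R := z.1.1.
Definition py (z : pt) : R := z.1.2.
Definition pz (z : pt) : R := z.2.
Definition dot (u v : pt) : R := px u * px v + py u * py v + pz u * pz v.
Definition nrm2 (u : pt) : R := dot u u.

Definition hyp_space : set pt := [set z | nrm2 z < 1].

Definition arcosh (c : R) : R := ln (c + Num.sqrt (c ^+ 2 - 1)).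

(* hyperbolic distance (curvature -1) in the Klein model *)
Definition hdist (u v : pt) : R :=
  arcosh ((1 - dot u v) / Num.sqrt ((1 - nrm2 u) * (1 - nrm2 v))).

Definition setdist (A B : set pt) : R :=
  inf [set r | exists a b, A a /\ B b /\ hyp_space a /\ hyp_space b /\ r = hdist a b].

Definition polar_plane (B : pt) : set pt := [set z | hyp_space z /\ dot z B = 1].

(* interior dihedral angle between the half-spaces {z.P <= 1} and {z.Q <= 1}
   whose bounding planes have poles P, Q (Lorentzian form L(u,v) = u.v - 1 on
   homogeneous coordinates (u,1)) *)
Definition dihedral (P Q : pt) : R :=
  acos (- (dot P Q - 1) / Num.sqrt ((nrm2 P - 1) * (nrm2 Q - 1))).

Definition vtx (y : R) (i : nat) : pt :=
  match i with
  | 1 => mkpt y (- y) (- y)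
  | 2 => mkpt y y (- y)
  | 3 => mkpt (- y) y (- y)
  | 4 => mkpt (- y) (- y) (- y)
  | 5 => mkpt y (- y) y
  | 6 => mkpt y y y
  | 7 => mkpt (- y) y y
  | _ => mkpt (- y) (- y) y
  end.

(* truncated cube: cube |x_k| <= y cut by the polar planes beta_i, keeping the
   side containing the origin *)
Definition Cr (y : R) : set pt :=
  [set z | hyp_space z /\ `|px z| <= y /\ `|py z| <= y /\ `|pz z| <= y /\
           forall i : nat, (1 <= i <= 8)%N -> dot z (vtx y i) <= 1].

(* y(p): the cube parameter in (1/sqrt 3, 1) for which the dihedral angle
   between the adjacent faces x_1 = y (pole (1/y,0,0)) and x_2 = y
   (pole (0,1/y,0)) equals 2 pi / p *)
Definition yp (p : R) : R :=
  xget 0 [set y : R | (Num.sqrt 3)^-1 < y < 1 /\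
     dihedral (mkpt y^-1 0 0) (mkpt 0 y^-1 0) = 2 * pi / p].

Definition hyperball (B : pt) (s : R) : set pt :=
  [set z | hyp_space z /\ setdist [set z] (polar_plane B) <= s].

Definition leb3 := ((@lebesgue_measure R \x @lebesgue_measure R) \x @lebesgue_measure R)%E.
Definition hvol (A : set pt) : R :=
  fine (\int[leb3]_(z in A) ((1 - nrm2 z) ^-2)%:E)%E.

Section AtP.
Variable p : nat.
Let y := yp p%:R.
Let beta1 := polar_plane (vtx y 1).

Definition h_ : R := setdist beta1 (polar_plane (vtx y 2)) / 2.
Definition t_ : R := setdist beta1 [set mkpt 0 0 0].
(* centre of the face x_1 = y, which contains B_1 *)
Definition s_ : R := setdist beta1 [set mkpt y 0 0].
(* face plane x_1 = -y, coming from a cube face not containing B_1 *)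
Definition w_ : R := setdist beta1 [set z | hyp_space z /\ px z = - y].

Definition Vol (s : R) : R := hvol (hyperball (vtx y 1) s `&` Cr y).
Definition V0 : R := hvol (Cr y).

Definition delta1 (x : R) : R := (2 * Vol (h_ + x) + 6 * Vol (h_ - x)) / V0.
Definition delta2 (x : R) : R :=
  (Vol (t_ + x) + Vol (t_ - x) + 3 * Vol (2 * h_ - t_ - x) + 3 * Vol (2 * h_ - t_ + x)) / V0.
Definition delta3 (x : R) : R := (4 * Vol (h_ + x) + 4 * Vol (h_ - x)) / V0.

Definition adm1 (x : R) : Prop :=
  0 <= x /\ x <= Num.min (Num.min (2 * h_) w_) t_ - h_.
Definition adm2 (x : R) : Prop :=
  0 <= x /\ x <= Num.min (Num.min (2 * h_ - t_) t_) (Num.min (w_ - t_) (s_ - h_)).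
Definition adm3 (x : R) : Prop :=
  0 <= x /\ x <= Num.min h_ (s_ - h_).
End AtP.
End Klein.

(* Main.v *)
(** The part of a hyperball of height s over one truncation triangle lies in the prism over that
triangle, of area pi - 6 pi / p, so that V(s) <= (pi - 6 pi / p) (sinh s cosh s + s) / 2, with
equality as long as the prism stays inside the cube (which covers all s <= s(7) for p = 7). The
numerators of the three densities thus become elementary functions of k = tanh h(p), where
k^2 = 1 / cos(2 pi / p) - 1.

For V_0, coordinates of a cone with apex at a vertex of the cube allow two of the three integrations
of (1 - |v|^2)^-2 to be carried out. What remains is the integral of x atanh x against dT / (1 + T^2)
for 0 <= T <= tan(pi / p), where x^-2 is an affine function of T^2. As a function of r = x^-2,
f = x atanh x is convex and satisfies 2 r f' + f = -1 / (r - 1). A tangent of f bounds V_0 from below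
well enough to give densities below 0.8493 for all p >= 8; for p = 7 the differential equation
certifies polynomial bounds of f, which determine V_0 within 10^-4. *)

(* Every line through a vertex [B] is orthogonal to the plane that truncates it, so prism and cube
   are both stacks of segments over the same base, and one column integral serves both. Over the
   prism all segments have the same height, and only the area of the base is left. In the cube they
   end on a plane through the centre; the second integration still closes, because the volume of a
   column over unit area is half the derivative of [x atanh x], with [x] the hyperbolic tangent of
   the height.

   Two precisions are needed. Five digits at [p = 7] require bounds of [V_0] from both sides and an
   exact numerator, hence the check that the prism stays inside the cube there. The number 0.8493
   lies below the optimum at [p = 7] and above all densities for [p >= 8], where one-sided bounds
   therefore suffice.

   The numerators of all three families are bounded by one expression, that of the third family with
   a constant in place of [cosh (2 x)], so each order needs a single inequality against [V_0]. For
   [p = 8] and [p = 9] the factor [y] cancels from it and only rational estimates in [k^2] remain;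
   for [p >= 10] estimates uniform in [k] replace them. *)
Require Import Defs.
From HB Require Import structures.
From mathcomp Require Import all_boot all_order all_algebra.
From mathcomp Require Import all_classical all_reals all_analysis.
From mathcomp Require Import measurable_realfun.
From mathcomp Require Import ring lra.
Set Implicit Arguments.
Unset Strict Implicit.
Unset Printing Implicit Defensive.
Import Order.TTheory GRing.Theory Num.Theory.
Import numFieldNormedType.Exports.
Local Open Scope classical_set_scope.
Local Open Scope ring_scope.

(* Ring numerals are unary, hence these numbers in blocks of three digits. *)
Local Notation i2 a b := (a * 10 ^+ 3 + b).
Local Notation i3 a b c := (i2 a b * 10 ^+ 3 + c).
Local Notation i4 a b c d := (i3 a b c * 10 ^+ 3 + d).
Local Notation d2 a b := (i2 a b / 10 ^+ 6).
Local Notation d3 a b c := (i3 a b c / 10 ^+ 9).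
Local Notation d4 a b c d := (i4 a b c d / 10 ^+ 12).

(** * Iterated integrals in cone coordinates *)

Section iterated_integrals.
Variable R : realType.
Local Notation mu := (@lebesgue_measure R).
Local Open Scope ereal_scope.
Implicit Types (F : R -> \bar R) (g h : R * R * R -> \bar R).

(** The image of Lebesgue measure under [x |-> k x + b], scaled by [k], gives half-open intervals
    their length, hence is Lebesgue measure. The rule thus holds for every nonnegative measurable
    [F], in particular for the discontinuous integrands cut out by bodies. *)
Lemma integral_affine F (k b : R) : (0 < k)%R ->
  measurable_fun setT F -> (forall x, 0 <= F x) ->
  \int[mu]_x F x = k%:E * \int[mu]_x F (k * x + b)%R.
Proof.
move=> k0 mF F0.
pose phi : measurableTypeR R -> measurableTypeR R := fun x => (k * x + b)%R.
have mphi : measurable_fun [set: measurableTypeR R] phi.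
  by apply: measurable_funD => //; exact: measurable_funM.
pose kn : {nonneg R} := NngNum (ltW k0).
pose nu : {measure set (measurableTypeR R) -> \bar R} :=
  mscale kn (measure_function_pushforward__canonical__measure_function_Measure mu mphi).
have nuE : forall A, measurable A -> mu A = nu A.
  apply: lebesgue_measure_unique => _ [[u v]] _ <- /=.
  rewrite /nu /= /mscale /= /pushforward.
  have -> : phi @^-1` `]u, v] = `]((u - b) / k)%R, ((v - b) / k)%R]%classic.
    apply/seteqP; split=> x /=; rewrite /phi !in_itv/=;
      by rewrite ltr_pdivrMr// ler_pdivlMr// ltrBlDr lerBrDr (mulrC x).
  rewrite !lebesgue_measure_itv/= !lte_fin ltr_pM2r ?invr_gt0// ltrD2r.
  case: ifPn => _; last by rewrite mule0.
  by rewrite -!EFinD -EFinM; congr EFin; field; rewrite gt_eqF.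
transitivity (\int[nu]_x F x).
  by apply: eq_measure_integral => A mA _; exact: nuE.
by rewrite /nu ge0_integral_mscale//= ge0_integral_pushforward//=.
Qed.

Lemma integral_shift F (b : R) : measurable_fun setT F -> (forall x, 0 <= F x) ->
  \int[mu]_x F x = \int[mu]_x F (x + b)%R.
Proof.
move=> mF F0; rewrite (@integral_affine F 1 b)// mul1e.
by apply: eq_integral => x _; rewrite mul1r.
Qed.

Lemma integral_oppr F : measurable_fun setT F -> (forall x, 0 <= F x) ->
  \int[mu]_x F x = \int[mu]_x F (- x)%R.
Proof.
move=> mF F0; rewrite -[RHS]/(\int[mu]_x (F \o -%R) x).
transitivity (\int[pushforward mu (-%R : _ -> measurableTypeR R)]_x F x).
  by apply: eq_measure_integral => A mA _; exact: (esym (lebesgue_measureN mA)).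
by rewrite ge0_integral_pushforward//= preimage_setT.
Qed.

Definition iter3 g : \bar R :=
  \int[mu]_a \int[mu]_b \int[mu]_c g (a, b, c).

Definition nnmeas g := measurable_fun setT g /\ forall v, 0 <= g v.

Lemma measurable_slice2 (T : R * R -> \bar R) a :
  measurable_fun setT T -> measurable_fun setT (fun b => T (a, b)).
Proof. by move=> mT; apply: measurableT_comp. Qed.

Lemma measurable_inner (T : R * R -> \bar R) : measurable_fun setT T ->
  (forall v, 0 <= T v) -> measurable_fun setT (fun a => \int[mu]_b T (a, b)).
Proof. by move=> mT T0; exact: (@measurable_fun_fubini_tonelli_F _ _ _ _ _ mu T). Qed.

Lemma measurable_inner3 g : nnmeas g ->
  measurable_fun setT (fun v : R * R => \int[mu]_c g (v, c)).
Proof. by move=> [mT T0]; exact: (@measurable_fun_fubini_tonelli_F _ _ _ _ _ mu g). Qed.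

Lemma integral_swap (T : R * R -> \bar R) : measurable_fun setT T ->
  (forall v, 0 <= T v) ->
  \int[mu]_a \int[mu]_b T (a, b) = \int[mu]_b \int[mu]_a T (a, b).
Proof.
move=> mT T0; have := @fubini_tonelli1 _ _ _ _ _ mu mu T mT T0.
by rewrite (@fubini_tonelli2 _ _ _ _ _ mu mu T mT T0) => ->.
Qed.

Lemma sigma_finite_plane : sigma_finite setT (mu \x mu).
Proof.
pose I (k : nat) := `[(- k%:R)%R, (k%:R)%R]%classic : set R.
exists (fun k => I k `*` I k).
  apply/esym; rewrite -subTset => -[a b] _.
  exists (Num.truncn (Num.max `|a|%R `|b|%R)).+1 => //.
  have := truncnS_gt (Num.max `|a|%R `|b|%R); rewrite gt_max => /andP[ha hb].
  by split; rewrite /I /= in_itv /= -ler_norml ltW.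
move=> k; split; first by apply: measurableX; exact: measurable_itv.
rewrite product_measure1E; [|exact: measurable_itv|exact: measurable_itv].
suff : lebesgue_measure (I k) * lebesgue_measure (I k) < +oo by [].
rewrite /I !lebesgue_measure_itv /=; case: ifPn => _; last by rewrite mule0 ltry.
by rewrite -EFinD -EFinM ltry.
Qed.

Lemma iter3E g : nnmeas g -> \int[@leb3 R]_v g v = iter3 g.
Proof.
move=> gg; have [mg g0] := gg; rewrite /leb3.
(* Tonelli for the plane times the line takes the plane measure as a packaged sigma-finite measure;
   growing squares exhaust the plane. *)
pose m12 : {sigma_finite_measure set (measurableTypeR R * measurableTypeR R)%type -> \bar R} :=
  HB.pack (mu \x mu) (Measure_isSigmaFinite.Build _ _ _ (mu \x mu) sigma_finite_plane).
etransitivity; first exact: (@fubini_tonelli1 _ _ _ _ R m12 mu g mg g0).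
rewrite /fubini_F.
etransitivity; first apply: fubini_tonelli1.
- exact: measurable_inner3.
- by move=> v; apply: integral_ge0.
- by [].
Qed.

Lemma nnmeas_comp g (f : R * R * R -> R * R * R) : nnmeas g ->
  measurable_fun setT f -> nnmeas (g \o f).
Proof. by move=> [mg g0] mf; split=> [|v]; [exact: measurableT_comp|exact: g0]. Qed.

Lemma measurable_mk3 (d : measure_display) (T : measurableType d) (f1 f2 f3 : T -> R) :
  measurable_fun setT f1 -> measurable_fun setT f2 -> measurable_fun setT f3 ->
  measurable_fun setT (fun x => (f1 x, f2 x, f3 x)).
Proof. by move=> m1 m2 m3; do 2?apply: measurable_fun_pair. Qed.

Lemma measurable_fst3 : measurable_fun setT (fun v : R * R * R => v.1.1).
Proof. exact: measurableT_comp. Qed.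
Lemma measurable_snd3 : measurable_fun setT (fun v : R * R * R => v.1.2).
Proof. exact: measurableT_comp. Qed.
Lemma measurable_thd3 : measurable_fun setT (fun v : R * R * R => v.2).
Proof. exact: measurable_snd. Qed.

Definition swap12 (v : R * R * R) : R * R * R := (v.1.2, v.1.1, v.2).
Definition swap23 (v : R * R * R) : R * R * R := (v.1.1, v.2, v.1.2).

Lemma measurable_swap12 : measurable_fun setT swap12.
Proof.
apply: measurable_mk3;
  [exact: measurable_snd3|exact: measurable_fst3|exact: measurable_thd3].
Qed.

Lemma measurable_swap23 : measurable_fun setT swap23.
Proof.
apply: measurable_mk3;
  [exact: measurable_fst3|exact: measurable_thd3|exact: measurable_snd3].
Qed.

Lemma iter3_swap12 g : nnmeas g -> iter3 g = iter3 (g \o swap12).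
Proof.
move=> gg; rewrite /iter3.
have -> := @integral_swap (fun v => \int[mu]_c g (v, c)) (measurable_inner3 gg) _.
  by [].
by move=> v; apply: integral_ge0 => c _; apply gg.2.
Qed.

Lemma iter3_swap23 g : nnmeas g -> iter3 g = iter3 (g \o swap23).
Proof.
move=> [mg g0]; apply: eq_integral => a _.
have -> := @integral_swap (fun v => g (a, v.1, v.2)) _ _.
- by [].
- by apply: measurableT_comp => //; apply: measurable_mk3;
    [exact: measurable_cst|exact: measurable_fst|exact: measurable_snd].
- by move=> v; apply: g0.
Qed.

Lemma nnmeas_swap12 g : nnmeas g -> nnmeas (g \o swap12).
Proof. by move=> gg; apply: nnmeas_comp => //; exact: measurable_swap12. Qed.

Lemma nnmeas_swap23 g : nnmeas g -> nnmeas (g \o swap23).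
Proof. by move=> gg; apply: nnmeas_comp => //; exact: measurable_swap23. Qed.
End iterated_integrals.

(** * Symmetric integrands and ordered coordinates *)

Section symmetrization.
Variable R : realType.
Local Notation mu := (@lebesgue_measure R).
Local Open Scope ereal_scope.
Implicit Types (F G : R -> \bar R) (g h : R * R * R -> \bar R).

Lemma integral_eq_off F G (s1 s2 : R) :
  measurable_fun setT F -> measurable_fun setT G ->
  (forall x, 0 <= F x) -> (forall x, 0 <= G x) ->
  (forall x, x != s1 -> x != s2 -> F x = G x) ->
  \int[mu]_x F x = \int[mu]_x G x.
Proof.
move=> mF mG F0 G0 FG; apply: ge0_ae_eq_integral => //.
exists [set s1; s2]; split.
- by apply: measurableU; exact: measurable_set1.
- have : mu ([set s1] `|` [set s2]) <= mu [set s1] + mu [set s2].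
    by apply: measureU2; exact: measurable_set1.
  rewrite !lebesgue_measure_set1 adde0 => le0.
  by apply/eqP; rewrite eq_le le0 measure_ge0.
- move=> x /= FGx; apply: contrapT => nx; apply: FGx => _; apply: FG.
    by apply/eqP => xs; apply: nx; left.
  by apply/eqP => xs; apply: nx; right.
Qed.

Lemma nnmeas_slice3 g a b : nnmeas g -> measurable_fun setT (fun c => g (a, b, c)).
Proof.
by move=> [mg _]; exact: measurableT_comp.
Qed.

Lemma nnmeas_slice2 g a : nnmeas g -> measurable_fun setT (fun b => \int[mu]_c g (a, b, c)).
Proof. by move=> gg; apply: (measurable_slice2 a (measurable_inner3 gg)). Qed.

Lemma nnmeas_slice1 g : nnmeas g ->
  measurable_fun setT (fun a => \int[mu]_b \int[mu]_c g (a, b, c)).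
Proof.
move=> gg; apply: (@measurable_inner R (fun v => \int[mu]_c g (v, c))).
  exact: measurable_inner3.
by move=> v; apply: integral_ge0 => c _; apply gg.2.
Qed.

Lemma eq_iter3_off_diag g h : nnmeas g -> nnmeas h ->
  (forall a b c, a != b -> a != c -> b != c -> g (a, b, c) = h (a, b, c)) ->
  iter3 g = iter3 h.
Proof.
move=> gg hh gh; apply: eq_integral => a _.
apply: (@integral_eq_off _ _ a a).
- exact: nnmeas_slice2.
- exact: nnmeas_slice2.
- by move=> b; apply: integral_ge0 => c _; apply gg.2.
- by move=> b; apply: integral_ge0 => c _; apply hh.2.
move=> b ba _; apply: (@integral_eq_off _ _ a b).
- exact: nnmeas_slice3.
- exact: nnmeas_slice3.
- by move=> c; apply gg.2.
- by move=> c; apply hh.2.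
- by move=> c ca cb; apply: gh; rewrite eq_sym.
Qed.

Lemma iter3D g h : nnmeas g -> nnmeas h ->
  iter3 (fun v => g v + h v) = iter3 g + iter3 h.
Proof.
move=> gg hh; rewrite /iter3.
rewrite -(@ge0_integralD _ _ _ mu setT measurableT
  (fun a => \int[mu]_b \int[mu]_c g (a, b, c))
  (fun a => \int[mu]_b \int[mu]_c h (a, b, c))); last 4 first.
- by move=> a _; do 2!apply: integral_ge0 => ? _; apply gg.2.
- exact: nnmeas_slice1.
- by move=> a _; do 2!apply: integral_ge0 => ? _; apply hh.2.
- exact: nnmeas_slice1.
apply: eq_integral => a _.
rewrite -(@ge0_integralD _ _ _ mu setT measurableT
  (fun b => \int[mu]_c g (a, b, c)) (fun b => \int[mu]_c h (a, b, c))); last 4 first.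
- by move=> b _; apply: integral_ge0 => ? _; apply gg.2.
- exact: nnmeas_slice2.
- by move=> b _; apply: integral_ge0 => ? _; apply hh.2.
- exact: nnmeas_slice2.
apply: eq_integral => b _.
apply: (@ge0_integralD _ _ _ mu setT measurableT
  (fun c => g (a, b, c)) (fun c => h (a, b, c))).
- by move=> c _; apply gg.2.
- exact: nnmeas_slice3.
- by move=> c _; apply hh.2.
- exact: nnmeas_slice3.
Qed.

Lemma nnmeasD g h : nnmeas g -> nnmeas h -> nnmeas (fun v => g v + h v).
Proof.
move=> [mg g0] [mh h0]; split; first exact: emeasurable_funD.
by move=> v; apply: adde_ge0.
Qed.

Definition cut (P : R * R * R -> bool) g v := if P v then g v else 0.

Lemma nnmeas_cut P g : measurable_fun setT P -> nnmeas g -> nnmeas (cut P g).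
Proof.
move=> mP [mg g0]; split; last by move=> v; rewrite /cut; case: ifP.
by apply: measurable_fun_ifT => //; exact: measurable_cst.
Qed.

Definition chain_bac (v : R * R * R) := ((v.1.2 < v.1.1) && (v.1.1 < v.2))%R.

Lemma measurable_chain_bac : measurable_fun setT chain_bac.
Proof.
apply: measurable_and; apply: measurable_fun_ltr.
- exact: measurable_snd3.
- exact: measurable_fst3.
- exact: measurable_fst3.
- exact: measurable_thd3.
Qed.

Lemma six_orderings (x : \bar R) (a b c : R) : a != b -> a != c -> b != c ->
  x = (((if ((b < a) && (a < c))%R then x else 0) + (if ((a < b) && (b < c))%R then x else 0))
     + ((if ((c < a) && (a < b))%R then x else 0) + (if ((a < c) && (c < b))%R then x else 0)))
     + ((if ((c < b) && (b < a))%R then x else 0) + (if ((b < c) && (c < a))%R then x else 0)).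
Proof.
case: (ltgtP a b) => // ab _; case: (ltgtP a c) => // ac _; case: (ltgtP b c) => // bc _;
  rewrite /= ?adde0 ?add0e //; exfalso; lra.
Qed.

(* The six orderings of the coordinates contribute equally, and ties are negligible. *)
Lemma iter3_sym g : nnmeas g -> g \o @swap12 R = g -> g \o @swap23 R = g ->
  iter3 g = 6%:R%:E * iter3 (cut chain_bac g).
Proof.
move=> gg g12 g23; set h := cut chain_bac g.
have hh : nnmeas h by exact: nnmeas_cut measurable_chain_bac gg.
(* Products of the two transpositions carry the ordering [b < a < c] to the other five, and
   exchanging the order of integration shows that every copy has the integral of [h]. *)
pose h1 := h \o @swap12 R; pose h2 := h \o @swap23 R.
pose h3 := h1 \o @swap23 R; pose h4 := h2 \o @swap12 R; pose h5 := h4 \o @swap23 R.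
have n1 : nnmeas h1 by exact: nnmeas_swap12.
have n2 : nnmeas h2 by exact: nnmeas_swap23.
have n3 : nnmeas h3 by exact: nnmeas_swap23.
have n4 : nnmeas h4 by exact: nnmeas_swap12.
have n5 : nnmeas h5 by exact: nnmeas_swap23.
have e1 : iter3 h1 = iter3 h by exact/esym/iter3_swap12.
have e2 : iter3 h2 = iter3 h by exact/esym/iter3_swap23.
have e3 : iter3 h3 = iter3 h by rewrite -e1; exact/esym/iter3_swap23.
have e4 : iter3 h4 = iter3 h by rewrite -e2; exact/esym/iter3_swap12.
have e5 : iter3 h5 = iter3 h by rewrite -e4; exact/esym/iter3_swap23.
have n01 := nnmeasD hh n1; have n23 := nnmeasD n2 n3; have n45 := nnmeasD n4 n5.
have n03 := nnmeasD n01 n23; have n05 := nnmeasD n03 n45.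
transitivity (iter3 (fun v => ((h v + h1 v) + (h2 v + h3 v)) + (h4 v + h5 v))).
  apply: (eq_iter3_off_diag gg n05) => a b c ab ac bc.
  have s12 x y z : g (y, x, z) = g (x, y, z) by rewrite -[in RHS]g12.
  have s23 x y z : g (x, z, y) = g (x, y, z) by rewrite -[in RHS]g23.
  rewrite /h5 /h4 /h3 /h2 /h1 /h /cut /chain_bac /swap12 /swap23 /=.
  have E1 : g (b, a, c) = g (a, b, c) := s12 a b c.
  have E2 : g (a, c, b) = g (a, b, c) := s23 a b c.
  have E3 : g (c, a, b) = g (a, b, c) := etrans (s12 a c b) E2.
  have E4 : g (b, c, a) = g (a, b, c) := etrans (s23 b a c) E1.
  have E5 : g (c, b, a) = g (a, b, c) := etrans (s12 b c a) E4.
  rewrite ?E1 ?E2 ?E3 ?E4 ?E5.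
  exact: six_orderings.
rewrite (iter3D n03 n45) (iter3D n01 n23) (iter3D hh n1) (iter3D n2 n3) (iter3D n4 n5).
rewrite e1 e2 e3 e4 e5.
case: (iter3 h) => [r||]; rewrite /= -?EFinD.
- by rewrite -EFinM; congr EFin; ring.
- by rewrite gt0_muley // lte_fin ltr0n.
- by rewrite gt0_muleNy // lte_fin ltr0n.
Qed.
End symmetrization.

(** * Cone coordinates *)

Section cone_coordinates.
Variable R : realType.
Local Notation mu := (@lebesgue_measure R).
Local Open Scope ereal_scope.
Implicit Types (g : R * R * R -> \bar R).

(* [(m, r, c)] stands for the point [(c r, c r m, c)] of the cone [0 <= b < a < c]. *)
Definition cone_density g (v : R * R * R) : \bar R :=
  if [&& (0 <= v.1.1)%R, (v.1.1 < 1)%R, (0 < v.1.2)%R, (v.1.2 < 1)%R & (0 < v.2)%R]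
  then (v.2 * v.2 * v.1.2)%:E * g (v.2 * v.1.2, v.2 * v.1.2 * v.1.1, v.2)%R else 0.

Lemma nnmeas_cone_density g : nnmeas g -> nnmeas (cone_density g).
Proof.
move=> [mg g0].
have mm := @measurable_fst3 R; have mr := @measurable_snd3 R.
have mc := @measurable_thd3 R.
split; last first.
  move=> v; rewrite /cone_density; case: ifP => // /and5P[_ _ r0 _ c0].
  by apply: mule_ge0; [rewrite lee_fin !mulr_ge0// ltW|exact: g0].
apply: measurable_fun_ifT; last exact: measurable_cst.
- apply: measurable_and; first by apply: measurable_fun_ler; [exact: measurable_cst|exact: mm].
  apply: measurable_and; first by apply: measurable_fun_ltr; [exact: mm|exact: measurable_cst].
  apply: measurable_and; first by apply: measurable_fun_ltr; [exact: measurable_cst|exact: mr].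
  apply: measurable_and; first by apply: measurable_fun_ltr; [exact: mr|exact: measurable_cst].
  by apply: measurable_fun_ltr; [exact: measurable_cst|exact: mc].
- have mcr : measurable_fun setT (fun v : R * R * R => (v.2 * v.1.2)%R).
    exact: (measurable_funM mc mr).
  apply: emeasurable_funM.
    apply/measurable_EFinP; apply: measurable_funM; last exact: mr.
    exact: (measurable_funM mc mc).
  apply: (measurableT_comp mg); apply: measurable_mk3; [exact: mcr| |exact: mc].
  exact: (measurable_funM mcr mm).
Qed.

Lemma integral_scale (k : R) (F : R -> \bar R) : (0 <= k)%R ->
  measurable_fun setT F -> (forall x, 0 <= F x) ->
  \int[mu]_x (k%:E * F x) = k%:E * \int[mu]_x F x.
Proof. by move=> k0 mF F0; rewrite ge0_integralZl_EFin. Qed.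

(** For fixed [c] the substitutions [a = c r] and [b = c r m] contribute the factors [c] and [c r],
    whose product is the weight in [cone_density]. The ordering [b < a < c] becomes [m < 1],
    [r < 1], and the vanishing of [g] for [b < 0] gives [m >= 0]. *)
Lemma cone_slice g c : nnmeas g -> (forall a b c, (b < 0)%R -> g (a, b, c) = 0) ->
  \int[mu]_a \int[mu]_b cut (@chain_bac R) g (a, b, c) =
  \int[mu]_r \int[mu]_m cone_density g (m, r, c).
Proof.
move=> gg gneg; set H := cut _ g.
have hh : nnmeas H by exact: (nnmeas_cut (@measurable_chain_bac R) gg).
have zeroE (F : R -> \bar R) : (forall x, F x = 0) -> \int[mu]_x F x = 0.
  by move=> F0; apply: integral0_eq => x _; exact: F0.
case: (lerP c 0) => c0.
  transitivity (0 : \bar R).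
    apply: (zeroE) => a; apply: (zeroE) => b.
    rewrite /H /cut /chain_bac /=; case: ifP => // /andP[ba ac].
    by apply: gneg; lra.
  apply/esym; apply: (zeroE) => r; apply: (zeroE) => m.
  by rewrite /cone_density /= (ltNge 0%R c) c0 !andbF.
have hsw := nnmeas_swap12 (nnmeas_swap23 hh).
have mF : measurable_fun setT (fun a => \int[mu]_b H (a, b, c)).
  exact: (nnmeas_slice2 c hsw).
have F0 a : 0 <= \int[mu]_b H (a, b, c) by apply: integral_ge0 => b _; apply hh.2.
rewrite (integral_affine 0 c0 mF F0).
have mF' : measurable_fun setT (fun r => \int[mu]_b H (c * r + 0, b, c)%R).
  have mphi : measurable_fun setT (fun r : R => c * r + 0)%R.
    by apply: measurable_funD => //; exact: measurable_funM.
  exact: (measurableT_comp mF mphi).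
rewrite -(integral_scale (ltW c0) mF' (fun r => F0 _)).
apply: eq_integral => r _; rewrite addr0.
  case: (boolP ((0 < r) && (r < 1))%R) => [/andP[r0 r1]|nr]; last first.
    rewrite (zeroE (fun b => H (c * r, b, c)%R)); last first.
      move=> b; rewrite /H /cut /chain_bac /=; case: ifP => // /andP[ba ac].
      apply: gneg; move: nr; rewrite negb_and -!leNgt => /orP[r0|r1]; nra.
    rewrite mule0; apply/esym; apply: (zeroE) => m.
    rewrite /cone_density /=; case: ifP => // /and5P[_ _ r0 r1 _].
    by rewrite r0 r1 in nr.
  have cr0 : (0 < c * r)%R by rewrite mulr_gt0.
  have mG : measurable_fun setT (fun b => H (c * r, b, c)%R).
    by apply: (measurableT_comp hh.1); exact: measurable_mk3.
  have G0 b : 0 <= H (c * r, b, c)%R by apply hh.2.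
  rewrite (integral_affine 0 cr0 mG G0) muleA -EFinM.
  have mG' : measurable_fun setT (fun m => H (c * r, c * r * m + 0, c)%R).
    apply: (measurableT_comp hh.1); apply: measurable_mk3 => //.
    by apply: measurable_funD => //; exact: measurable_funM.
  rewrite -(integral_scale _ mG' (fun m => hh.2 _)).
  - apply: eq_integral => m _; rewrite addr0 /cone_density /= r0 r1 c0 /H /cut /chain_bac /=.
    have -> : (c * r * m < c * r)%R = (m < 1)%R by rewrite -[ltRHS]mulr1 ltr_pM2l.
    have -> : (c * r < c)%R by nra.
    rewrite !andbT.
    case: (ltP m 1%R) => m1; last by rewrite andbF mule0.
    case: (leP 0%R m) => m0 /=; first by congr (_ * _); congr EFin; ring.
    rewrite gneg ?mule0//; nra.
  - by rewrite mulr_ge0 ?ltW// mulr_gt0.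
Qed.

Theorem cone_integral g : nnmeas g -> g \o @swap12 R = g -> g \o @swap23 R = g ->
  (forall a b c, (b < 0)%R -> g (a, b, c) = 0) ->
  iter3 g = 6%:R%:E * iter3 (cone_density g).
Proof.
move=> gg g12 g23 gneg; refine (etrans (iter3_sym gg g12 g23) _).
have hh : nnmeas (cut (@chain_bac R) g) by exact: (nnmeas_cut (@measurable_chain_bac R) gg).
have kk := nnmeas_cone_density gg.
refine (congr1 (fun x => 6%:R%:E * x) _).
(* [cone_slice] works at fixed [c], so on both sides the third coordinate is first moved to the
   outermost integral. *)
refine (etrans (iter3_swap23 hh) (etrans (iter3_swap12 (nnmeas_swap23 hh)) _)).
refine (esym (etrans (iter3_swap12 kk) (etrans (iter3_swap23 (nnmeas_swap12 kk)) _))).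
refine (etrans (iter3_swap12 (nnmeas_swap23 (nnmeas_swap12 kk))) _).
by apply: eq_integral => c _; exact: (esym (cone_slice c gg gneg)).
Qed.
End cone_coordinates.

(** * Derivatives and one-dimensional integrals *)

Section one_variable_calculus.
Variable R : realType.
Implicit Types (f g F : R -> R) (x a b d : R).
Local Notation mu := (@lebesgue_measure R).

Definition deriv_at f x d : Prop := is_derive x (1 : R) f d.

Lemma deriv_eq f x d d' : deriv_at f x d -> d = d' -> deriv_at f x d'.
Proof. by move=> h <-. Qed.

Lemma deriv_cst (c x : R) : deriv_at (fun=> c) x 0.
Proof. exact: is_derive_cst. Qed.

Lemma deriv_id x : deriv_at (fun y => y) x 1.
Proof. exact: is_derive_id. Qed.

Lemma derivD f g x d e : deriv_at f x d -> deriv_at g x e ->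
  deriv_at (fun y => f y + g y) x (d + e).
Proof. exact: is_deriveD. Qed.

Lemma derivN f x d : deriv_at f x d -> deriv_at (fun y => - f y) x (- d).
Proof. exact: is_deriveN. Qed.

Lemma derivM f g x d e : deriv_at f x d -> deriv_at g x e ->
  deriv_at (fun y => f y * g y) x (f x * e + g x * d).
Proof. exact: is_deriveM. Qed.

Lemma derivX f n x d : deriv_at f x d ->
  deriv_at (fun y => f y ^+ n) x (n%:R * f x ^+ n.-1 * d).
Proof.
move=> h; have := is_deriveX n h; rewrite /deriv_at.
by rewrite (_ : f ^+ n = (fun y => f y ^+ n)) //; apply/funext => y; rewrite fctE.
Qed.

Lemma derivV f x d : f x != 0 -> deriv_at f x d ->
  deriv_at (fun y => (f y)^-1) x (- f x ^- 2 * d).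
Proof. by move=> f0 h; exact: is_deriveV. Qed.

Lemma deriv_comp f g x d e : deriv_at f (g x) d -> deriv_at g x e ->
  deriv_at (fun y => f (g y)) x (d * e).
Proof. by move=> h1 h2; exact: (is_derive1_comp h1 h2). Qed.

Lemma deriv_sqrt f x d : 0 < f x -> deriv_at f x d ->
  deriv_at (fun y => Num.sqrt (f y)) x ((2 * Num.sqrt (f x))^-1 * d).
Proof. by move=> f0; apply: deriv_comp; exact: is_derive1_sqrt. Qed.

Lemma deriv_ln f x d : 0 < f x -> deriv_at f x d ->
  deriv_at (fun y => ln (f y)) x ((f x)^-1 * d).
Proof. by move=> f0; apply: deriv_comp; exact: is_derive1_ln. Qed.

Lemma deriv_atan f x d : deriv_at f x d ->
  deriv_at (fun y => atan (f y)) x ((1 + f x ^+ 2)^-1 * d).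
Proof. by apply: deriv_comp; exact: is_derive1_atan. Qed.

Definition atanh x : R := ln ((1 + x) / (1 - x)) / 2.

Lemma deriv_atanh f x d : -1 < f x < 1 -> deriv_at f x d ->
  deriv_at (fun y => atanh (f y)) x ((1 - f x ^+ 2)^-1 * d).
Proof.
move=> /andP[f1 f2]; apply: deriv_comp; set t := f x in f1 f2 *.
have p1 : 0 < 1 - t by lra.
have p2 : 0 < 1 + t by lra.
have n1 : 1 - t != 0 by rewrite gt_eqF.
rewrite /atanh; apply: deriv_eq.
  apply: derivM; last exact: deriv_cst.
  apply: deriv_ln; first exact: divr_gt0.
  apply: derivM; first by apply: derivD; [exact: deriv_cst|exact: deriv_id].
  apply: derivV; first exact: n1.
  by apply: derivD; [exact: deriv_cst|apply: derivN; exact: deriv_id].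
cbn beta; field; rewrite n1 /=; apply/andP; split; rewrite gt_eqF //; nra.
Qed.

Lemma deriv_continuous f x d : deriv_at f x d -> {for x, continuous f}.
Proof.
move=> h; apply: differentiable_continuous; apply/derivable1_diffP.
by case: h.
Qed.

Lemma deriv_ge0_le F f a b : a <= b ->
  (forall x, a <= x <= b -> deriv_at F x (f x)) ->
  (forall x, a <= x <= b -> 0 <= f x) -> F a <= F b.
Proof.
move=> ab dF f0.
have cF : {within `[a, b], continuous F}.
  apply: continuous_in_subspaceT => x; rewrite inE /= in_itv /= => xab.
  exact: deriv_continuous (dF x xab).
have [|c cab E] := @MVT_segment R F f a b ab _ cF.
  by move=> x; rewrite in_itv /= => /andP[xa xb]; apply: dF; rewrite !ltW.
rewrite -subr_ge0 E mulr_ge0 ?subr_ge0 //.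
by apply: f0; move: cab; rewrite in_itv.
Qed.

Lemma integral_derive F f a b : a <= b ->
  (forall x, a <= x <= b -> deriv_at F x (f x)) ->
  (forall x, a <= x <= b -> {for x, continuous f}) ->
  (\int[mu]_(x in `[a, b]) (f x)%:E = (F b - F a)%:E)%E.
Proof.
rewrite le_eqVlt => /orP[/eqP <- _ _|ab dF cf].
  by rewrite set_itv1 integral_set1 subrr.
have cF x : a <= x <= b -> {for x, continuous F}.
  by move=> xab; exact: deriv_continuous (dF x xab).
rewrite (@continuous_FTC2 R f F a b ab) ?EFinB //.
- apply: continuous_in_subspaceT => x; rewrite inE /= in_itv /= => xab.
  exact: cf.
- split.
  + move=> x; rewrite in_itv /= => /andP[xa xb].
    have h : deriv_at F x (f x) by apply: dF; rewrite !ltW.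
    by case: h.
  + by apply: cvg_at_right_filter; apply: cF; rewrite lexx ltW.
  + by apply: cvg_at_left_filter; apply: cF; rewrite lexx ltW.
- move=> x; rewrite in_itv /= => /andP[xa xb].
  have h : deriv_at F x (f x) by apply: dF; rewrite !ltW.
  by rewrite derive1E; case: h.
Qed.

(* Values of [G] at the two endpoints are irrelevant. *)
Lemma integral_slice (G : R -> \bar R) F f a b : a <= b ->
  measurable_fun setT G -> (forall x, (0 <= G x)%E) ->
  (forall x, a <= x <= b -> 0 <= f x) ->
  (forall x, a < x < b -> G x = (f x)%:E) ->
  (forall x, x < a \/ b < x -> G x = 0%E) ->
  (forall x, a <= x <= b -> deriv_at F x (f x)) ->
  (forall x, a <= x <= b -> {for x, continuous f}) ->
  (\int[mu]_x G x = (F b - F a)%:E)%E.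
Proof.
move=> ab mG G0 f0 Gf Gz dF cf.
rewrite -(integral_derive ab dF cf) [RHS]integral_mkcond.
apply: (@integral_eq_off _ _ _ a b) => //.
- apply/(measurable_restrictT _ _).1; first exact: measurable_itv.
  apply/measurable_EFinP; apply: subspace_continuous_measurable_fun.
    exact: measurable_itv.
  apply: continuous_in_subspaceT => x; rewrite inE /= in_itv /= => xab.
  exact: cf.
- move=> x; rewrite patchE; case: ifPn => //; rewrite inE /= in_itv /= => xab.
  by rewrite lee_fin f0.
- move=> x xa xb; rewrite patchE; case: ifPn => [|nx].
    rewrite inE /= in_itv /= => /andP[ax bx]; apply: Gf.
    by rewrite !lt_neqAle eq_sym xa ax xb bx.
  apply: Gz; case: (ltP x a) => [?|ax]; first by left.
  right; rewrite ltNge; apply/negP => xleb; move: nx.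
  by rewrite notin_setE /= in_itv /= ax xleb.
Qed.
End one_variable_calculus.

(** Leaves only side conditions as goals: nonzero denominators, positive radicands, arguments of
    [atanh] between -1 and 1. *)
Ltac derivs := repeat first
  [ exact: deriv_id | exact: deriv_cst
  | apply: deriv_atanh | apply: deriv_atan | apply: deriv_sqrt
  | apply: derivN | apply: derivD | apply: derivX | apply: derivM | apply: derivV ].

(** * Volume along a line through a vertex *)

Section cone_columns.
Variables (R : realType) (y : R).
Hypotheses (y0 : 0 < y) (y1 : 1 < 3 * y ^+ 2) (y2 : 2 * y ^+ 2 < 1).
Implicit Types (m r z x : R).
Local Notation mu := (@lebesgue_measure R).

(** This is [|B|^2 - 1] for the vertex [B = (y, y, y)]. Below, [colS] and [colQ] are the coordinate
    sum and the squared length of the direction [(r, r m, 1)], [colE] is a quarter of the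
    discriminant of [colT] in [z], and [colBase] is the parameter at which the line crosses the
    polar plane. *)
Definition excess := 3 * y ^+ 2 - 1.
Definition colS m r := 1 + r * (1 + m).
Definition colQ m r := 1 + r ^+ 2 * (1 + m ^+ 2).
Definition colE m r := y ^+ 2 * colS m r ^+ 2 - excess * colQ m r.
(* [1 - |v|^2] at the point [v = y (1, 1, 1) - z (r, r m, 1)]. *)
Definition colT m r z := - excess + 2 * y * colS m r * z - colQ m r * z ^+ 2.
(* The hyperbolic tangent of the distance from the same point to the polar plane. *)
Definition colX m r z := (y * colS m r - excess / z) / Num.sqrt (colE m r).
Definition colBase m r := excess / (y * colS m r).

(** For [x = tanh s] this is the integral of [cosh^2] over [[0, s]]: the volume of height [s] above
    unit area of a plane. *)
Definition layer x := (x / (1 - x ^+ 2) + atanh x) / 2.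

Lemma excess_gt0 : 0 < excess.
Proof. by rewrite /excess subr_gt0. Qed.

Lemma excess_lt : excess < y ^+ 2.
Proof. by rewrite /excess; move: y2; lra. Qed.

Lemma colS_ge1 m r : 0 <= m -> 0 <= r -> 1 <= colS m r.
Proof. by move=> m0 r0; rewrite /colS lerDl mulr_ge0 // addr_ge0. Qed.

Lemma colQ_ge1 m r : 1 <= colQ m r.
Proof. by rewrite /colQ lerDl mulr_ge0 ?sqr_ge0 // addr_ge0 ?sqr_ge0. Qed.

Lemma colQ_le m r : 0 <= m -> 0 <= r -> colQ m r <= colS m r ^+ 2.
Proof.
move=> m0 r0; rewrite /colS /colQ -subr_ge0.
have -> : (1 + r * (1 + m)) ^+ 2 - (1 + r ^+ 2 * (1 + m ^+ 2)) =
  2 * (r * (1 + m)) + 2 * (r ^+ 2 * m) by ring.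
by rewrite addr_ge0 // !mulr_ge0 ?sqr_ge0 // addr_ge0.
Qed.

(** Combine [colQ <= colS^2] with [excess < y^2], which is [2 y^2 < 1] in disguise. Positivity means
    that the line really enters the ball. *)
Lemma colE_gt0 m r : 0 <= m -> 0 <= r -> 0 < colE m r.
Proof.
move=> m0 r0; have := colQ_le m0 r0; have := colS_ge1 m0 r0; have := colQ_ge1 m r.
have := excess_gt0; have := excess_lt; rewrite /colE.
set s := colS m r; set q := colQ m r; set e := excess => ey e0 q1 s1 qs.
have : e * q <= e * s ^+ 2 by rewrite ler_pM2l.
have : e * s ^+ 2 < y ^+ 2 * s ^+ 2 by rewrite ltr_pM2r // exprn_gt0 //; lra.
lra.
Qed.

Lemma colBase_gt0 m r : 0 <= m -> 0 <= r -> 0 < colBase m r.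
Proof.
move=> m0 r0; rewrite /colBase divr_gt0 ?excess_gt0 // mulr_gt0 //.
by have := colS_ge1 m0 r0; lra.
Qed.

Lemma colX_base m r : 0 <= m -> 0 <= r -> colX m r (colBase m r) = 0.
Proof.
move=> m0 r0; rewrite /colX /colBase; have := colS_ge1 m0 r0 => s1.
have en : excess != 0 by rewrite gt_eqF ?excess_gt0.
by rewrite invf_div mulrC [excess * _]mulrC divfK // subrr mulr0.
Qed.

(** Rests on [excess * T = z^2 E - (y S z - excess)^2]; hence [|X| < 1] wherever [T > 0], that is,
    inside the ball. *)
Lemma colX_sqr m r z : 0 <= m -> 0 <= r -> z != 0 ->
  1 - colX m r z ^+ 2 = excess * colT m r z / (z ^+ 2 * colE m r).
Proof.
move=> m0 r0 z0; have E0 := colE_gt0 m0 r0.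
rewrite /colX exprMn exprVn sqr_sqrtr ?ltW // /colT.
have En : colE m r != 0 by rewrite gt_eqF.
have -> : excess * (- excess + 2 * y * colS m r * z - colQ m r * z ^+ 2) =
    z ^+ 2 * colE m r - (y * colS m r * z - excess) ^+ 2 by rewrite /colE; ring.
by field; rewrite En z0.
Qed.

Lemma deriv_colX m r z : 0 <= m -> 0 <= r -> z != 0 ->
  deriv_at (colX m r) z (excess / (z ^+ 2 * Num.sqrt (colE m r))).
Proof.
move=> m0 r0 z0; have E0 := colE_gt0 m0 r0; rewrite /colX; apply: deriv_eq.
  derivs; exact: z0.
by cbn beta; field; rewrite z0 /= gt_eqF ?sqrtr_gt0.
Qed.

Lemma deriv_layer (f : R -> R) x d : -1 < f x < 1 -> deriv_at f x d ->
  deriv_at (fun z => layer (f z)) x ((1 - f x ^+ 2) ^- 2 * d).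
Proof.
move=> fx df; have n0 : 1 - f x ^+ 2 != 0.
  rewrite gt_eqF //; case/andP: fx => f1 f2; have : 0 < (1 - f x) * (1 + f x) by (apply: mulr_gt0; lra).
  lra.
apply: (@deriv_comp _ layer) => //; rewrite /layer; apply: deriv_eq.
  by derivs; [exact: n0|exact: fx].
by cbn beta; field; exact: n0.
Qed.

Lemma layer0 : layer 0 = 0.
Proof. by rewrite /layer /atanh mul0r add0r subr0 addr0 divr1 ln1 mul0r mul0r. Qed.

Lemma colX_bound m r z : 0 <= m -> 0 <= r -> 0 < z -> 0 < colT m r z ->
  -1 < colX m r z < 1.
Proof.
move=> m0 r0 z0 T0; have E0 := colE_gt0 m0 r0.
have zn : z != 0 by rewrite gt_eqF.
have : 0 < 1 - colX m r z ^+ 2.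
  rewrite (colX_sqr m0 r0 zn) divr_gt0 ?mulr_gt0 ?exprn_gt0 // ?excess_gt0 //.
by move=> h; rewrite -ltr_norml -(@ltr_pXn2r _ 2) ?nnegrE // expr1n real_normK ?num_real //; lra.
Qed.

(** The derivative of [layer (X z)] is [(1 - X^2)^-2 X'], which [colX_sqr] turns into [z^2 T^-2]
    times [E sqrt E / excess]. So [layer] of [X] is a primitive up to a factor free of [z], and it
    vanishes at the base. *)
Lemma integral_column m r z1 (G : R -> \bar R) : 0 <= m -> 0 <= r ->
  colBase m r <= z1 -> (forall z, colBase m r <= z <= z1 -> 0 < colT m r z) ->
  measurable_fun setT G -> (forall z, (0 <= G z)%E) ->
  (forall z, colBase m r < z < z1 -> G z = (z * z * r * (colT m r z) ^- 2)%:E) ->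
  (forall z, z < colBase m r \/ z1 < z -> G z = 0%E) ->
  (\int[mu]_z G z =
   (r * (excess / (colE m r * Num.sqrt (colE m r))) * layer (colX m r z1))%:E)%E.
Proof.
move=> m0 r0 z01 T0 mG G0 GE Gz.
have E0 := colE_gt0 m0 r0; have B0 := colBase_gt0 m0 r0.
pose k := r * (excess / (colE m r * Num.sqrt (colE m r))).
have zp z : colBase m r <= z <= z1 -> 0 < z by move=> /andP[bz _]; lra.
refine (etrans (@integral_slice _ G (fun z => k * layer (colX m r z))
  (fun z => z * z * r * (colT m r z) ^- 2) (colBase m r) z1 z01 mG G0 _ GE Gz _ _) _).
- move=> z /[dup] /zp z0 /T0 T1.
  by rewrite !mulr_ge0 ?invr_ge0 ?exprn_ge0 // ltW.
- move=> z /[dup] /zp z0 /T0 T1; have zn : z != 0 by rewrite gt_eqF.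
  apply: deriv_eq.
    apply: derivM; first exact: deriv_cst.
    apply: deriv_layer; last exact: (deriv_colX m0 r0 zn).
    exact: (colX_bound m0 r0 z0 T1).
  rewrite (colX_sqr m0 r0 zn) /k mulr0 addr0.
  have s2 : Num.sqrt (colE m r) ^+ 2 = colE m r by rewrite sqr_sqrtr // ltW.
  have sn : Num.sqrt (colE m r) != 0 by rewrite gt_eqF ?sqrtr_gt0.
  move: s2 sn; set E := colE m r; set sE := Num.sqrt E => s2 sn.
  rewrite -s2; field.
  by rewrite zn sn !gt_eqF ?T1 ?excess_gt0.
- move=> z /[dup] /zp z0 /T0 T1; apply: deriv_continuous; rewrite /colT.
  by derivs; rewrite expf_neq0 // gt_eqF.
- by rewrite (colX_base m0 r0) layer0 mulr0 subr0.
Qed.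
End cone_columns.

(** * The two integrations over the base *)

Section cone_surfaces.
Variables (R : realType) (y : R).
Hypotheses (y0 : 0 < y) (y1 : 1 < 3 * y ^+ 2) (y2 : 2 * y ^+ 2 < 1).
Implicit Types (m r z x : R).
Local Notation mu := (@lebesgue_measure R).
Local Notation excess := (excess y).
Local Notation colE := (colE y).
Local Notation colT := (colT y).

(** In the cube a column ends at [z = y], in a coordinate plane through the centre. The end point is
    an edge midpoint for [r = 0], a face centre for [r = 1], [m = 0], and the origin for
    [r = m = 1], so there [tipX] equals [tanh h], [tanh s] and [tanh t]. *)
Definition tipX m r := colX y m r y.
(** The factor of [d tipX / dr] that depends on [m] alone; the radial integration leaves its
    reciprocal behind. *)
Definition colW m := (1 - y ^+ 2) * (1 + m ^+ 2) + 2 * y ^+ 2 * m.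
Definition edgeK := Num.sqrt (1 - 2 * y ^+ 2).
(** The substitution that turns [edgeK dm / colW m] into [dT / (1 + T^2)]; it maps [[0, 1]] to
    [[0, edgeK]], and [edgeK] will be [tan (pi / p)]. *)
Definition tipT m := edgeK * m / (1 - y ^+ 2 + y ^+ 2 * m).

Lemma colW_gt0 m : 0 <= m -> 0 < colW m.
Proof.
move=> m0; rewrite /colW; have n0 : 0 < 1 - y ^+ 2 by move: y2 (sqr_ge0 y); lra.
apply: ltr_pwDl; last by rewrite mulr_ge0 // mulr_ge0 ?sqr_ge0.
by rewrite mulr_gt0 // ltr_pwDl ?sqr_ge0.
Qed.

Lemma edgeK_gt0 : 0 < edgeK.
Proof. by rewrite /edgeK sqrtr_gt0 subr_gt0. Qed.

Lemma edgeK_sqr : edgeK ^+ 2 = 1 - 2 * y ^+ 2.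
Proof. by rewrite /edgeK sqr_sqrtr // subr_ge0 ltW. Qed.

Lemma ratio_lt1_sqr (u : R) : u ^+ 2 < 1 -> -1 < u < 1.
Proof. by move=> h; rewrite -ltr_norml -(@ltr_pXn2r _ 2) ?nnegrE // expr1n real_normK ?num_real. Qed.

Lemma colT_tip_gt0 m r : 0 <= m <= 1 -> 0 <= r <= 1 -> 0 < colT m r y.
Proof.
move=> /andP[m0 m1] /andP[r0 r1].
have -> : colT m r y = 1 - 2 * y ^+ 2 + y ^+ 2 * (r * (2 - r)) + y ^+ 2 * (r * m * (2 - r * m)).
  by rewrite /colT /excess /colS /colQ; ring.
have rm : r * m <= 1 by rewrite -[leRHS]mulr1 ler_pM.
have h1 : 0 <= y ^+ 2 * (r * (2 - r)) by apply: mulr_ge0; [exact: sqr_ge0|apply: mulr_ge0; lra].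
have h2 : 0 <= y ^+ 2 * (r * m * (2 - r * m)).
  by apply: mulr_ge0; [exact: sqr_ge0|apply: mulr_ge0; [exact: mulr_ge0|lra]].
by move: y2; lra.
Qed.

Lemma colBase_le_tip m r : 0 <= m -> 0 <= r -> colBase y m r <= y.
Proof.
move=> m0 r0; have s1 := colS_ge1 m0 r0.
rewrite /colBase ler_pdivrMr ?mulr_gt0 //; last by lra.
have := excess_lt y2; have : y ^+ 2 * 1 <= y ^+ 2 * colS m r by rewrite ler_wpM2l ?sqr_ge0.
have -> : y * (y * colS m r) = y ^+ 2 * colS m r by ring.
lra.
Qed.

Lemma colT_base_gt0 m r : 0 <= m -> 0 <= r -> 0 < colT m r (colBase y m r).
Proof.
move=> m0 r0; have z0 := colBase_gt0 y0 y1 m0 r0; have E0 := colE_gt0 y1 y2 m0 r0.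
have zn : colBase y m r != 0 by rewrite gt_eqF.
have := colX_sqr y1 y2 m0 r0 zn; rewrite colX_base // expr0n subr0.
move/(congr1 (fun t => t * (colBase y m r ^+ 2 * colE m r))).
rewrite mul1r divfK; last by rewrite mulf_neq0 ?expf_neq0 // gt_eqF.
move=> E; have : 0 < excess * colT m r (colBase y m r).
  by rewrite -E mulr_gt0 // exprn_gt0.
by rewrite pmulr_rgt0 // excess_gt0.
Qed.

(** [colT] is a concave quadratic in [z], hence lies above its chord from [a] to [b]. *)
Lemma colT_between m r a b z : 0 < colT m r a -> 0 < colT m r b -> a <= z <= b ->
  0 < colT m r z.
Proof.
move=> Ta Tb /andP[az zb]; move: az; rewrite le_eqVlt => /orP[/eqP <- //|az].
have ba : 0 < b - a by lra.
rewrite -(pmulr_lgt0 _ ba).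
have -> : colT m r z * (b - a) = colT m r a * (b - z) + colT m r b * (z - a) +
    colQ m r * ((z - a) * (b - z) * (b - a)) by rewrite /colT; ring.
rewrite ltr_pwDl // ?ltr_wpDl ?mulr_ge0 ?mulr_gt0 //; try lra.
by have := colQ_ge1 m r; lra.
Qed.

Lemma tipX_bound m r : 0 <= m <= 1 -> 0 <= r <= 1 -> -1 < tipX m r < 1.
Proof.
move=> mm rr; have T0 := colT_tip_gt0 mm rr; case/andP: mm => m0 _; case/andP: rr => r0 _.
exact: colX_bound.
Qed.

Lemma tipX_ge0 m r : 0 <= m -> 0 <= r -> 0 <= tipX m r.
Proof.
move=> m0 r0; rewrite /tipX /colX divr_ge0 ?sqrtr_ge0 // subr_ge0.
rewrite ler_pdivrMr //; have s1 := colS_ge1 m0 r0.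
have := excess_lt y2; have : y ^+ 2 * 1 <= y ^+ 2 * colS m r by rewrite ler_wpM2l ?sqr_ge0.
have -> : y * colS m r * y = y ^+ 2 * colS m r by ring.
lra.
Qed.

Lemma deriv_tipX m r : 0 <= m -> 0 <= r ->
  deriv_at (tipX m) r (excess * colW m * r / (y * (colE m r * Num.sqrt (colE m r)))).
Proof.
move=> m0 r0; have E0 := colE_gt0 y1 y2 m0 r0.
have sn : Num.sqrt (colE m r) != 0 by rewrite gt_eqF ?sqrtr_gt0.
have yn : y != 0 by rewrite gt_eqF.
have s2 : Num.sqrt (colE m r) ^+ 2 = colE m r by rewrite sqr_sqrtr // ltW.
rewrite /tipX /colX /colE /colS /colQ; apply: deriv_eq.
  by derivs; [exact: sn|exact: E0].
cbn beta; rewrite -/(colS m r) -/(colQ m r) -/(colE m r).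
set sE := Num.sqrt (colE m r) in sn s2 *.
have -> : colE m r = sE ^+ 2 by [].
(* Clearing [y] and the cube of the root leaves only even powers of the root, so a polynomial
   identity remains. *)
apply: (mulfI (expf_neq0 3 sn)); apply: (mulfI yn).
have s2' : sE ^+ 2 = y ^+ 2 * (1 + r * (1 + m)) ^+ 2 - (3 * y ^+ 2 - 1) * (1 + r ^+ 2 * (1 + m ^+ 2)).
  by rewrite s2.
transitivity (- (y ^+ 2 * (1 + r * (1 + m)) - (3 * y ^+ 2 - 1)) *
   (y ^+ 2 * (1 + r * (1 + m)) * (1 + m) - (3 * y ^+ 2 - 1) * r * (1 + m ^+ 2)) +
   y ^+ 2 * (1 + m) * sE ^+ 2).
  by rewrite /excess /colS /colQ; field; rewrite sn yn.
have -> : y * (sE ^+ 3 * (excess * colW m * r / (y * (sE ^+ 2 * sE)))) = excess * colW m * r.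
  by field; rewrite sn yn.
by rewrite s2' /colW /excess; ring.
Qed.

Lemma layer_ge0 x : 0 <= x < 1 -> 0 <= layer x.
Proof.
move=> /andP[x0 x1]; have p1 : 0 < 1 - x by lra.
have p2 : 0 < 1 - x ^+ 2.
  have -> : 1 - x ^+ 2 = (1 - x) * (1 + x) by ring.
  by apply: mulr_gt0; lra.
rewrite /layer divr_ge0 // addr_ge0 //; first by rewrite divr_ge0 // ltW.
by rewrite /atanh divr_ge0 // ln_ge0 // ler_pdivlMr //; lra.
Qed.


(** By [deriv_tipX], [r excess / (E sqrt E) dr] is [y / colW m] times [d tipX]. *)
Lemma integral_radius_cst m (P : R) (G : R -> \bar R) : 0 <= m -> 0 <= P ->
  measurable_fun setT G -> (forall r, (0 <= G r)%E) ->
  (forall r, 0 < r < 1 ->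
    G r = (r * (excess / (colE m r * Num.sqrt (colE m r))) * P)%:E) ->
  (forall r, r < 0 \/ 1 < r -> G r = 0%E) ->
  (\int[mu]_r G r = (y / colW m * P * (tipX m 1 - tipX m 0))%:E)%E.
Proof.
move=> m0 P0 mG G0 GE Gz.
have W0 := colW_gt0 m0.
refine (etrans (@integral_slice _ G (fun r => y / colW m * P * tipX m r)
  (fun r => r * (excess / (colE m r * Num.sqrt (colE m r))) * P) 0 1 ler01 mG G0 _ GE Gz _ _) _).
- move=> r /andP[r0 _]; have E0 := colE_gt0 y1 y2 m0 r0.
  by rewrite !mulr_ge0 ?invr_ge0 ?mulr_ge0 ?sqrtr_ge0 ?(ltW (excess_gt0 y1)) // ltW.
- move=> r /andP[r0 _]; have E0 := colE_gt0 y1 y2 m0 r0.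
  have sn : Num.sqrt (colE m r) != 0 by rewrite gt_eqF ?sqrtr_gt0.
  apply: deriv_eq; first by apply: derivM; [exact: deriv_cst|exact: deriv_tipX].
  by cbn beta; field; rewrite sn !gt_eqF.
- move=> r /andP[r0 _]; have E0 := colE_gt0 y1 y2 m0 r0.
  apply: deriv_continuous; rewrite /colE /colS /colQ; derivs; last exact: E0.
  by rewrite mulf_neq0 // gt_eqF ?sqrtr_gt0.
- by rewrite mulrBr.
Qed.

(** As in the case of constant height the measure is a multiple of [d tipX], and [2 layer x] is the
    derivative of [x atanh x]. *)
Lemma integral_radius_tip m (G : R -> \bar R) : 0 <= m <= 1 ->
  measurable_fun setT G -> (forall r, (0 <= G r)%E) ->
  (forall r, 0 < r < 1 ->
    G r = (r * (excess / (colE m r * Num.sqrt (colE m r))) * layer (tipX m r))%:E) ->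
  (forall r, r < 0 \/ 1 < r -> G r = 0%E) ->
  (\int[mu]_r G r = (y / colW m / 2 *
     (tipX m 1 * atanh (tipX m 1) - tipX m 0 * atanh (tipX m 0)))%:E)%E.
Proof.
move=> mm mG G0 GE Gz; have m0 : 0 <= m by case/andP: mm.
have W0 := colW_gt0 m0.
refine (etrans (@integral_slice _ G
  (fun r => y / colW m / 2 * (tipX m r * atanh (tipX m r)))
  (fun r => r * (excess / (colE m r * Num.sqrt (colE m r))) * layer (tipX m r))
  0 1 ler01 mG G0 _ GE Gz _ _) _).
- move=> r rr; case/andP: (rr) => r0 _; have E0 := colE_gt0 y1 y2 m0 r0.
  apply: mulr_ge0.
    by rewrite !mulr_ge0 ?invr_ge0 ?mulr_ge0 ?sqrtr_ge0 ?(ltW (excess_gt0 y1)) ?(ltW E0).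
  by apply: layer_ge0; rewrite tipX_ge0 //; case/andP: (tipX_bound mm rr).
- move=> r rr; case/andP: (rr) => r0 _; have E0 := colE_gt0 y1 y2 m0 r0.
  have sn : Num.sqrt (colE m r) != 0 by rewrite gt_eqF ?sqrtr_gt0.
  have xb := tipX_bound mm rr.
  apply: deriv_eq.
    apply: derivM; first exact: deriv_cst.
    apply: derivM; first exact: deriv_tipX.
    by apply: deriv_atanh; [exact: xb|exact: deriv_tipX].
  cbn beta; rewrite /layer; field.
  rewrite sn !gt_eqF //; case/andP: xb => b1 b2.
  have -> : 1 - tipX m r ^+ 2 = (1 - tipX m r) * (1 + tipX m r) by ring.
  by apply: mulr_gt0; lra.
- move=> r rr; case/andP: (rr) => r0 _; have E0 := colE_gt0 y1 y2 m0 r0.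
  apply: deriv_continuous; apply: derivM; last first.
    by apply: deriv_layer; [exact: tipX_bound|exact: deriv_tipX].
  rewrite /colE /colS /colQ; derivs; last exact: E0.
  by rewrite mulf_neq0 // gt_eqF ?sqrtr_gt0.
- by rewrite mulrBr.
Qed.

Lemma tipX0 m : tipX m 0 = edgeK / y.
Proof.
rewrite /tipX /colX /colE /colS /colQ !mul0r expr0n !mul0r addr0 expr1n !mulr1.
have -> : y ^+ 2 - excess = 1 - 2 * y ^+ 2 by rewrite /excess; ring.
have e2 := edgeK_sqr; have e0 := edgeK_gt0; rewrite -/edgeK.
have -> : y - excess / y = (1 - 2 * y ^+ 2) / y by rewrite /excess; field; rewrite gt_eqF.
by rewrite -e2; field; rewrite !gt_eqF.
Qed.

Lemma tip_den_gt0 m : 0 <= m -> 0 < 1 - y ^+ 2 + y ^+ 2 * m.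
Proof.
move=> m0; have : 0 <= y ^+ 2 * m by rewrite mulr_ge0 ?sqr_ge0.
by move: y2 (sqr_ge0 y); lra.
Qed.

Lemma tipX1 m : tipX m 1 = (1 - y ^+ 2 + y ^+ 2 * m) / (y * Num.sqrt (colE m 1)).
Proof.
rewrite /tipX /colX /colS mul1r invfM mulrA; congr (_ * _).
by rewrite /excess; field; rewrite gt_eqF.
Qed.

Lemma colE1 m : colE m 1 = 2 * colW m - m ^+ 2.
Proof. by rewrite /colW /colE /colS /colQ /excess; ring. Qed.

(** The relation [E(m, 1) + m^2 = 2 colW m] makes the denominator [1 + (m / sqrt E)^2] of the
    arctangent proportional to [colW m / E]. *)
Lemma deriv_tip_arc m : 0 <= m ->
  deriv_at (fun m => atan (m / Num.sqrt (colE m 1))) m (y / colW m * tipX m 1).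
Proof.
move=> m0; have E0 := colE_gt0 y1 y2 m0 ler01; have W0 := colW_gt0 m0.
have sn : Num.sqrt (colE m 1) != 0 by rewrite gt_eqF ?sqrtr_gt0.
have yn : y != 0 by rewrite gt_eqF.
have s2 : Num.sqrt (colE m 1) ^+ 2 = colE m 1 by rewrite sqr_sqrtr // ltW.
rewrite tipX1 /colE /colS /colQ; apply: deriv_eq.
  by derivs; [exact: sn|exact: E0].
cbn beta; rewrite -/(colS m 1) -/(colQ m 1) -/(colE m 1).
set sE := Num.sqrt (colE m 1) in sn s2 *.
have h : sE ^+ 2 + m ^+ 2 = 2 * colW m by rewrite s2 colE1; ring.
have W2 : sE ^+ 2 + m ^+ 2 != 0 by rewrite h gt_eqF ?mulr_gt0.
have -> : colW m = (sE ^+ 2 + m ^+ 2) / 2 by rewrite h; field.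
have s2' : sE ^+ 2 = 2 - 2 * y ^+ 2 + 4 * y ^+ 2 * m + (1 - 2 * y ^+ 2) * m ^+ 2.
  by rewrite s2 colE1 /colW; ring.
transitivity ((2 * sE ^+ 2 - m * (4 * y ^+ 2 + 2 * (1 - 2 * y ^+ 2) * m)) / (2 * (sE ^+ 2 + m ^+ 2) * sE)).
  by rewrite /excess /colS /colQ; field; rewrite sn W2.
rewrite {1}s2'; field; by rewrite sn W2 yn.
Qed.

Lemma deriv_tipT m : 0 <= m ->
  deriv_at tipT m (edgeK * (1 - y ^+ 2) / (1 - y ^+ 2 + y ^+ 2 * m) ^+ 2).
Proof.
move=> m0; have D0 := tip_den_gt0 m0; rewrite /tipT; apply: deriv_eq.
  by derivs; rewrite gt_eqF.
by cbn beta; field; rewrite gt_eqF.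
Qed.

Lemma tipT_sqr m : 0 <= m ->
  1 + tipT m ^+ 2 = (1 - y ^+ 2) * colW m / (1 - y ^+ 2 + y ^+ 2 * m) ^+ 2.
Proof.
move=> m0; have D0 := tip_den_gt0 m0; rewrite /tipT exprMn exprMn edgeK_sqr /colW.
by field; rewrite gt_eqF.
Qed.

Lemma deriv_tip_angle m : 0 <= m ->
  deriv_at (fun m => atan (tipT m)) m (y / colW m * (edgeK / y)).
Proof.
move=> m0; have D0 := tip_den_gt0 m0; have W0 := colW_gt0 m0.
have n0 : 0 < 1 - y ^+ 2 by move: y2 (sqr_ge0 y); lra.
apply: deriv_eq; first by apply: deriv_atan; exact: deriv_tipT.
by rewrite tipT_sqr //; field; rewrite !gt_eqF.
Qed.

Lemma tipT1 : tipT 1 = edgeK.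
Proof. by rewrite /tipT !mulr1 subrK divr1. Qed.

Lemma tipT0 : tipT 0 = 0.
Proof. by rewrite /tipT mulr0 mul0r. Qed.

Lemma colW_continuous m : 0 <= m -> {for m, continuous (fun m => y / colW m)}.
Proof.
move=> m0; have W0 := colW_gt0 m0.
by apply: deriv_continuous; rewrite /colW; derivs; rewrite gt_eqF.
Qed.

(** Both ends of the radial integral have arctangents as primitives in [m]; at [m = 1] they will be
    [pi / 6] and [pi / p]. Six such sectors give [pi - 6 pi / p], the area of a triangle with angles
    [2 pi / p]. *)
Lemma integral_cap (P : R) (G : R -> \bar R) : 0 <= P ->
  measurable_fun setT G -> (forall m, (0 <= G m)%E) ->
  (forall m, 0 < m < 1 -> G m = (y / colW m * P * (tipX m 1 - tipX m 0))%:E) ->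
  (forall m, m < 0 \/ 1 < m -> G m = 0%E) ->
  (\int[mu]_m G m = (P * (atan (Num.sqrt 3)^-1 - atan edgeK))%:E)%E.
Proof.
move=> P0 mG G0 GE Gz.
refine (etrans (@integral_slice _ G
  (fun m => P * (atan (m / Num.sqrt (colE m 1)) - atan (tipT m)))
  (fun m => y / colW m * P * (tipX m 1 - tipX m 0)) 0 1 ler01 mG G0 _ GE Gz _ _) _).
- move=> m /andP[m0 m1]; have W0 := colW_gt0 m0.
  rewrite !mulr_ge0 ?invr_ge0 ?(ltW W0) ?(ltW y0) // subr_ge0.
  apply: (@deriv_ge0_le _ _ (fun r => excess * colW m * r / (y * (colE m r * Num.sqrt (colE m r))))).
  + exact: ler01.
  + by move=> r /andP[r0 _]; exact: deriv_tipX.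
  + move=> r /andP[r0 _]; have E0 := colE_gt0 y1 y2 m0 r0.
    by rewrite !mulr_ge0 ?invr_ge0 ?mulr_ge0 ?sqrtr_ge0 ?(ltW (excess_gt0 y1)) ?(ltW W0) ?(ltW y0) ?(ltW E0).
- move=> m /andP[m0 m1]; have W0 := colW_gt0 m0.
  apply: deriv_eq.
    apply: derivM; first exact: deriv_cst.
    by apply: derivD; [exact: deriv_tip_arc|apply: derivN; exact: deriv_tip_angle].
  by rewrite tipX0; ring.
- move=> m /andP[m0 m1]; have W0 := colW_gt0 m0; have E0 := colE_gt0 y1 y2 m0 ler01.
  apply: deriv_continuous.
  have -> : (fun m => y / colW m * P * (tipX m 1 - tipX m 0)) =
     (fun m => y / colW m * P * ((1 - y ^+ 2 + y ^+ 2 * m) / (y * Num.sqrt (colE m 1)) - edgeK / y)).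
    by apply/funext => t; rewrite tipX0 tipX1.
  rewrite /colW /colE /colS /colQ; derivs.
  + by rewrite gt_eqF.
  + by rewrite mulf_neq0 // gt_eqF ?sqrtr_gt0.
  + exact: E0.
- rewrite tipT1 tipT0 mul0r !atan0 subrr mulr0 subr0 mul1r.
  by have -> : colE 1 1 = 3 by rewrite colE1 /colW; ring.
Qed.
End cone_surfaces.

(** * The prism over a truncation triangle and the octant of the cube *)

Section cone_bodies.
Variables (R : realType) (y : R).
Hypotheses (y0 : 0 < y) (y1 : 1 < 3 * y ^+ 2) (y2 : 2 * y ^+ 2 < 1).
Implicit Types (m r z x : R) (v : R * R * R).
Local Notation mu := (@lebesgue_measure R).
Local Notation excess := (excess y).
Local Notation colE := (colE y).
Local Notation colT := (colT y).
Local Notation colX := (colX y).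
Local Notation colBase := (colBase y).
Local Notation tipX := (tipX y).
Local Notation colW := (colW y).

(* [1 - |x|^2] and [1 - <x, B>] at the point [x = B - v], where [B = (y, y, y)]. *)
Definition coneT v : R := 1 - ((y - v.1.1) ^+ 2 + (y - v.1.2) ^+ 2 + (y - v.2) ^+ 2).
Definition coneD v : R := 1 - y * ((y - v.1.1) + (y - v.1.2) + (y - v.2)).

Lemma coneT_col m r c : coneT (c * r, c * r * m, c) = colT m r c.
Proof. by rewrite /coneT /colT /excess /colS /colQ /=; ring. Qed.

Lemma coneD_col m r c : coneD (c * r, c * r * m, c) = y * colS m r * c - excess.
Proof. by rewrite /coneD /excess /colS /=; ring. Qed.

Lemma measurable_coneT : measurable_fun setT coneT.
Proof.
apply: measurable_funB; first exact: measurable_cst.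
apply: measurable_funD; first apply: measurable_funD.
- by apply: measurable_funX; apply: measurable_funB; [exact: measurable_cst|exact: measurable_fst3].
- by apply: measurable_funX; apply: measurable_funB; [exact: measurable_cst|exact: measurable_snd3].
- by apply: measurable_funX; apply: measurable_funB; [exact: measurable_cst|exact: measurable_thd3].
Qed.

Lemma measurable_coneD : measurable_fun setT coneD.
Proof.
apply: measurable_funB; first exact: measurable_cst.
apply: measurable_funM; first exact: measurable_cst.
apply: measurable_funD; first apply: measurable_funD.
- by apply: measurable_funB; [exact: measurable_cst|exact: measurable_fst3].
- by apply: measurable_funB; [exact: measurable_cst|exact: measurable_snd3].
- by apply: measurable_funB; [exact: measurable_cst|exact: measurable_thd3].
Qed.

Lemma measurable_invr : measurable_fun setT (fun t : R => t^-1).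
Proof.
have -> : [set: R] = [set 0] `|` ~` [set 0] by rewrite setUv.
apply/measurable_funU => //; first exact: measurableC.
split; first exact: measurable_fun_set1.
apply: open_continuous_measurable_fun.
  by apply: closed_openC; exact: (@closed_eq _ (0 : R)).
by move=> t; rewrite inE /= => /eqP t0; exact: inv_continuous.
Qed.

Definition cone_weight (P : R * R * R -> bool) v : \bar R :=
  if P v then ((coneT v) ^- 2)%:E else 0%E.

Lemma nnmeas_cone_weight P : measurable_fun setT P -> nnmeas (cone_weight P).
Proof.
move=> mP; split; last first.
  by move=> v; rewrite /cone_weight; case: ifP => // _; rewrite lee_fin invr_ge0 sqr_ge0.
apply: measurable_fun_ifT => //.
apply/measurable_EFinP; apply: (@measurableT_comp _ _ _ _ _ _ (fun t : R => t^-1)).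
  exact: measurable_invr.
by apply: measurable_funX; exact: measurable_coneT.
Qed.

(** The last inequality is [D^2 / (excess T) <= t^2 / (1 - t^2)], a bound for the squared hyperbolic
    sine of the distance to the polar plane when [t] is the hyperbolic tangent of the height. The
    only walls are three faces through the vertex and the polar plane; the other faces of the cube
    are ignored. *)
Definition in_cap (t : R) v :=
  [&& 0 <= v.1.1, 0 <= v.1.2, 0 <= v.2, 0 <= coneD v, 0 < coneT v &
      coneD v ^+ 2 * (1 - t ^+ 2) <= excess * t ^+ 2 * coneT v].

Definition in_cell v :=
  [&& 0 <= v.1.1 <= y, 0 <= v.1.2 <= y, 0 <= v.2 <= y, 0 <= coneD v & 0 < coneT v].

Let mf := @measurable_fst3 R.
Let ms := @measurable_snd3 R.
Let mt := @measurable_thd3 R.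

Lemma measurable_in_cap t : measurable_fun setT (in_cap t).
Proof.
apply: measurable_and; first by apply: measurable_fun_ler; [exact: measurable_cst|exact: mf].
apply: measurable_and; first by apply: measurable_fun_ler; [exact: measurable_cst|exact: ms].
apply: measurable_and; first by apply: measurable_fun_ler; [exact: measurable_cst|exact: mt].
apply: measurable_and; first by apply: measurable_fun_ler; [exact: measurable_cst|exact: measurable_coneD].
apply: measurable_and; first by apply: measurable_fun_ltr; [exact: measurable_cst|exact: measurable_coneT].
apply: measurable_fun_ler; apply: measurable_funM.
- by apply: measurable_funX; exact: measurable_coneD.
- exact: measurable_cst.
- exact: measurable_cst.
- exact: measurable_coneT.
Qed.

Lemma measurable_in_cell : measurable_fun setT in_cell.
Proof.
have sl (f : R * R * R -> R) : measurable_fun setT f -> measurable_fun setT (fun v => 0 <= f v <= y).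
  by move=> mm; apply: measurable_and; apply: measurable_fun_ler => //; exact: measurable_cst.
apply: measurable_and; first exact: sl mf.
apply: measurable_and; first exact: sl ms.
apply: measurable_and; first exact: sl mt.
apply: measurable_and; first by apply: measurable_fun_ler; [exact: measurable_cst|exact: measurable_coneD].
by apply: measurable_fun_ltr; [exact: measurable_cst|exact: measurable_coneT].
Qed.

Lemma integral_zero (F : R -> \bar R) : (forall x, F x = 0%E) -> (\int[mu]_x F x = 0)%E.
Proof. by move=> F0; apply: integral0_eq => x _; exact: F0. Qed.

(** Common treatment of both bodies: on each column [P] holds from the polar plane up to [z1 m r].
    Its values at the two ends are left open, being negligible. *)
Section columns.
Variables (P : R * R * R -> bool) (z1 : R -> R -> R).
Hypothesis mP : measurable_fun setT P.
Hypothesis z1_base : forall m r, 0 <= m < 1 -> 0 < r < 1 -> colBase m r <= z1 m r.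
Hypothesis z1_T : forall m r, 0 <= m < 1 -> 0 < r < 1 -> 0 < colT m r (z1 m r).
Hypothesis P_in : forall m r c, 0 <= m < 1 -> 0 < r < 1 -> 0 < c ->
  colBase m r < c < z1 m r -> P (c * r, c * r * m, c).
Hypothesis P_out : forall m r c, 0 <= m < 1 -> 0 < r < 1 -> 0 < c ->
  c < colBase m r \/ z1 m r < c -> P (c * r, c * r * m, c) = false.

Let K := cone_density (cone_weight P).
Let nK : nnmeas K.
Proof. by apply: nnmeas_cone_density; exact: nnmeas_cone_weight. Qed.

Lemma column_value m r : 0 <= m < 1 -> 0 < r < 1 ->
  (\int[mu]_c K (m, r, c) =
   (r * (excess / (colE m r * Num.sqrt (colE m r))) * layer (colX m r (z1 m r)))%:E)%E.
Proof.
move=> mm rr; have m0 : 0 <= m by case/andP: mm.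
have m1 : m < 1 by case/andP: mm.
have r0 : 0 < r by case/andP: rr.
have r1 : r < 1 by case/andP: rr.
have B0 := colBase_gt0 y0 y1 m0 (ltW r0).
apply: (integral_column y0 y1 y2 m0 (ltW r0) (z1_base mm rr)).
- by move=> z; apply: (colT_between (colT_base_gt0 y0 y1 y2 m0 (ltW r0)) (z1_T mm rr)).
- exact: nnmeas_slice3.
- by move=> z; apply nK.2.
- move=> z /andP[bz zz]; have z0 : 0 < z by lra.
  rewrite /K /cone_density /= m0 m1 r0 r1 z0 /cone_weight P_in ?bz //.
  by rewrite coneT_col -EFinM.
- move=> z zz; rewrite /K /cone_density /= m0 m1 r0 r1 /=.
  by case: ifP => // z0; rewrite /cone_weight P_out // mule0.
Qed.

Lemma column_out_r m r : r < 0 \/ 1 < r -> (\int[mu]_c K (m, r, c) = 0)%E.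
Proof.
move=> rr; apply: integral_zero => c; rewrite /K /cone_density /=.
by case: ifP => // /and5P[_ _ r0 r1 _]; exfalso; case: rr; lra.
Qed.

Lemma column_out_m m : m < 0 \/ 1 < m ->
  (\int[mu]_r \int[mu]_c K (m, r, c) = 0)%E.
Proof.
move=> mm; apply: integral_zero => r; apply: integral_zero => c; rewrite /K /cone_density /=.
by case: ifP => // /and5P[m0 m1 _ _ _]; exfalso; case: mm; lra.
Qed.
End columns.

(** The solution [z] of [colX m r z = t]. *)
Definition capTop (t m r : R) := excess / (y * colS m r - t * Num.sqrt (colE m r)).

Lemma capTop_den t m r : 0 <= t < 1 -> 0 <= m -> 0 <= r ->
  0 < y * colS m r - t * Num.sqrt (colE m r).
Proof.
move=> /andP[t0 t1] m0 r0; have E0 := colE_gt0 y1 y2 m0 r0.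
have s1 := colS_ge1 m0 r0; have q1 := colQ_ge1 m r; have e0 := excess_gt0 y1.
have ys : 0 < y * colS m r by rewrite mulr_gt0 //; lra.
have lt1 : Num.sqrt (colE m r) < y * colS m r.
  rewrite -(@ltr_pXn2r _ 2) ?nnegrE ?sqrtr_ge0 // ?ltW //.
  rewrite sqr_sqrtr ?ltW // exprMn /colE ltrBlDr ltrDl mulr_gt0 //; lra.
have s0 : 0 < Num.sqrt (colE m r) by rewrite sqrtr_gt0.
have : t * Num.sqrt (colE m r) <= 1 * Num.sqrt (colE m r) by rewrite ler_pM2r // ltW.
by rewrite subr_gt0; lra.
Qed.

Lemma capTop_gt0 t m r : 0 <= t < 1 -> 0 <= m -> 0 <= r -> 0 < capTop t m r.
Proof. by move=> tt m0 r0; rewrite divr_gt0 ?excess_gt0 ?capTop_den. Qed.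

Lemma colX_capTop t m r : 0 <= t < 1 -> 0 <= m -> 0 <= r -> colX m r (capTop t m r) = t.
Proof.
move=> tt m0 r0; have E0 := colE_gt0 y1 y2 m0 r0.
have s0 : Num.sqrt (colE m r) != 0 by rewrite gt_eqF ?sqrtr_gt0.
have en : excess != 0 by rewrite gt_eqF ?excess_gt0.
rewrite /colX /capTop invf_div mulrC [excess * _]mulrC divfK // opprB addrC subrK.
by rewrite mulrC mulfK.
Qed.

Lemma iter3_cap t : 0 <= t < 1 -> iter3 (cone_density (cone_weight (in_cap t))) =
  (layer t * (atan (Num.sqrt 3)^-1 - atan (edgeK y)))%:E.
Proof.
move=> tt; have [t0 t1] : 0 <= t /\ t < 1 by case/andP: tt.
have mP := measurable_in_cap t; have e0 := excess_gt0 y1.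
have nK := nnmeas_cone_density (nnmeas_cone_weight mP).
have t2 : 0 < 1 - t ^+ 2.
  have -> : 1 - t ^+ 2 = (1 - t) * (1 + t) by ring.
  by apply: mulr_gt0; lra.
have zb m r : 0 <= m < 1 -> 0 < r < 1 -> colBase m r <= capTop t m r.
  move=> /andP[m0 _] /andP[/ltW r0 _]; have d0 := capTop_den tt m0 r0.
  rewrite /capTop /colBase ler_pM2l // lef_pV2 ?posrE //.
    by rewrite lerBlDr lerDl mulr_ge0 ?sqrtr_ge0.
  by rewrite mulr_gt0 //; have := colS_ge1 m0 r0; lra.
have zT m r : 0 <= m < 1 -> 0 < r < 1 -> 0 < colT m r (capTop t m r).
  move=> /andP[m0 _] /andP[/ltW r0 _]; have z0 := capTop_gt0 tt m0 r0.
  have E0 := colE_gt0 y1 y2 m0 r0; have zn : capTop t m r != 0 by rewrite gt_eqF.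
  have h : 0 < excess * colT m r (capTop t m r).
    rewrite -(pmulr_lgt0 _ (x := (capTop t m r ^+ 2 * colE m r)^-1)).
      by rewrite -(colX_sqr y1 y2 m0 r0 zn) colX_capTop.
    by rewrite invr_gt0 mulr_gt0 // exprn_gt0.
  by rewrite pmulr_rgt0 in h.
(* In terms of [X = colX m r c] the two sides of the height condition become multiples of
   [X^2 (1 - t^2)] and [t^2 (1 - X^2)] by the same positive factor, so the condition reads
   [X^2 <= t^2]. *)
have key m r c : 0 <= m -> 0 <= r -> 0 < c ->
    (y * colS m r * c - excess = c * Num.sqrt (colE m r) * colX m r c) *
    (excess * colT m r c = (1 - colX m r c ^+ 2) * (c ^+ 2 * colE m r)).
  move=> m0 r0 c0; have E0 := colE_gt0 y1 y2 m0 r0; have cn : c != 0 by rewrite gt_eqF.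
  split.
    by rewrite /colX; field; rewrite cn gt_eqF ?sqrtr_gt0.
  rewrite (colX_sqr y1 y2 m0 r0 cn) divfK // mulf_neq0 ?expf_neq0 //; by rewrite gt_eqF.
have Pin m r c : 0 <= m < 1 -> 0 < r < 1 -> 0 < c ->
    colBase m r < c < capTop t m r -> in_cap t (c * r, c * r * m, c).
  move=> mm rr c0 /andP[bc cz]; have [m0 r0] : 0 <= m /\ 0 <= r.
    by case/andP: mm => -> _; case/andP: rr => /ltW.
  have E0 := colE_gt0 y1 y2 m0 r0; have s0 : 0 < Num.sqrt (colE m r) by rewrite sqrtr_gt0.
  have T0 : 0 < colT m r c.
    apply: (colT_between (colT_base_gt0 y0 y1 y2 m0 r0) (zT _ _ mm rr)).
    by rewrite (ltW bc) (ltW cz).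
  have ys : 0 < y * colS m r by rewrite mulr_gt0 //; have := colS_ge1 m0 r0; lra.
  have X0 : 0 < colX m r c.
    rewrite /colX divr_gt0 // subr_gt0 ltr_pdivrMr // mulrC -ltr_pdivrMr //.
  have Xt : colX m r c < t.
    rewrite /colX ltr_pdivrMr // ltrBlDr -ltrBlDl -[ltLHS]invrK -[ltRHS]invrK invf_div.
    have d0 := capTop_den tt m0 r0; rewrite ltf_pV2 ?posrE ?invr_gt0 ?divr_gt0 //.
    by rewrite ltr_pdivrMr // mulrC.
  rewrite /in_cap /= coneD_col coneT_col T0 (key m r c m0 r0 c0).1.
  have D0 : 0 <= c * Num.sqrt (colE m r) * colX m r c.
    by apply: mulr_ge0 (ltW X0); apply: mulr_ge0; exact: ltW.
  have cr0 : 0 <= c * r by apply: mulr_ge0 (ltW c0) r0.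
  rewrite D0 cr0 (mulr_ge0 cr0 m0) (ltW c0) /=.
  have -> : excess * t ^+ 2 * colT m r c = t ^+ 2 * (excess * colT m r c) by rewrite -mulrA mulrCA.
  rewrite (key m r c m0 r0 c0).2.
  set X := colX m r c in X0 Xt *.
  have -> : (c * Num.sqrt (colE m r) * X) ^+ 2 = c ^+ 2 * colE m r * X ^+ 2.
    by rewrite !exprMn sqr_sqrtr ?ltW.
  rewrite -subr_ge0.
  have -> : t ^+ 2 * ((1 - X ^+ 2) * (c ^+ 2 * colE m r)) - c ^+ 2 * colE m r * X ^+ 2 * (1 - t ^+ 2)
    = c ^+ 2 * colE m r * ((t - X) * (t + X)) by ring.
  apply: mulr_ge0; first by rewrite mulr_ge0 ?sqr_ge0 ?ltW.
  by apply: mulr_ge0; lra.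
have Pout m r c : 0 <= m < 1 -> 0 < r < 1 -> 0 < c ->
    c < colBase m r \/ capTop t m r < c -> in_cap t (c * r, c * r * m, c) = false.
  move=> mm rr c0 bz; have [m0 r0] : 0 <= m /\ 0 <= r.
    by case/andP: mm => -> _; case/andP: rr => /ltW.
  have E0 := colE_gt0 y1 y2 m0 r0; have s0 : 0 < Num.sqrt (colE m r) by rewrite sqrtr_gt0.
  have ys : 0 < y * colS m r by rewrite mulr_gt0 //; have := colS_ge1 m0 r0; lra.
  apply/negP => /and5P[_ _ _ /=]; rewrite coneD_col coneT_col => D0 /andP[T0].
  case: bz => [cb|zc].
    have : y * colS m r * c < excess by rewrite mulrC -ltr_pdivlMr.
    by lra.
  have d0 := capTop_den tt m0 r0.
  have tX : t < colX m r c.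
    rewrite /colX ltr_pdivlMr // ltrBrDr -ltrBrDl ltr_pdivrMr // mulrC -ltr_pdivrMr //.
  have -> : excess * t ^+ 2 * colT m r c = t ^+ 2 * (excess * colT m r c) by rewrite -mulrA mulrCA.
  rewrite (key m r c m0 r0 c0).1 (key m r c m0 r0 c0).2.
  set X := colX m r c in tX *; apply/negP; rewrite -ltNge.
  have -> : (c * Num.sqrt (colE m r) * X) ^+ 2 = c ^+ 2 * colE m r * X ^+ 2.
    by rewrite !exprMn sqr_sqrtr ?ltW.
  rewrite -subr_gt0.
  have -> : c ^+ 2 * colE m r * X ^+ 2 * (1 - t ^+ 2) - t ^+ 2 * ((1 - X ^+ 2) * (c ^+ 2 * colE m r))
    = c ^+ 2 * colE m r * ((X - t) * (t + X)) by ring.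
  apply: mulr_gt0; first by rewrite mulr_gt0 ?exprn_gt0.
  by apply: mulr_gt0; lra.
have L0 : 0 <= layer t by exact: layer_ge0.
apply: (integral_cap y0 y1 y2 L0).
- exact: nnmeas_slice1.
- by move=> m; do 2!apply: integral_ge0 => ? _; apply nK.2.
- move=> m /andP[m0 m1]; have mm : 0 <= m < 1 by rewrite ltW.
  apply: (integral_radius_cst y0 y1 y2 (ltW m0) L0).
  + exact: nnmeas_slice2.
  + by move=> r; apply: integral_ge0 => ? _; apply nK.2.
  + move=> r rr; refine (etrans (column_value mP zb zT Pin Pout mm rr) _).
    by rewrite colX_capTop //; [exact: ltW|case/andP: rr => /ltW].
  + by move=> r; exact: column_out_r.
- by move=> m; exact: column_out_m.
Qed.

Definition tipF m := y / colW m / 2 *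
  (tipX m 1 * atanh (tipX m 1) - tipX m 0 * atanh (tipX m 0)).

Lemma tipF_continuous m : 0 <= m <= 1 -> {for m, continuous tipF}.
Proof.
move=> mm; have m0 : 0 <= m by case/andP: mm.
have W0 := colW_gt0 y2 m0; have E0 := colE_gt0 y1 y2 m0 ler01.
have xb : -1 < tipX m 1 < 1 by apply: tipX_bound => //; rewrite ler01 lexx.
pose X1 u := (1 - y ^+ 2 + y ^+ 2 * u) / (y * Num.sqrt (2 * ((1 - y ^+ 2) * (1 + u ^+ 2) + 2 * y ^+ 2 * u) - u ^+ 2)).
have X1E u : tipX u 1 = X1 u by rewrite tipX1 // colE1.
have -> : tipF = fun u => y / ((1 - y ^+ 2) * (1 + u ^+ 2) + 2 * y ^+ 2 * u) / 2 *
    (X1 u * atanh (X1 u) - edgeK y / y * atanh (edgeK y / y)).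
  by apply/funext => u; rewrite /tipF X1E tipX0.
have E0' : 0 < 2 * ((1 - y ^+ 2) * (1 + m ^+ 2) + 2 * y ^+ 2 * m) - m ^+ 2.
  by rewrite -/(colW m) -colE1.
have n1 : y * Num.sqrt (2 * ((1 - y ^+ 2) * (1 + m ^+ 2) + 2 * y ^+ 2 * m) - m ^+ 2) != 0.
  by rewrite mulf_neq0 // gt_eqF // sqrtr_gt0.
rewrite X1E in xb.
apply: deriv_continuous; derivs.
- by rewrite gt_eqF.
- exact: n1.
- exact: E0'.
- exact: xb.
- exact: n1.
- exact: E0'.
Qed.

Lemma iter3_cell : iter3 (cone_density (cone_weight in_cell)) =
  (\int[mu]_(m in `[0%R, 1%R]) (tipF m)%:E)%E.
Proof.
have mP := measurable_in_cell; have e0 := excess_gt0 y1.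
have nK := nnmeas_cone_density (nnmeas_cone_weight mP).
have zb m r : 0 <= m < 1 -> 0 < r < 1 -> colBase m r <= y.
  by move=> /andP[m0 _] /andP[/ltW r0 _]; exact: colBase_le_tip.
have zT m r : 0 <= m < 1 -> 0 < r < 1 -> 0 < colT m r y.
  by move=> /andP[m0 m1] /andP[r0 r1]; apply: colT_tip_gt0; rewrite ?m0 ?ltW.
have Pin m r c : 0 <= m < 1 -> 0 < r < 1 -> 0 < c ->
    colBase m r < c < y -> in_cell (c * r, c * r * m, c).
  move=> mm rr c0 /andP[bc cz]; have [m0 r0] : 0 <= m /\ 0 <= r.
    by case/andP: mm => -> _; case/andP: rr => /ltW.
  have [m1 r1] : m <= 1 /\ r <= 1 by case/andP: mm => _ /ltW; case/andP: rr => _ /ltW.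
  have T0 : 0 < colT m r c.
    apply: (colT_between (colT_base_gt0 y0 y1 y2 m0 r0) (zT _ _ mm rr)).
    by rewrite (ltW bc) (ltW cz).
  have ys : 0 < y * colS m r by rewrite mulr_gt0 //; have := colS_ge1 m0 r0; lra.
  have D0 : 0 <= y * colS m r * c - excess by rewrite subr_ge0 mulrC -ler_pdivrMr // ltW.
  have cr : c * r <= y by apply: le_trans (ltW cz); rewrite -[leRHS]mulr1 ler_pM2l.
  rewrite /in_cell /= coneD_col coneT_col T0 D0 cr (ltW cz) (ltW c0) !mulr_ge0 ?(ltW c0) //=.
  rewrite andbT; apply: le_trans cr; rewrite -[leRHS]mulr1.
  by rewrite ler_wpM2l // mulr_ge0 // ltW.
have Pout m r c : 0 <= m < 1 -> 0 < r < 1 -> 0 < c ->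
    c < colBase m r \/ y < c -> in_cell (c * r, c * r * m, c) = false.
  move=> mm rr c0 bz; have [m0 r0] : 0 <= m /\ 0 <= r.
    by case/andP: mm => -> _; case/andP: rr => /ltW.
  have ys : 0 < y * colS m r by rewrite mulr_gt0 //; have := colS_ge1 m0 r0; lra.
  apply/negP => /and5P[_ _ /= /andP[_ cy]]; rewrite coneD_col => D0 _.
  case: bz => [cb|zc]; last by lra.
  have : y * colS m r * c < excess by rewrite mulrC -ltr_pdivlMr.
  by lra.
have radial m : 0 < m < 1 -> (\int[mu]_r \int[mu]_c
    cone_density (cone_weight in_cell) (m, r, c) = (tipF m)%:E)%E.
  move=> /andP[m0 m1]; have mm : 0 <= m < 1 by rewrite ltW.
  have mm' : 0 <= m <= 1 by rewrite !ltW.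
  apply: (integral_radius_tip y0 y1 y2 mm').
  + exact: nnmeas_slice2.
  + by move=> r; apply: integral_ge0 => ? _; apply nK.2.
  + by move=> r rr; exact: (column_value mP zb zT Pin Pout mm rr).
  + by move=> r; exact: column_out_r.
have I0 m : (0 <= \int[mu]_r \int[mu]_c cone_density (cone_weight in_cell) (m, r, c))%E.
  by do 2!apply: integral_ge0 => ? _; apply nK.2.
have F0 m : 0 <= m <= 1 -> 0 <= tipF m.
  move=> mm; have m0 : 0 <= m by case/andP: mm.
  have W0 := colW_gt0 y2 m0.
  apply: mulr_ge0; first by rewrite !mulr_ge0 ?invr_ge0 ?ltW.
  rewrite subr_ge0.
  apply: (@deriv_ge0_le _ (fun r => tipX m r * atanh (tipX m r))
    (fun r => (tipX m r / (1 - tipX m r ^+ 2) + atanh (tipX m r)) *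
       (excess * colW m * r / (y * (colE m r * Num.sqrt (colE m r)))))).
  + exact: ler01.
  + move=> r rr; have r0 : 0 <= r by case/andP: rr.
    apply: deriv_eq.
      apply: derivM; first exact: deriv_tipX.
      by apply: deriv_atanh; [exact: tipX_bound|exact: deriv_tipX].
    by cbn beta; rewrite [RHS]mulrDl -[in RHS]mulrA.
  + move=> r rr; have r0 : 0 <= r by case/andP: rr.
    have E0 := colE_gt0 y1 y2 m0 r0.
    apply: mulr_ge0; last first.
      by rewrite !mulr_ge0 ?invr_ge0 ?mulr_ge0 ?sqrtr_ge0 ?(ltW (excess_gt0 y1)) ?(ltW W0) ?(ltW y0) ?(ltW E0).
    have : 0 <= layer (tipX m r).
      by apply: layer_ge0; rewrite tipX_ge0 //; case/andP: (tipX_bound y0 y1 y2 mm rr).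
    by rewrite /layer pmulr_lge0 // invr_gt0.
rewrite [RHS]integral_mkcond.
apply: (@integral_eq_off _ _ _ 0 1).
- exact: nnmeas_slice1.
- apply/(measurable_restrictT _ _).1; first exact: measurable_itv.
  apply/measurable_EFinP; apply: subspace_continuous_measurable_fun.
    exact: measurable_itv.
  apply: continuous_in_subspaceT => x; rewrite inE /= in_itv /= => xab.
  exact: tipF_continuous.
- exact: I0.
- move=> x; rewrite patchE; case: ifPn => //; rewrite inE /= in_itv /= => xab.
  by rewrite lee_fin F0.
- move=> x xa xb; rewrite patchE; case: ifPn => [|nx].
    rewrite inE /= in_itv /= => /andP[ax bx]; apply: radial.
    by rewrite !lt_neqAle eq_sym xa ax xb bx.
  apply: column_out_m; case: (ltP x 0) => [?|ax]; first by left.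
  right; rewrite ltNge; apply/negP => xleb; move: nx.
  by rewrite notin_setE /= in_itv /= ax xleb.
Qed.
End cone_bodies.

(** * Distances in the Klein model *)

Section hyperbolic_functions.
Variable R : realType.
Implicit Types (x s c : R).

Definition cosh x : R := (expR x + expR (- x)) / 2.
Definition sinh x : R := (expR x - expR (- x)) / 2.
Definition tanh x : R := sinh x / cosh x.

Lemma expR_mulN x : expR x * expR (- x) = 1.
Proof. by rewrite -expRD subrr expR0. Qed.

Lemma cosh_gt0 x : 0 < cosh x.
Proof. by rewrite divr_gt0 // addr_gt0 ?expR_gt0. Qed.

Lemma cosh2_sinh2 x : cosh x ^+ 2 = 1 + sinh x ^+ 2.
Proof.
rewrite /cosh /sinh; have := expR_mulN x.
set a := expR x; set b := expR (- x) => ab.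
have -> : ((a + b) / 2) ^+ 2 = a * b + ((a - b) / 2) ^+ 2 by field.
by rewrite ab.
Qed.

Lemma expR_ge_inv x : 0 <= x -> expR (- x) <= 1 <= expR x.
Proof. by move=> x0; rewrite -expR0 !ler_expR x0 andbT lerNl oppr0. Qed.

Lemma sinh_ge0 x : 0 <= x -> 0 <= sinh x.
Proof. by move/expR_ge_inv => /andP[h1 h2]; rewrite /sinh divr_ge0 //; lra. Qed.

Lemma cosh_ge1 x : 1 <= cosh x.
Proof.
have := cosh2_sinh2 x; have := cosh_gt0 x; have := sqr_ge0 (sinh x) => s0 c0 E.
by rewrite -(@ler_pXn2r _ 2) ?nnegrE ?ler01 ?(ltW c0) // expr1n E lerDl.
Qed.

Lemma coshD x s : cosh (x + s) = cosh x * cosh s + sinh x * sinh s.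
Proof. by rewrite /cosh /sinh opprD !expRD; field. Qed.

Lemma sinhD x s : sinh (x + s) = sinh x * cosh s + cosh x * sinh s.
Proof. by rewrite /cosh /sinh opprD !expRD; field. Qed.

Lemma coshN x : cosh (- x) = cosh x.
Proof. by rewrite /cosh opprK addrC. Qed.

Lemma sinhN x : sinh (- x) = - sinh x.
Proof. by rewrite /sinh opprK -mulNr opprB. Qed.

Lemma le_cosh x s : 0 <= x -> x <= s -> cosh x <= cosh s.
Proof.
move=> x0 xs; have -> : s = x + (s - x) by ring.
have d0 : 0 <= s - x by lra.
rewrite coshD; have h1 := cosh_ge1 (s - x); have h2 := cosh_gt0 x.
have h3 : 0 <= sinh x * sinh (s - x) by rewrite mulr_ge0 ?sinh_ge0.
have : cosh x * 1 <= cosh x * cosh (s - x) by rewrite ler_pM2l.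
lra.
Qed.

Lemma le_sinh x s : 0 <= x -> x <= s -> sinh x <= sinh s.
Proof.
move=> x0 xs; have := le_cosh x0 xs => h.
have s0 := sinh_ge0 x0; have s1 := sinh_ge0 (le_trans x0 xs).
rewrite -(@ler_pXn2r _ 2) ?nnegrE //.
have h2 : cosh x ^+ 2 <= cosh s ^+ 2 by rewrite ler_pXn2r ?nnegrE ?(ltW (cosh_gt0 _)).
by move: h2; rewrite !cosh2_sinh2 lerD2l.
Qed.

Lemma lt_cosh x s : 0 <= x -> x < s -> cosh x < cosh s.
Proof.
move=> x0 xs; have le := le_cosh x0 (ltW xs); rewrite lt_neqAle le andbT; apply/eqP => E.
have s0 : 0 < s - x by lra.
have E1 : cosh s = cosh x * cosh (s - x) + sinh x * sinh (s - x).
  by rewrite -coshD; congr cosh; ring.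
have h1 : 1 < cosh (s - x).
  rewrite -(@ltr_pXn2r _ 2) ?nnegrE ?ler01 ?(ltW (cosh_gt0 _)) // expr1n cosh2_sinh2 ltrDl.
  apply: exprn_gt0; rewrite /sinh divr_gt0 // subr_gt0 ltr_expR; lra.
have h3 : 0 <= sinh x * sinh (s - x) by rewrite mulr_ge0 ?sinh_ge0 // ltW.
have : cosh x * 1 < cosh x * cosh (s - x) by rewrite ltr_pM2l ?cosh_gt0.
lra.
Qed.

Lemma cosh_le x s : 0 <= x -> 0 <= s -> (cosh x <= cosh s) = (x <= s).
Proof.
move=> x0 s0; apply/idP/idP => [|h]; last exact: le_cosh.
by apply: contraTT; rewrite -!ltNge => h; exact: lt_cosh.
Qed.

Lemma cosh_inj x s : 0 <= x -> 0 <= s -> cosh x = cosh s -> x = s.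
Proof.
move=> x0 s0 E; case: (ltgtP x s) => // h.
  by have := lt_cosh x0 h; rewrite E ltxx.
by have := lt_cosh s0 h; rewrite E ltxx.
Qed.

Lemma arcosh_ge0 c : 1 <= c -> 0 <= arcosh c.
Proof.
by move=> c1; rewrite /arcosh ln_ge0 // (le_trans c1) // lerDl sqrtr_ge0.
Qed.

Lemma arcoshK c : 1 <= c -> cosh (arcosh c) = c.
Proof.
move=> c1; have r0 : 0 <= c ^+ 2 - 1 by rewrite subr_ge0 expr_ge1 //; lra.
have s0 := sqrtr_ge0 (c ^+ 2 - 1); have s2 := sqr_sqrtr r0.
rewrite /cosh /arcosh; set q := Num.sqrt _ in s0 s2 *.
have p0 : 0 < c + q by lra.
rewrite expRN lnK ?posrE //.
have -> : (c + q)^-1 = c - q.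
  apply: (mulfI (x := c + q)); first by rewrite gt_eqF.
  rewrite mulfV ?gt_eqF //.
  have -> : (c + q) * (c - q) = c ^+ 2 - q ^+ 2 by ring.
  by rewrite s2; ring.
by field.
Qed.

Lemma arcosh_cosh x : 0 <= x -> arcosh (cosh x) = x.
Proof. by move=> x0; apply: (cosh_inj (arcosh_ge0 (cosh_ge1 x)) x0); rewrite (arcoshK (cosh_ge1 x)). Qed.

Lemma arcosh_le c s : 1 <= c -> 0 <= s -> (arcosh c <= s) = (c <= cosh s).
Proof. by move=> c1 s0; rewrite -(cosh_le (arcosh_ge0 c1) s0) (arcoshK c1). Qed.

Lemma le_arcosh c1 c2 : 1 <= c1 -> c1 <= c2 -> arcosh c1 <= arcosh c2.
Proof.
by move=> h1 h2; have h3 := le_trans h1 h2; rewrite arcosh_le ?arcosh_ge0 ?arcoshK.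
Qed.

Lemma tanh_bound s : 0 <= s -> 0 <= tanh s < 1.
Proof.
move=> s0; have c0 := cosh_gt0 s; rewrite /tanh divr_ge0 ?sinh_ge0 ?(ltW c0) //=.
rewrite ltr_pdivrMr // mul1r /sinh /cosh; have := expR_gt0 (- s); lra.
Qed.

Lemma tanh_sqr s : 1 - tanh s ^+ 2 = (cosh s ^+ 2)^-1.
Proof.
rewrite /tanh exprMn exprVn; have c0 : cosh s != 0 by rewrite gt_eqF ?cosh_gt0.
have -> : sinh s ^+ 2 = cosh s ^+ 2 - 1 by rewrite cosh2_sinh2; ring.
by field.
Qed.

Lemma tanhK s : atanh (tanh s) = s.
Proof.
rewrite /atanh /tanh; have c0 : cosh s != 0 by rewrite gt_eqF ?cosh_gt0.
have -> : (1 + sinh s / cosh s) / (1 - sinh s / cosh s) = expR (s + s).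
  have E : cosh s - sinh s = expR (- s) by rewrite /cosh /sinh; field.
  have n0 : cosh s - sinh s != 0 by rewrite E gt_eqF ?expR_gt0.
  apply: (mulIf n0).
  have -> : (1 + sinh s / cosh s) / (1 - sinh s / cosh s) * (cosh s - sinh s) = cosh s + sinh s.
    by field; rewrite n0 c0.
  by rewrite E -expRD addrK /cosh /sinh; field.
by rewrite expRK; field.
Qed.

Lemma layer_tanh s : layer (tanh s) = (sinh s * cosh s + s) / 2.
Proof.
rewrite /layer tanhK tanh_sqr invrK /tanh; have c0 : cosh s != 0 by rewrite gt_eqF ?cosh_gt0.
by field.
Qed.

Lemma atanhK x : -1 < x < 1 -> tanh (atanh x) = x.
Proof.
move=> /andP[x1 x2]; have p1 : 0 < 1 + x by lra.
have p2 : 0 < 1 - x by lra.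
have q0 : 0 < (1 + x) / (1 - x) by rewrite divr_gt0.
set s := atanh x.
have E2 : expR s ^+ 2 = (1 + x) / (1 - x).
  rewrite -expRM_natl /s /atanh mulrC divfK // lnK //.
have e0 := expR_gt0 s; rewrite /tanh /sinh /cosh expRN.
have -> : (expR s - (expR s)^-1) / 2 / ((expR s + (expR s)^-1) / 2) =
  (expR s ^+ 2 - 1) / (expR s ^+ 2 + 1).
  field; rewrite !gt_eqF //; have := sqr_ge0 (expR s); lra.
rewrite E2; field; rewrite (_ : 1 + x + (1 - x) = 2) ?gt_eqF //; by ring.
Qed.
End hyperbolic_functions.

Section distances.
Variable R : realType.
Implicit Types (u v z B : pt R).

Lemma inf_attained (S : set R) m : S m -> (forall x, S x -> m <= x) -> inf S = m.
Proof.
move=> Sm lb; apply/eqP; rewrite eq_le; apply/andP; split.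
  by apply: ge_inf => //; exists m => x; exact: lb.
by apply: lb_le_inf; [exists m|move=> x; exact: lb].
Qed.

Lemma dotC u v : dot u v = dot v u.
Proof. by rewrite /dot; ring. Qed.

Lemma hdistC u v : hdist u v = hdist v u.
Proof. by rewrite /hdist dotC (mulrC (1 - nrm2 u)). Qed.

Lemma setdistC (A B : set (pt R)) : setdist A B = setdist B A.
Proof.
rewrite /setdist; congr inf; apply/seteqP; split=> r [a [b [h1 [h2 [h3 [h4 ->]]]]]];
  by exists b, a; rewrite hdistC.
Qed.

(* The reversed Cauchy-Schwarz inequality of the Lorentzian form, for the vectors [(p, k)] and [(v, 1)]. *)
Lemma reverse_cauchy (p v : pt R) (k : R) : nrm2 v <= 1 ->
  (k ^+ 2 - nrm2 p) * (1 - nrm2 v) <= (k - dot p v) ^+ 2.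
Proof.
move=> v1; pose d := (px p - k * px v, py p - k * py v, pz p - k * pz v).
rewrite -subr_ge0.
have -> : (k - dot p v) ^+ 2 - (k ^+ 2 - nrm2 p) * (1 - nrm2 v) =
  nrm2 d * (1 - nrm2 v) + dot d v ^+ 2.
  by rewrite /nrm2 /dot /d /px /py /pz /=; ring.
rewrite addr_ge0 ?sqr_ge0 // mulr_ge0 ?subr_ge0 //.
by rewrite /nrm2 /dot !addr_ge0 // -expr2 sqr_ge0.
Qed.

Lemma nrm2_ge0 u : 0 <= nrm2 u.
Proof. by rewrite /nrm2 /dot !addr_ge0 // -expr2 sqr_ge0. Qed.

Lemma dot_sqr_le u v : dot u v ^+ 2 <= nrm2 u * nrm2 v.
Proof.
rewrite -subr_ge0.
have -> : nrm2 u * nrm2 v - dot u v ^+ 2 = (px u * py v - py u * px v) ^+ 2 +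
   (px u * pz v - pz u * px v) ^+ 2 + (py u * pz v - pz u * py v) ^+ 2.
  by rewrite /nrm2 /dot; ring.
by rewrite !addr_ge0 ?sqr_ge0.
Qed.

Lemma dot_lt1 u v : nrm2 u < 1 -> nrm2 v < 1 -> dot u v < 1.
Proof.
move=> u1 v1; have := dot_sqr_le u v; have := nrm2_ge0 u; have := nrm2_ge0 v => v0 u0 h.
have h2 : nrm2 u * nrm2 v < 1.
  by rewrite -(mulr1 1) ltr_pM.
have : dot u v ^+ 2 < 1 by lra.
by move/ratio_lt1_sqr => /andP[].
Qed.

(* Hyperbolic cosine of the distance, squared. *)
Definition chord u v : R := (1 - dot u v) ^+ 2 / ((1 - nrm2 u) * (1 - nrm2 v)).

Lemma hdistE u v : nrm2 u < 1 -> nrm2 v < 1 -> hdist u v = arcosh (Num.sqrt (chord u v)).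
Proof.
move=> u1 v1; rewrite /hdist /chord [in RHS]sqrtrM ?sqr_ge0 // sqrtr_sqr ger0_norm.
  by rewrite sqrtrV // mulr_ge0 // subr_ge0 ltW.
by rewrite subr_ge0 ltW // dot_lt1.
Qed.

Lemma le_arcosh_sqrt (a b : R) : 1 <= a -> a <= b -> arcosh (Num.sqrt a) <= arcosh (Num.sqrt b).
Proof.
move=> a1 ab; apply: le_arcosh; last by rewrite ler_wsqrtr.
by rewrite -[leLHS]sqrtr1 ler_wsqrtr.
Qed.

(** The squared hyperbolic cosine of the distance from [z] to the polar plane of [B], written as one
    plus the squared hyperbolic sine. *)
Definition plane_chord B z : R := 1 + (1 - dot z B) ^+ 2 / ((nrm2 B - 1) * (1 - nrm2 z)).

Lemma plane_chord_ge1 B z : 1 < nrm2 B -> nrm2 z < 1 -> 1 <= plane_chord B z.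
Proof.
by move=> B1 z1; rewrite lerDl divr_ge0 ?sqr_ge0 // mulr_ge0 ?subr_ge0 ?ltW.
Qed.

Lemma plane_chord_le B z b : 1 < nrm2 B -> nrm2 z < 1 -> polar_plane B b ->
  plane_chord B z <= chord z b.
Proof.
move=> B1 z1 [b1 bB]; rewrite /plane_chord /chord /hyp_space /= in b1 *.
set D := 1 - dot z B; set e := nrm2 B - 1.
have e0 : 0 < e by rewrite subr_gt0.
(* Lorentz-orthogonal projection of [(z, 1)] to the hyperplane polar to [B], with last coordinate
   [1 + D / e]. Since [b] lies in that hyperplane, replacing [z] by its projection does not change
   the product with [b]. *)
pose p : pt R := (px z + D / e * px B, py z + D / e * py B, pz z + D / e * pz B).
have := @reverse_cauchy p b (1 + D / e) (ltW b1).
have -> : 1 + D / e - dot p b = 1 - dot z b.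
  have -> : dot p b = dot z b + D / e * dot b B by rewrite /dot /p /px /py /pz /=; ring.
  by rewrite bB; ring.
have -> : (1 + D / e) ^+ 2 - nrm2 p = (1 - nrm2 z) + D ^+ 2 / e.
  have -> : nrm2 p = nrm2 z + 2 * (D / e) * dot z B + (D / e) ^+ 2 * nrm2 B.
    by rewrite /nrm2 /dot /p /px /py /pz /=; ring.
  have -> : dot z B = 1 - D by rewrite /D; ring.
  have -> : nrm2 B = e + 1 by rewrite /e; ring.
  by field; rewrite gt_eqF.
move=> h; rewrite ler_pdivlMr ?mulr_gt0 ?subr_gt0 //; apply: le_trans h.
rewrite le_eqVlt; apply/orP; left; apply/eqP.
by field; rewrite !gt_eqF // subr_gt0.
Qed.

Lemma plane_chord_attained B z : 1 < nrm2 B -> nrm2 z < 1 ->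
  exists2 b, polar_plane B b & chord z b = plane_chord B z.
Proof.
move=> B1 z1; rewrite /plane_chord.
set D := 1 - dot z B; set e := nrm2 B - 1.
have e0 : 0 < e by rewrite subr_gt0.
have T0 : 0 < 1 - nrm2 z by rewrite subr_gt0.
have k0 : 0 < e + D.
  have h := dot_sqr_le z B; have z0 := nrm2_ge0 z.
  have -> : e + D = nrm2 B - dot z B by rewrite /e /D; ring.
  rewrite subr_gt0; case: (lerP (dot z B) 0) => [?|d0]; first by lra.
  rewrite -(@ltr_pXn2r _ 2) ?nnegrE ?(ltW d0) //; last by lra.
  apply: le_lt_trans h _; rewrite expr2 ltr_pM2r; lra.
(* The foot of the perpendicular: the same projection, rescaled to last coordinate 1. Positivity of
   [e + D = |B|^2 - <z, B>] comes from Cauchy-Schwarz. *)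
pose b : pt R := ((e * px z + D * px B) / (e + D), (e * py z + D * py B) / (e + D),
   (e * pz z + D * pz B) / (e + D)).
have zB : dot z B = 1 - D by rewrite /D; ring.
have BB : nrm2 B = e + 1 by rewrite /e; ring.
have kn : e + D != 0 by rewrite gt_eqF.
have bB : dot b B = 1.
  have -> : dot b B = (e * dot z B + D * nrm2 B) / (e + D) by rewrite /nrm2 /dot /b /px /py /pz /=; field.
  by rewrite zB BB; field.
have zb : dot z b = (e * nrm2 z + D * (1 - D)) / (e + D).
  have -> : dot z b = (e * nrm2 z + D * dot z B) / (e + D) by rewrite /nrm2 /dot /b /px /py /pz /=; field.
  by rewrite zB.
have bb : 1 - nrm2 b = e * (e * (1 - nrm2 z) + D ^+ 2) / (e + D) ^+ 2.
  have -> : nrm2 b = (e ^+ 2 * nrm2 z + 2 * e * D * dot z B + D ^+ 2 * nrm2 B) / (e + D) ^+ 2.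
    by rewrite /nrm2 /dot /b /px /py /pz /=; field.
  by rewrite zB BB; field.
have q0 : 0 < e * (1 - nrm2 z) + D ^+ 2 by rewrite ltr_pwDl ?sqr_ge0 // mulr_gt0.
exists b.
  split => //; rewrite /hyp_space /= -subr_gt0 bb.
  by rewrite divr_gt0 ?mulr_gt0 ?exprn_gt0.
rewrite /chord bb zb; field.
by rewrite kn !gt_eqF.
Qed.

Lemma setdist_point_polar B z : 1 < nrm2 B -> nrm2 z < 1 ->
  setdist [set z] (polar_plane B) = arcosh (Num.sqrt (plane_chord B z)).
Proof.
move=> B1 z1; have [b bB bE] := plane_chord_attained B1 z1.
apply: inf_attained.
  exists z, b; split => //; split => //; split => //; split; first by case: bB.
  by rewrite hdistE ?bE //; case: bB.
move=> _ [a [c [-> [cB [a1 [c1 ->]]]]]]; rewrite hdistE //.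
apply: le_arcosh_sqrt; first exact: plane_chord_ge1.
exact: plane_chord_le.
Qed.

Lemma setdist_polar_point B z : 1 < nrm2 B -> nrm2 z < 1 ->
  setdist (polar_plane B) [set z] = arcosh (Num.sqrt (plane_chord B z)).
Proof. by rewrite setdistC; exact: setdist_point_polar. Qed.
End distances.

(** * Translations, reflections and hyperbolic volume as an iterated integral *)

Section coordinate_changes.
Variable R : realType.
Local Notation mu := (@lebesgue_measure R).
Local Open Scope ereal_scope.
Implicit Types (F : R -> \bar R) (g h : R * R * R -> \bar R) (f : R -> R).

Definition preserving f := measurable_fun setT f /\
  forall F, measurable_fun setT F -> (forall x, 0 <= F x) ->
    \int[mu]_x F x = \int[mu]_x F (f x).

Lemma preserving_sub (b : R) : preserving (fun x => b - x)%R.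
Proof.
split; first by apply: measurable_funB => //; exact: measurable_cst.
move=> F mF F0; rewrite (integral_shift b mF F0).
have mF' : measurable_fun setT (fun x : R => F (x + b)%R).
  by apply: (measurableT_comp mF); apply: measurable_funD => //; exact: measurable_cst.
rewrite (integral_oppr mF' (fun x => F0 _)).
by apply: eq_integral => x _; rewrite addrC.
Qed.

Lemma preserving_addC (b : R) : preserving (fun x => x - b)%R.
Proof.
split; first by apply: measurable_funB => //; exact: measurable_cst.
by move=> F mF F0; rewrite (integral_shift (- b) mF F0).
Qed.

Lemma iter3_map f1 f2 f3 g : preserving f1 -> preserving f2 -> preserving f3 ->
  nnmeas g -> iter3 g = iter3 (fun v => g (f1 v.1.1, f2 v.1.2, f3 v.2)).
Proof.
move=> [m1 p1] [m2 p2] [m3 p3] gg.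
refine (etrans (p1 _ (nnmeas_slice1 gg) _) _).
  by move=> a; do 2!apply: integral_ge0 => ? _; apply gg.2.
apply: eq_integral => a _.
refine (etrans (p2 _ (nnmeas_slice2 (f1 a) gg) _) _).
  by move=> b; apply: integral_ge0 => ? _; apply gg.2.
apply: eq_integral => b _.
by apply: p3; [exact: nnmeas_slice3|move=> c; apply gg.2].
Qed.

Lemma integral_even F : measurable_fun setT F -> (forall x, 0 <= F x) ->
  (forall x, F (- x)%R = F x) ->
  \int[mu]_x F x = 2%:E * \int[mu]_x (if (0 <= x)%R then F x else 0).
Proof.
move=> mF F0 Fe.
pose Fp (x : R) := if (0 <= x)%R then F x else 0.
have mp : measurable_fun setT Fp.
  apply: measurable_fun_ifT => //.
  by apply: measurable_fun_ler => //; exact: measurable_cst.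
have p0 x : 0 <= Fp x by rewrite /Fp; case: ifP.
have mn : measurable_fun setT (fun x : R => Fp (- x)%R).
  by apply: (measurableT_comp mp); exact: oppr_measurable.
transitivity (\int[mu]_x (Fp x + Fp (- x)%R)).
  apply: (@integral_eq_off _ _ _ (0 : R)%R (0 : R)%R) => //.
  - exact: emeasurable_funD.
  - by move=> x; apply: adde_ge0.
  - move=> x x0 _; rewrite /Fp oppr_ge0 Fe.
    by case: (ltgtP x 0%R) x0 => //; rewrite ?adde0 ?add0e.
rewrite ge0_integralD //.
rewrite -(integral_oppr mp p0).
set I := integral _ _ _; have I0 : 0 <= I by apply: integral_ge0.
rewrite (_ : 2%:E = (1 + 1)%:E); last by congr EFin.
by rewrite EFinD ge0_muleDl ?mul1e // lee_fin.
Qed.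

Definition pos1 (v : R * R * R) := (0 <= v.1.1)%R.

Lemma measurable_pos1 : measurable_fun setT pos1.
Proof. by apply: measurable_fun_ler; [exact: measurable_cst|exact: measurable_fst3]. Qed.

Lemma iter3_even g : nnmeas g -> (forall a b c, g ((- a)%R, b, c) = g (a, b, c)) ->
  iter3 g = 2%:E * iter3 (cut pos1 g).
Proof.
move=> gg ge; refine (etrans (integral_even (nnmeas_slice1 gg) _ _) _).
- by move=> a; do 2!apply: integral_ge0 => ? _; apply gg.2.
- by move=> a; apply: eq_integral => b _; apply: eq_integral => c _; exact: ge.
refine (congr1 (fun x => 2%:E * x) _); apply: eq_integral => a _.
rewrite /cut /pos1 /=; case: ifPn => // _.
by apply/esym; apply: integral_zero => b; exact: integral_zero.
Qed.

Definition octant (v : R * R * R) := [&& (0 <= v.1.1)%R, (0 <= v.1.2)%R & (0 <= v.2)%R].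

(** Evenness in one coordinate passes to all three by symmetry; each coordinate in turn is brought
    to the front and folded, which doubles the integral. *)
Lemma iter3_octant g : nnmeas g -> g \o @swap12 R = g -> g \o @swap23 R = g ->
  (forall a b c, g ((- a)%R, b, c) = g (a, b, c)) ->
  iter3 g = 8%:E * iter3 (cut octant g).
Proof.
move=> gg g12 g23 ge.
have s12 a b c : g (b, a, c) = g (a, b, c) by exact: (congr1 (fun k => k (a, b, c)) g12).
have s23 a b c : g (a, c, b) = g (a, b, c) by exact: (congr1 (fun k => k (a, b, c)) g23).
have n1 := nnmeas_cut measurable_pos1 gg.
pose g1 := cut pos1 g \o @swap12 R.
have m1 : nnmeas g1 by exact: nnmeas_swap12.
have n2 := nnmeas_cut measurable_pos1 m1.
pose g2 := (cut pos1 g1 \o @swap23 R) \o @swap12 R.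
have m2 : nnmeas g2 by apply: nnmeas_swap12; exact: nnmeas_swap23.
have E1 : iter3 (cut pos1 g) = 2%:E * iter3 (cut pos1 g1).
  refine (etrans (iter3_swap12 n1) (iter3_even m1 _)) => a b c.
  by rewrite /g1 /cut /pos1 /swap12 /=; case: ifP => // _; rewrite s12 ge s12.
have E2 : iter3 (cut pos1 g1) = 2%:E * iter3 (cut pos1 g2).
  refine (etrans (iter3_swap23 n2) (etrans (iter3_swap12 (nnmeas_swap23 n2)) (iter3_even m2 _))).
  move=> a b c; rewrite /g2 /g1 /cut /pos1 /swap12 /swap23 /=.
  by case: ifP => // _; case: ifP => // _; rewrite (s23 c (- a)%R b) (s12 (- a)%R c b) ge -(s12 a c b) -(s23 c a b).
have E3 : iter3 (cut pos1 g2) = iter3 (cut octant g).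
  refine (etrans (iter3_swap12 (nnmeas_cut measurable_pos1 m2)) _).
  refine (etrans (iter3_swap23 (nnmeas_swap12 (nnmeas_cut measurable_pos1 m2))) _).
  apply: eq_integral => a _; apply: eq_integral => b _; apply: eq_integral => c _.
  rewrite /g2 /g1 /cut /pos1 /octant /swap12 /swap23 /=.
  by case: (0 <= a)%R; case: (0 <= b)%R; case: (0 <= c)%R.
rewrite (iter3_even gg ge) E1 E2 E3 !muleA; congr (_ * _).
by rewrite -!EFinM; congr EFin; ring.
Qed.

Lemma le_iter3 g h : nnmeas g -> nnmeas h -> (forall v, g v <= h v) -> iter3 g <= iter3 h.
Proof.
move=> gg hh gh; apply: ge0_le_integral => //.
- by move=> a _; do 2!apply: integral_ge0 => ? _; apply gg.2.
- exact: nnmeas_slice1.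
- exact: nnmeas_slice1.
move=> a _; apply: ge0_le_integral => //.
- by move=> b _; apply: integral_ge0 => ? _; apply gg.2.
- exact: nnmeas_slice2.
- exact: nnmeas_slice2.
move=> b _; apply: ge0_le_integral => //.
- by move=> c _; apply gg.2.
- exact: nnmeas_slice3.
- exact: nnmeas_slice3.
Qed.

Definition ball_weight (P : pt R -> bool) (z : pt R) : \bar R :=
  if P z then ((1 - nrm2 z) ^- 2)%:E else 0.

Lemma measurable_nrm2 : measurable_fun setT (@nrm2 R).
Proof.
by apply: measurable_funD; first apply: measurable_funD;
  apply: measurable_funM; (exact: measurable_fst3 || exact: measurable_snd3 || exact: measurable_thd3).
Qed.

Lemma nnmeas_ball_weight P : measurable_fun setT P -> nnmeas (ball_weight P).
Proof.
move=> mP; split; last first.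
  by move=> v; rewrite /ball_weight; case: ifP => // _; rewrite lee_fin invr_ge0 sqr_ge0.
apply: measurable_fun_ifT => //.
apply/measurable_EFinP; apply: (@measurableT_comp _ _ _ _ _ _ (fun t : R => t^-1)%R).
  exact: measurable_invr.
apply: measurable_funX; apply: measurable_funB; first exact: measurable_cst.
exact: measurable_nrm2.
Qed.

Lemma hvol_iter3 (P : pt R -> bool) : measurable_fun setT P ->
  hvol [set z | P z] = fine (iter3 (ball_weight P)).
Proof.
move=> mP; rewrite /hvol -(iter3E (nnmeas_ball_weight mP)) integral_mkcond.
congr fine; apply: eq_integral => z _; rewrite patchE /ball_weight.
case: ifPn; first by rewrite inE /= => ->.
by rewrite notin_setE /= => /negP/negbTE ->.
Qed.
End coordinate_changes.

(** * The volume of the truncated cube *)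

Section bodies.
Variables (R : realType) (y : R).
Hypotheses (y0 : 0 < y) (y1 : 1 < 3 * y ^+ 2) (y2 : 2 * y ^+ 2 < 1).
Implicit Types (z v : R * R * R).
Local Notation mu := (@lebesgue_measure R).

Definition in_Cr (z : pt R) := [&& nrm2 z < 1, `|px z| <= y, `|py z| <= y, `|pz z| <= y &
  y * (`|px z| + `|py z| + `|pz z|) <= 1].

Definition in_ball (t : R) (z : pt R) :=
  (1 - dot z (vtx y 1)) ^+ 2 * (1 - t ^+ 2) <= excess y * t ^+ 2 * (1 - nrm2 z).

(** Over the eight sign patterns the largest product of [z] with a vertex is [y] times the sum of
    the absolute values, so the eight truncations merge into one inequality. *)
Lemma Cr_in : Cr y = [set z | in_Cr z].
Proof.
apply/seteqP; split=> z.
  move=> [z1 [zx [zy [zz h]]]]; apply/and5P; split => //.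
  have [h1 [h2 [h3 h4]]] := (h 1%N isT, (h 2%N isT, (h 3%N isT, h 4%N isT))).
  have [h5 [h6 [h7 h8]]] := (h 5%N isT, (h 6%N isT, (h 7%N isT, h 8%N isT))).
  move: h1 h2 h3 h4 h5 h6 h7 h8; rewrite /dot /vtx /mkpt /=.
  change (px (y, _, _)) with y.
  rewrite /px /py /pz /=.
  case: (ger0P z.1.1) => _; case: (ger0P z.1.2) => _; case: (ger0P z.2) => _; lra.
move=> /and5P[z1 zx zy zz h]; split => //; split => //; split => //; split => // i _.
have bnd (a b c : R) : (`|a| = y) -> (`|b| = y) -> (`|c| = y) ->
    px z * a + py z * b + pz z * c <= 1.
  move=> ha hb hc; apply: le_trans h; rewrite !mulrDr.
  have le (u w : R) : `|w| = y -> u * w <= y * `|u|.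
    by move=> hw; apply: (le_trans (ler_norm _)); rewrite normrM hw mulrC.
  by apply: lerD; first apply: lerD; exact: le.
have ny : `|- y| = y by rewrite normrN gtr0_norm.
have py' : `|y| = y by rewrite gtr0_norm.
by rewrite /dot /vtx; do 8?[case: i => [|i]]; apply: bnd.
Qed.

Lemma measurable_in_Cr : measurable_fun setT in_Cr.
Proof.
have mx := @measurable_fst3 R; have my := @measurable_snd3 R; have mz := @measurable_thd3 R.
have mn (f : R * R * R -> R) : measurable_fun setT f -> measurable_fun setT (fun v => `|f v|).
  by move=> mf; apply: (measurableT_comp _ mf); exact: normr_measurable.
apply: measurable_and; first by apply: measurable_fun_ltr; [exact: measurable_nrm2|exact: measurable_cst].
apply: measurable_and; first by apply: measurable_fun_ler; [exact: (mn _ mx)|exact: measurable_cst].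
apply: measurable_and; first by apply: measurable_fun_ler; [exact: (mn _ my)|exact: measurable_cst].
apply: measurable_and; first by apply: measurable_fun_ler; [exact: (mn _ mz)|exact: measurable_cst].
apply: measurable_fun_ler; last exact: measurable_cst.
apply: measurable_funM; first exact: measurable_cst.
apply: measurable_funD; first apply: measurable_funD.
- exact: (mn _ mx).
- exact: (mn _ my).
- exact: (mn _ mz).
Qed.

Lemma nrm2_neg1 (a b c : R) : nrm2 ((- a, b, c) : pt R) = nrm2 ((a, b, c) : pt R).
Proof. by rewrite /nrm2 /dot /px /py /pz /=; ring. Qed.

Lemma coneT_swap12 v : coneT y (swap12 v) = coneT y v.
Proof. by rewrite /coneT /swap12 /=; ring. Qed.
Lemma coneT_swap23 v : coneT y (swap23 v) = coneT y v.
Proof. by rewrite /coneT /swap23 /=; ring. Qed.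
Lemma coneD_swap12 v : coneD y (swap12 v) = coneD y v.
Proof. by rewrite /coneD /swap12 /=; ring. Qed.
Lemma coneD_swap23 v : coneD y (swap23 v) = coneD y v.
Proof. by rewrite /coneD /swap23 /=; ring. Qed.

Lemma cone_cell : iter3 (cone_weight y (in_cell y)) =
  (6%:R%:E * \int[mu]_(m in `[0%R, 1%R]) (tipF y m)%:E)%E.
Proof.
rewrite -(iter3_cell y0 y1 y2); apply: cone_integral.
- by apply: nnmeas_cone_weight; exact: measurable_in_cell.
- apply/funext => v; rewrite /= /cone_weight coneT_swap12 /in_cell coneD_swap12 coneT_swap12.
  by rewrite /swap12 /= andbCA.
- apply/funext => v; rewrite /= /cone_weight coneT_swap23 /in_cell coneD_swap23 coneT_swap23.
  by rewrite /swap23 /= [X in _ && X]andbCA.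
- move=> a b c b0; rewrite /cone_weight /in_cell /=.
  by rewrite (leNgt 0 b) b0 /= andbF.
Qed.

Lemma cone_cap (t : R) : 0 <= t < 1 -> iter3 (cone_weight y (in_cap y t)) =
  (6 * (layer t * (atan (Num.sqrt 3)^-1 - atan (edgeK y))))%:E.
Proof.
move=> tt; rewrite EFinM -(iter3_cap y0 y1 y2 tt); apply: cone_integral.
- by apply: nnmeas_cone_weight; exact: measurable_in_cap.
- apply/funext => v; rewrite /= /cone_weight coneT_swap12 /in_cap coneD_swap12 coneT_swap12.
  by rewrite /swap12 /= andbCA.
- apply/funext => v; rewrite /= /cone_weight coneT_swap23 /in_cap coneD_swap23 coneT_swap23.
  by rewrite /swap23 /= [X in _ && X]andbCA.
- move=> a b c b0; rewrite /cone_weight /in_cap /=.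
  by rewrite (leNgt 0 b) b0 /= andbF.
Qed.

Lemma coneT_nrm2 (a b c : R) : 1 - nrm2 ((y - a, y - b, y - c) : pt R) = coneT y (a, b, c).
Proof. by rewrite /coneT /nrm2 /dot /px /py /pz /=; ring. Qed.

Lemma in_cell_octant v : octant (y - v.1.1, y - v.1.2, y - v.2) &&
  in_Cr (y - v.1.1, y - v.1.2, y - v.2) = in_cell y v.
Proof.
have nT : 1 - nrm2 ((y - v.1.1, y - v.1.2, y - v.2) : pt R) = coneT y v.
  by rewrite /coneT /nrm2 /dot /px /py /pz /=; ring.
rewrite /octant /in_Cr /in_cell /= /coneD -nT !subr_gt0 !subr_ge0 /px /py /pz /=.
apply/andP/and5P.
  move=> [/and3P[a1 b1 c1] /and5P[T h1 h2 h3 h4]].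
  by move: h1 h2 h3 h4; rewrite !ger0_norm ?subr_ge0 // => h1 h2 h3 h4; split => //; lra.
move=> [/andP[a0 a1] /andP[b0 b1] /andP[c0 c1] D T]; rewrite a1 b1 c1; split => //.
by rewrite !ger0_norm ?subr_ge0 // T D /=; apply/and4P; split => //; lra.
Qed.

Lemma cell_integral_fin :
  mu.-integrable `[0, 1] (EFin \o tipF y).
Proof.
apply: continuous_compact_integrable; first exact: segment_compact.
apply: continuous_in_subspaceT => x; rewrite inE /= in_itv /= => xab.
exact: tipF_continuous.
Qed.

(** The factor 48 counts eight octants times six orderings of the coordinates, the order of the
    symmetry group of the cube. *)
Lemma hvol_Cr : hvol (Cr y) =
  48 * fine (\int[mu]_(m in `[0%R, 1%R]) (tipF y m)%:E)%E.
Proof.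
rewrite Cr_in (hvol_iter3 measurable_in_Cr).
have nW := nnmeas_ball_weight measurable_in_Cr.
have E1 : iter3 (ball_weight in_Cr) = (8%:E * iter3 (cut (@octant R) (ball_weight in_Cr)))%E.
  apply: iter3_octant => //.
  - apply/funext => v; rewrite /= /ball_weight /in_Cr.
    have -> : nrm2 (swap12 v : pt R) = nrm2 (v : pt R) by rewrite /nrm2 /dot /px /py /pz /=; ring.
    rewrite /px /py /pz /swap12 /=; congr (if _ then _ else _).
    by rewrite (addrC `|v.1.2|); congr (_ && _); exact: andbCA.
  - apply/funext => v; rewrite /= /ball_weight /in_Cr.
    have -> : nrm2 (swap23 v : pt R) = nrm2 (v : pt R) by rewrite /nrm2 /dot /px /py /pz /=; ring.
    rewrite /px /py /pz /swap23 /=; congr (if _ then _ else _).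
    by rewrite addrAC; do 2!congr (_ && _); exact: andbCA.
  - move=> a b c; rewrite /ball_weight /in_Cr nrm2_neg1 /px /py /pz /=.
    by rewrite normrN.
have mo : measurable_fun setT (@octant R).
  apply: measurable_and; first exact: measurable_pos1.
  by apply: measurable_and; apply: measurable_fun_ler;
    (exact: measurable_cst || exact: measurable_snd3 || exact: measurable_thd3).
have E2 : iter3 (cut (@octant R) (ball_weight in_Cr)) = iter3 (cone_weight y (in_cell y)).
  have ps := preserving_sub y.
  refine (etrans (iter3_map ps ps ps (nnmeas_cut mo nW)) _).
  apply: eq_integral => a _; apply: eq_integral => b _; apply: eq_integral => c _.
  rewrite /cut /ball_weight /cone_weight -in_cell_octant /=.
  by rewrite coneT_nrm2; case: (octant _).
rewrite E1 E2 cone_cell; set J := integral _ _ _.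
have Jf : J \is a fin_num by exact: integrable_fin_num cell_integral_fin.
by rewrite -(fineK Jf) -!EFinM /=; ring.
Qed.
End bodies.

Section integral_comparison.
Variable R : realType.
Local Notation mu := (@lebesgue_measure R).

Lemma itv_integrable (f : R -> R) (a b : R) :
  (forall x, a <= x <= b -> {for x, continuous f}) -> mu.-integrable `[a, b] (EFin \o f).
Proof.
move=> cf; apply: continuous_compact_integrable; first exact: segment_compact.
by apply: continuous_in_subspaceT => x; rewrite inE /= in_itv /= => xab; exact: cf.
Qed.

Lemma fine_integral_le (f g : R -> R) (a b : R) :
  (forall x, a <= x <= b -> {for x, continuous f}) ->
  (forall x, a <= x <= b -> {for x, continuous g}) ->
  (forall x, a <= x <= b -> f x <= g x) ->
  fine (\int[mu]_(x in `[a, b]) (f x)%:E)%E <= fine (\int[mu]_(x in `[a, b]) (g x)%:E)%E.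
Proof.
move=> cf cg fg; have If := itv_integrable cf; have Ig := itv_integrable cg.
apply: fine_le.
- exact: integrable_fin_num If.
- exact: integrable_fin_num Ig.
apply: le_integral => //.
by move=> x; rewrite inE /= in_itv /= => xab; rewrite lee_fin; exact: fg.
Qed.

Lemma fine_integral_derive (F f : R -> R) (a b : R) : a <= b ->
  (forall x, a <= x <= b -> deriv_at F x (f x)) ->
  (forall x, a <= x <= b -> {for x, continuous f}) ->
  fine (\int[mu]_(x in `[a, b]) (f x)%:E)%E = F b - F a.
Proof. by move=> ab dF cf; rewrite (integral_derive ab dF cf). Qed.
End integral_comparison.

(** * Volumes of the truncated hyperballs *)

Section hyperball_pieces.
Variables (R : realType) (y : R).
Hypotheses (y0 : 0 < y) (y1 : 1 < 3 * y ^+ 2) (y2 : 2 * y ^+ 2 < 1).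
Implicit Types (z v : R * R * R) (s t a b c u w : R).
Local Notation mu := (@lebesgue_measure R).

Lemma nrm2_vtx1 : nrm2 (vtx y 1) = 3 * y ^+ 2.
Proof. by rewrite /nrm2 /dot /vtx /mkpt /px /py /pz /=; ring. Qed.

Lemma hyperball_in s : 0 <= s -> hyperball (vtx y 1) s `&` Cr y =
  [set z | in_Cr y z && in_ball y (tanh s) z].
Proof.
move=> s0; have e0 := excess_gt0 y1.
have B1 : 1 < nrm2 (vtx y 1) by rewrite nrm2_vtx1.
have key (z : pt R) : nrm2 z < 1 ->
    (setdist [set z] (polar_plane (vtx y 1)) <= s) = in_ball y (tanh s) z.
  move=> z1; have T0 : 0 < 1 - nrm2 z by rewrite subr_gt0.
  have c0 := cosh_gt0 s; have pc := plane_chord_ge1 B1 z1.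
  rewrite (setdist_point_polar B1 z1) arcosh_le //; last first.
    by rewrite -[leLHS]sqrtr1 ler_wsqrtr.
  rewrite -(@ler_pXn2r _ 2) ?nnegrE ?sqrtr_ge0 ?(ltW c0) // sqr_sqrtr; last by lra.
  rewrite cosh2_sinh2 /plane_chord lerD2l ler_pdivrMr; last first.
    by rewrite mulr_gt0 // subr_gt0.
  rewrite /in_ball tanh_sqr nrm2_vtx1 -/(excess y) ler_pdivrMr ?exprn_gt0 //.
  congr (_ <= _); rewrite /tanh; field; by rewrite gt_eqF.
rewrite Cr_in //; apply/seteqP; split=> z /=.
  by move=> [[z1 h] zC]; rewrite zC -key.
move=> /andP[zC zb]; split => //; have z1 : nrm2 z < 1 by case/andP: zC.
by split => //; rewrite key.
Qed.

Lemma measurable_in_ball t : measurable_fun setT (in_ball y t).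
Proof.
have md : measurable_fun setT (fun z : pt R => dot z (vtx y 1)).
  rewrite /dot; apply: measurable_funD; first apply: measurable_funD;
    apply: measurable_funM => //; (exact: measurable_fst3 || exact: measurable_snd3 || exact: measurable_thd3 || exact: measurable_cst).
apply: measurable_fun_ler; apply: measurable_funM.
- by apply: measurable_funX; apply: measurable_funB => //; exact: measurable_cst.
- exact: measurable_cst.
- exact: measurable_cst.
- by apply: measurable_funB; [exact: measurable_cst|exact: measurable_nrm2].
Qed.

(** Coordinates measured inwards from [B_1 = (y, -y, -y)]. The change of signs makes [nrm2] and the
    product with [B_1] the same functions [coneT] and [coneD] as for the vertex [(y, y, y)]. *)
Definition piece t v := in_Cr y (y - v.1.1, v.1.2 - y, v.2 - y) &&
  in_ball y t (y - v.1.1, v.1.2 - y, v.2 - y).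

Lemma nrm2_piece a b c : 1 - nrm2 ((y - a, b - y, c - y) : pt R) = coneT y (a, b, c).
Proof. by rewrite /coneT /nrm2 /dot /px /py /pz /=; ring. Qed.

Lemma dot_piece a b c : 1 - dot ((y - a, b - y, c - y) : pt R) (vtx y 1) = coneD y (a, b, c).
Proof. by rewrite /coneD /dot /vtx /mkpt /px /py /pz /=; ring. Qed.

Lemma measurable_piece t : measurable_fun setT (piece t).
Proof.
have mm : measurable_fun setT (fun v : R * R * R => (y - v.1.1, v.1.2 - y, v.2 - y)).
  apply: measurable_mk3; apply: measurable_funB;
    (exact: measurable_fst3 || exact: measurable_snd3 || exact: measurable_thd3 || exact: measurable_cst).
apply: measurable_and.
  exact: (measurableT_comp (measurable_in_Cr y) mm).
exact: (measurableT_comp (measurable_in_ball t) mm).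
Qed.

Lemma hvol_piece s : 0 <= s -> hvol (hyperball (vtx y 1) s `&` Cr y) =
  fine (iter3 (cone_weight y (piece (tanh s)))).
Proof.
move=> s0; rewrite (hyperball_in s0).
have mQ : measurable_fun setT (fun z : pt R => in_Cr y z && in_ball y (tanh s) z).
  by apply: measurable_and; [exact: measurable_in_Cr|exact: measurable_in_ball].
rewrite (hvol_iter3 mQ).
have ps := preserving_sub y; have pa := preserving_addC y.
rewrite (iter3_map ps pa pa (nnmeas_ball_weight mQ)).
refine (congr1 fine _); apply: eq_integral => a _; apply: eq_integral => b _; apply: eq_integral => c _.
by rewrite /ball_weight /cone_weight /piece /= nrm2_piece.
Qed.

Lemma piece_cap t v : piece t v -> in_cap y t v.
Proof.
case: v => -[a b] c; rewrite /piece /in_Cr /in_ball /in_cap -[nrm2 _ < 1]subr_gt0 nrm2_piece dot_piece /=.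
move=> /andP[/and5P[T0 ha hb hc hs] hball].
rewrite T0 hball !andbT; rewrite /px /py /pz /= in ha hb hc hs.
move: ha hb hc; rewrite !ler_norml => /andP[_ ha] /andP[hb _] /andP[hc _].
apply/and4P; split; [lra|lra|lra|].
rewrite /coneD /= subr_ge0; apply: le_trans hs; rewrite ler_pM2l //.
apply: lerD; first apply: lerD; first exact: ler_norm.
  by rewrite -normrN opprB ler_norm.
by rewrite -normrN opprB ler_norm.
Qed.

Theorem Vol_le s : 0 <= s -> hvol (hyperball (vtx y 1) s `&` Cr y) <=
  6 * (layer (tanh s) * (atan (Num.sqrt 3)^-1 - atan (edgeK y))).
Proof.
move=> s0; rewrite (hvol_piece s0); have tt := tanh_bound s0.
have nP := nnmeas_cone_weight y (measurable_piece (tanh s)).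
have nC := nnmeas_cone_weight y (measurable_in_cap y (tanh s)).
have le : (iter3 (cone_weight y (piece (tanh s))) <= iter3 (cone_weight y (in_cap y (tanh s))))%E.
  apply: (le_iter3 nP nC) => v; rewrite /cone_weight.
  case: ifPn => [/piece_cap -> //|_]; case: ifP => // _.
  by rewrite lee_fin invr_ge0 sqr_ge0.
have ge : (0 <= iter3 (cone_weight y (piece (tanh s))))%E.
  by do 3!apply: integral_ge0 => ? _; apply nP.2.
rewrite (cone_cap y0 y1 y2 tt) in le.
by move: le ge; case: (iter3 _) => // r; rewrite !lee_fin.
Qed.

(** The bound for [D^2] says that the height is at most that of a face centre, where the squared
    hyperbolic sine is [(1 - y^2) / excess]. Beyond the opposite face [D] would exceed [1 - y^2],
    while the bound keeps it below. *)
Lemma cap_above (x1 x2 x3 D : R) : x2 <= y -> x3 <= y -> D = 1 - y * (x1 + x2 + x3) ->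
  D ^+ 2 <= (1 - y ^+ 2) * (1 - (x1 ^+ 2 + x2 ^+ 2 + x3 ^+ 2)) -> - y <= x1.
Proof.
move=> h2 h3 DE hD; rewrite leNgt; apply/negP => hx.
have n0 : 0 < 1 - y ^+ 2 by move: y2 (sqr_ge0 y); lra.
have D1 : 1 - y ^+ 2 < D.
  have : 0 < y * (- x1 + (y - x2) + (y - x3) - y) by rewrite mulr_gt0 //; lra.
  rewrite DE; lra.
have x12 : y ^+ 2 < x1 ^+ 2.
  by rewrite -[x1 ^+ 2]sqrrN ltr_pXn2r ?nnegrE //; move: y0; lra.
have : (1 - y ^+ 2) * (1 - (x1 ^+ 2 + x2 ^+ 2 + x3 ^+ 2)) <= (1 - y ^+ 2) * (1 - y ^+ 2).
  by rewrite ler_pM2l //; move: (sqr_ge0 x2) (sqr_ge0 x3) x12; lra.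
have : (1 - y ^+ 2) * (1 - y ^+ 2) < D ^+ 2 by rewrite expr2 ltr_pM // ltW.
lra.
Qed.

(** A window around the value 0.616 taken at [p = 7], the one order for which exact volumes are
    needed. *)
Hypotheses (n1 : 6 / 10 <= 1 - y ^+ 2) (n2 : 1 - y ^+ 2 <= 63 / 100).

(** Truncation at an adjacent vertex. If it failed, then [U > D / 2] and [q > 1 - D / 2]; with
    [x2^2 + x3^2 >= (x2 + x3)^2 / 2] the height bound would give [(1 - n) D^2 <= n (1 - n - D^2 / 4
    - (1 - D / 2)^2 / 2)] for [n = 1 - y^2], which is impossible in the window. *)
Lemma cap_one_flip (x1 x2 x3 D : R) : x2 <= y -> x3 <= y -> D = 1 - y * (x1 + x2 + x3) ->
  0 <= D -> D ^+ 2 <= (1 - y ^+ 2) * (1 - (x1 ^+ 2 + x2 ^+ 2 + x3 ^+ 2)) ->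
  y * (- x1 + x2 + x3) <= 1.
Proof.
move=> h2 h3 DE D0 hD; rewrite leNgt; apply/negP => hx.
pose U := - (y * x1); pose q := y * x2 + y * x3.
have hU : D / 2 < U by rewrite DE /U; lra.
have hq : q = 1 - D + U by rewrite /q /U DE; ring.
move: n1 n2 y0; set n := 1 - y ^+ 2 in hD *; move=> n1' n2' y0'.
have D1 : D < 1.
  rewrite -(@ltr_pXn2r _ 2) ?nnegrE ?ler01 // expr1n; apply: le_lt_trans hD _.
  have S0 : 0 <= x1 ^+ 2 + x2 ^+ 2 + x3 ^+ 2 by rewrite !addr_ge0 ?sqr_ge0.
  have : n * (1 - (x1 ^+ 2 + x2 ^+ 2 + x3 ^+ 2)) <= n * 1 by rewrite ler_pM2l; lra.
  lra.
have yn : y ^+ 2 = 1 - n by rewrite /n; ring.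
have hD2 : y ^+ 2 * D ^+ 2 <= n * (y ^+ 2 - U ^+ 2 - q ^+ 2 / 2).
  have h1 : y ^+ 2 * D ^+ 2 <= y ^+ 2 * (n * (1 - (x1 ^+ 2 + x2 ^+ 2 + x3 ^+ 2))).
    by rewrite ler_wpM2l ?sqr_ge0.
  apply: le_trans h1 _; rewrite mulrCA ler_wpM2l; [|lra|].
    by lra.
  have -> : y ^+ 2 * (1 - (x1 ^+ 2 + x2 ^+ 2 + x3 ^+ 2)) =
    y ^+ 2 - U ^+ 2 - ((y * x2 + y * x3) ^+ 2 / 2 + (y * x2 - y * x3) ^+ 2 / 2).
    by rewrite /U; field.
  by have := sqr_ge0 (y * x2 - y * x3); rewrite -/q; lra.
have U2 : (D / 2) ^+ 2 <= U ^+ 2 by rewrite ler_pXn2r ?nnegrE //; lra.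
have q2 : (1 - D / 2) ^+ 2 <= q ^+ 2 by rewrite ler_pXn2r ?nnegrE //; lra.
have : (1 - n) * D ^+ 2 <= n * ((1 - n) - (D / 2) ^+ 2 - (1 - D / 2) ^+ 2 / 2).
  rewrite -yn; apply: le_trans hD2 _; rewrite ler_wpM2l //; lra.
(* The first three products remove [n] at the ends of its window; what remains is a quadratic in [D]
   with its minimum near 1/4, hence the square in [e4]. *)
have e1 : 0 <= (63 / 100 - n) * D ^+ 2 by rewrite mulr_ge0 ?sqr_ge0 //; lra.
have e2 : 0 <= (63 / 100 - n) * D by rewrite mulr_ge0 //; lra.
have e3 : 0 <= (n - 6 / 10) * (n - 1 / 2) by rewrite mulr_ge0 //; lra.
have e4 := sqr_ge0 (D - 1 / 4).
move: e1 e2 e3 e4; rewrite !expr2; lra.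
Qed.

(** Since [D < 1], the sum [x1 + x2 + x3] is positive, so the left side is below
    [2 y x3 <= 2 y^2 <= 8 / 10]. *)
Lemma cap_two_flips (x1 x2 x3 D : R) : x3 <= y -> D = 1 - y * (x1 + x2 + x3) ->
  0 <= D -> D ^+ 2 <= (1 - y ^+ 2) * (1 - (x1 ^+ 2 + x2 ^+ 2 + x3 ^+ 2)) ->
  y * (- x1 - x2 + x3) <= 1.
Proof.
move=> h3 DE D0 hD; rewrite leNgt; apply/negP => hx.
have D1 : D < 1.
  rewrite -(@ltr_pXn2r _ 2) ?nnegrE ?ler01 // expr1n; apply: le_lt_trans hD _.
  have S0 : 0 <= x1 ^+ 2 + x2 ^+ 2 + x3 ^+ 2 by rewrite !addr_ge0 ?sqr_ge0.
  have : (1 - y ^+ 2) * (1 - (x1 ^+ 2 + x2 ^+ 2 + x3 ^+ 2)) <= (1 - y ^+ 2) * 1.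
    by rewrite ler_pM2l; move: n1; lra.
  by move: n2; lra.
have h : 0 <= y * (y - x3) by rewrite mulr_ge0 ?subr_ge0 ?(ltW y0).
by move: n1 h hx; rewrite DE in D1 *; rewrite expr2; lra.
Qed.

Lemma cap_piece t v : 0 <= t < 1 -> excess y * t ^+ 2 <= (1 - y ^+ 2) * (1 - t ^+ 2) ->
  in_cap y t v -> piece t v.
Proof.
move=> tt ht; case: v => -[a b] c; rewrite /piece /in_Cr /in_ball /in_cap -[nrm2 _ < 1]subr_gt0 nrm2_piece dot_piece /=.
move=> /and5P[a0 b0 c0 D0 /andP[T0 hball]].
rewrite T0 hball andbT /= /px /py /pz /=.
have t2 : 0 < 1 - t ^+ 2.
  have -> : 1 - t ^+ 2 = (1 - t) * (1 + t) by ring.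
  by case/andP: tt => t0 t1; apply: mulr_gt0; lra.
have hD : coneD y (a, b, c) ^+ 2 <= (1 - y ^+ 2) * coneT y (a, b, c).
  rewrite -(@ler_pM2r _ (1 - t ^+ 2)) //; apply: le_trans hball _.
  by rewrite [leRHS]mulrAC ler_pM2r.
move: D0 hD {T0 hball}; rewrite /coneD /coneT /=.
(* Absolute values hide the signs of [B_1], so the three coordinates play equal roles and each
   estimate is applied to their rotations. *)
pose x1 := y - a; pose x2 := y - b; pose x3 := y - c.
rewrite -/x1 -/x2 -/x3 -[b - y]opprB -[c - y]opprB -/x2 -/x3 !normrN.
have [h1 h2 h3] : [/\ x1 <= y, x2 <= y & x3 <= y] by rewrite /x1 /x2 /x3; split; lra.
move: h1 h2 h3; move: x1 x2 x3 => x1 x2 x3 h1 h2 h3 {a0 b0 c0}.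
set D := 1 - _ => D0 hD.
have e123 : D = 1 - y * (x1 + x2 + x3) by [].
have e231 : D = 1 - y * (x2 + x3 + x1) by rewrite e123; ring.
have e312 : D = 1 - y * (x3 + x1 + x2) by rewrite e123; ring.
have n231 : D ^+ 2 <= (1 - y ^+ 2) * (1 - (x2 ^+ 2 + x3 ^+ 2 + x1 ^+ 2)).
  by apply: le_trans hD _; rewrite le_eqVlt; apply/orP; left; apply/eqP; ring.
have n312 : D ^+ 2 <= (1 - y ^+ 2) * (1 - (x3 ^+ 2 + x1 ^+ 2 + x2 ^+ 2)).
  by apply: le_trans hD _; rewrite le_eqVlt; apply/orP; left; apply/eqP; ring.
have l1 := cap_above h2 h3 e123 hD.
have l2 := cap_above h3 h1 e231 n231.
have l3 := cap_above h1 h2 e312 n312.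
rewrite !ler_norml l1 l2 l3 h1 h2 h3 /=.
have f1 := cap_one_flip h2 h3 e123 D0 hD.
have f2 := cap_one_flip h3 h1 e231 D0 n231.
have f3 := cap_one_flip h1 h2 e312 D0 n312.
have g3 := cap_two_flips h3 e123 D0 hD.
have g1 := cap_two_flips h1 e231 D0 n231.
have g2 := cap_two_flips h2 e312 D0 n312.
(* The truncation at the opposite vertex, where all three signs are flipped. *)
have D2 : D <= 2.
  rewrite -(@ler_pXn2r _ 2) ?nnegrE //; apply: le_trans hD _.
  have S0 : 0 <= x1 ^+ 2 + x2 ^+ 2 + x3 ^+ 2 by rewrite !addr_ge0 ?sqr_ge0.
  have : (1 - y ^+ 2) * (1 - (x1 ^+ 2 + x2 ^+ 2 + x3 ^+ 2)) <= (1 - y ^+ 2) * 1.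
    by rewrite ler_pM2l; move: n1; lra.
  by move: n2; lra.
move: D0 D2; rewrite e123; clear hD n231 n312 l1 l2 l3 e231 e312 t2 tt.
case: (ger0P x1) => _; case: (ger0P x2) => _; case: (ger0P x3) => _; lra.
Qed.

Theorem Vol_eq s : 0 <= s -> excess y * sinh s ^+ 2 <= 1 - y ^+ 2 ->
  hvol (hyperball (vtx y 1) s `&` Cr y) =
  6 * (layer (tanh s) * (atan (Num.sqrt 3)^-1 - atan (edgeK y))).
Proof.
move=> s0 hs; rewrite (hvol_piece s0); have tt := tanh_bound s0.
have -> : cone_weight y (piece (tanh s)) = cone_weight y (in_cap y (tanh s)).
  apply/funext => v; rewrite /cone_weight.
  have -> // : piece (tanh s) v = in_cap y (tanh s) v.
  apply/idP/idP; first exact: piece_cap.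
  apply: cap_piece => //; rewrite tanh_sqr /tanh exprMn exprVn mulrA.
  by rewrite ler_pM2r // invr_gt0 exprn_gt0 // cosh_gt0.
by rewrite (cone_cap y0 y1 y2 tt).
Qed.
End hyperball_pieces.

(** * Angles and arctangents *)

Section angles.
Variable R : realType.
Implicit Types (x y : R).

Lemma cos3 x : cos (x + x + x) = 4 * cos x ^+ 3 - 3 * cos x.
Proof.
have := cos2Dsin2 x; rewrite !cosD sinD => h.
have -> : sin x * cos x + cos x * sin x = 2 * sin x * cos x by ring.
have s2 : sin x ^+ 2 = 1 - cos x ^+ 2 by rewrite -h; ring.
transitivity (cos x ^+ 3 - 3 * cos x * sin x ^+ 2); first by ring.
by rewrite s2; ring.
Qed.

Lemma cos2 x : cos (x + x) = 2 * cos x ^+ 2 - 1.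
Proof.
have := cos2Dsin2 x; rewrite cosD => h.
have s2 : sin x ^+ 2 = 1 - cos x ^+ 2 by rewrite -h; ring.
by rewrite -!expr2 s2; ring.
Qed.

Lemma tan_pi_div (q : R) : 2 < q ->
  tan (pi / q) ^+ 2 = (1 - cos (2 * pi / q)) / (1 + cos (2 * pi / q)).
Proof.
move=> q2; have pi0 := pi_gt0 R; have q0 : 0 < q by lra.
have xlt : pi / q < pi / 2 by rewrite ltr_pM2l // ltf_pV2 ?posrE.
have x0 : 0 < pi / q by rewrite divr_gt0.
have c0 : 0 < cos (pi / q) by apply: cos_gt0_pihalf; rewrite xlt andbT; lra.
have -> : 2 * pi / q = pi / q + pi / q by field; rewrite gt_eqF.
rewrite cos2 /tan exprMn exprVn; have := cos2Dsin2 (pi / q) => h.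
have -> : sin (pi / q) ^+ 2 = 1 - cos (pi / q) ^+ 2 by rewrite -h; ring.
have -> : 1 + (2 * cos (pi / q) ^+ 2 - 1) = 2 * cos (pi / q) ^+ 2 by ring.
by field; rewrite gt_eqF.
Qed.

Lemma atan_sqr_tan (q u : R) : 2 < q -> 0 <= u ->
  u ^+ 2 = (1 - cos (2 * pi / q)) / (1 + cos (2 * pi / q)) -> atan u = pi / q.
Proof.
move=> q2 u0 uE; have pi0 := pi_gt0 R; have q0 : 0 < q by lra.
have xlt : pi / q < pi / 2 by rewrite ltr_pM2l // ltf_pV2 ?posrE.
have x0 : 0 < pi / q by rewrite divr_gt0.
have c0 : 0 < cos (pi / q) by apply: cos_gt0_pihalf; rewrite xlt andbT; lra.
have s0 : 0 < sin (pi / q) by apply: sin_gt0_pihalf; rewrite x0.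
have -> : u = tan (pi / q).
  have t0 : 0 <= tan (pi / q) by rewrite /tan divr_ge0 // ltW.
  apply/eqP; rewrite -(@eqrXn2 _ 2) // uE tan_pi_div //.
by rewrite tanK // in_itv /= xlt andbT; lra.
Qed.

(** The triple angle is [pi], so [c] is a root of [(c + 1) (2 c - 1)^2], and it is positive. *)
Lemma cos_pi3 : cos (2 * pi / 6) = 1 / 2 :> R.
Proof.
have pi0 := pi_gt0 R.
have c0 : 0 < cos (2 * pi / 6 : R) by apply: cos_gt0_pihalf; apply/andP; split; lra.
have := cos3 (2 * pi / 6); have -> : 2 * pi / 6 + 2 * pi / 6 + 2 * pi / 6 = pi :> R by field.
rewrite cospi; set c := cos _ in c0 *; move=> h.
have h2 : (c + 1) * (2 * c - 1) ^+ 2 = 0.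
  have -> : (c + 1) * (2 * c - 1) ^+ 2 = 4 * c ^+ 3 - 3 * c + 1 by ring.
  by rewrite -h; ring.
move/eqP: h2; rewrite mulf_eq0 sqrf_eq0 => /orP[/eqP|/eqP]; lra.
Qed.

Lemma atan_pi6 : atan (Num.sqrt 3)^-1 = pi / 6 :> R.
Proof.
apply: atan_sqr_tan; [by lra|by rewrite invr_ge0 sqrtr_ge0|].
by rewrite cos_pi3 exprVn sqr_sqrtr //; field.
Qed.

Lemma cos_gt_half (q : R) : 6 < q -> 1 / 2 < cos (2 * pi / q).
Proof.
move=> q6; have pi0 := pi_gt0 R; have q0 : 0 < q by lra.
have h6 : 0 <= 2 * @pi R / 6 <= @pi R by rewrite divr_ge0 ?mulr_ge0 ?(ltW pi0) //= ler_pdivrMr //; lra.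
have hq : 0 <= 2 * @pi R / q <= @pi R.
  by rewrite divr_ge0 ?mulr_ge0 ?(ltW pi0) ?(ltW q0) //= ler_pdivrMr // mulrC ler_pM2l //; lra.
by rewrite -cos_pi3 ltr_cos ?in_itv //= ltr_pM2l ?mulr_gt0 // ltf_pV2 ?posrE.
Qed.

Lemma cos_lt1 (q : R) : 6 < q -> cos (2 * pi / q) < 1.
Proof.
move=> q6; have pi0 := pi_gt0 R; have q0 : 0 < q by lra.
have hq : 0 <= 2 * @pi R / q <= @pi R.
  by rewrite divr_ge0 ?mulr_ge0 ?(ltW pi0) ?(ltW q0) //= ler_pdivrMr // mulrC ler_pM2l //; lra.
have h0 : (0 : R) \in `[0, pi] by rewrite in_itv /= lexx (ltW pi0).
have h1 : 2 * pi / q \in `[0, pi] by rewrite in_itv.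
by rewrite -[ltRHS](@cos0 R) (ltr_cos h0 h1) divr_gt0 ?mulr_gt0.
Qed.

Lemma acos_out x : 1 < x -> acos x = 0.
Proof.
move=> x1; rewrite acos.unlock; apply: xgetPN => z [_ zx].
by have := cos_le1 z; rewrite zx; lra.
Qed.
End angles.

(** * The cube parameter in terms of the dihedral angle *)

Section cube_parameter.
Variables (R : realType) (p : nat).
Hypothesis p7 : (7 <= p)%N.
Local Notation q := (p%:R : R).
Local Notation y := (yp q).
Local Notation c := (cos (2 * pi / q)).

Let q6 : 6 < q.
Proof. by rewrite ltr_nat. Qed.

Lemma dihedral_cube (u : R) : 0 < u < 1 ->
  dihedral (mkpt u^-1 0 0) (mkpt 0 u^-1 0) = acos (u ^+ 2 / (1 - u ^+ 2)).
Proof.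
move=> /andP[u0 u1]; rewrite /dihedral /nrm2 /dot /mkpt /px /py /pz /=.
have n0 : 0 < 1 - u ^+ 2.
  have -> : 1 - u ^+ 2 = (1 - u) * (1 + u) by ring.
  by apply: mulr_gt0; lra.
congr acos; rewrite !mulr0 !mul0r !addr0 !add0r opprK.
have -> : (u^-1 * u^-1 - 1) * (u^-1 * u^-1 - 1) = ((1 - u ^+ 2) / u ^+ 2) ^+ 2.
  by field; rewrite gt_eqF.
rewrite sqrtr_sqr ger0_norm; last by rewrite divr_ge0 ?sqr_ge0 ?ltW.
by rewrite div1r invf_div.
Qed.

Lemma yp_props : [/\ 0 < y, y < 1 & y ^+ 2 / (1 - y ^+ 2) = c].
Proof.
have c1 := cos_gt_half q6; have c2 := cos_lt1 q6; have pi0 := pi_gt0 R.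
have q0 : 0 < q by have := q6; lra.
have th0 : 0 < 2 * pi / q by rewrite divr_gt0 ?mulr_gt0.
have thpi : 2 * pi / q <= pi.
  by rewrite ler_pdivrMr // mulrC ler_pM2l //; have := q6; lra.
have s3 : 0 < (Num.sqrt 3)^-1 :> R by rewrite invr_gt0 sqrtr_gt0.
have s32 : ((Num.sqrt 3)^-1) ^+ 2 = 1 / 3 :> R by rewrite exprVn sqr_sqrtr ?div1r.
have : exists u : R, (Num.sqrt 3)^-1 < u < 1 /\
    dihedral (mkpt u^-1 0 0) (mkpt 0 u^-1 0) = 2 * pi / q.
  (* The solution of [u^2 / (1 - u^2) = c]; it shows that the set behind [yp] is inhabited, so that
     [xget] does not return its default 0. *)
  pose u := Num.sqrt (c / (1 + c)).
  have d0 : 0 < 1 + c by lra.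
  have u2 : u ^+ 2 = c / (1 + c) by rewrite sqr_sqrtr // divr_ge0 // ltW //; lra.
  have u0 : 0 <= u by rewrite sqrtr_ge0.
  have ua : (Num.sqrt 3)^-1 < u.
    rewrite -(@ltr_pXn2r _ 2) ?nnegrE ?(ltW s3) // u2 s32 ltr_pdivlMr //; lra.
  have ub : u < 1.
    by rewrite -(@ltr_pXn2r _ 2) ?nnegrE // u2 expr1n ltr_pdivrMr //; lra.
  exists u; split; first by rewrite ua.
  rewrite dihedral_cube ?ub ?andbT ?(lt_trans s3) // u2.
  have -> : c / (1 + c) / (1 - c / (1 + c)) = c.
    by field; rewrite (_ : 1 + c - c = 1) ?oner_eq0 /= ?gt_eqF //; ring.
  by rewrite cosK // in_itv /= thpi (ltW th0).
move=> /(xgetPex 0); rewrite -/(yp q) => -[/andP[ya yb] yE].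
have y0 : 0 < y by exact: lt_trans ya.
split => //; rewrite dihedral_cube ?y0 // in yE.
have n0 : 0 < 1 - y ^+ 2.
  have -> : 1 - y ^+ 2 = (1 - y) * (1 + y) by ring.
  by apply: mulr_gt0; lra.
have r0 : 0 <= y ^+ 2 / (1 - y ^+ 2) by rewrite divr_ge0 ?sqr_ge0 ?ltW.
(* Above 1 [acos] takes its default value 0, which cannot equal the positive angle [2 pi / p]. Only
   this excludes spurious solutions close to [y = 1]. *)
case: (lerP (y ^+ 2 / (1 - y ^+ 2)) 1) => r1; last first.
  by rewrite (acos_out r1) in yE; move: th0; rewrite -yE ltxx.
by rewrite -yE acosK // in_itv /= r1 andbT; lra.
Qed.

Lemma yp_gt0 : 0 < y. Proof. by case: yp_props. Qed.

Lemma yp_sqr : y ^+ 2 = c / (1 + c).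
Proof.
have [y0 y1 <-] := yp_props.
have n0 : 0 < 1 - y ^+ 2.
  have -> : 1 - y ^+ 2 = (1 - y) * (1 + y) by ring.
  by apply: mulr_gt0; lra.
have -> : 1 + y ^+ 2 / (1 - y ^+ 2) = (1 - y ^+ 2)^-1 by field; rewrite gt_eqF.
by rewrite invrK mulfVK // gt_eqF.
Qed.

Lemma yp_lo : 1 < 3 * y ^+ 2.
Proof.
have c1 := cos_gt_half q6; rewrite yp_sqr mulrA ltr_pdivlMr; lra.
Qed.

Lemma yp_hi : 2 * y ^+ 2 < 1.
Proof.
have c1 := cos_gt_half q6; have c2 := cos_lt1 q6; rewrite yp_sqr mulrA ltr_pdivrMr; lra.
Qed.

(** With [y^2 = c / (1 + c)] the square of [edgeK] is [(1 - c) / (1 + c)], the half-angle formula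
    for [tan (pi / q)^2]. *)
Lemma atan_edgeK : atan (edgeK y) = pi / q.
Proof.
have c1 := cos_gt_half q6; apply: atan_sqr_tan.
- by have := q6; lra.
- exact: sqrtr_ge0.
- rewrite edgeK_sqr ?yp_hi // yp_sqr; field; rewrite gt_eqF //; lra.
Qed.

Lemma cube_angle : 6 * (atan (Num.sqrt 3)^-1 - atan (edgeK y)) = pi - 6 * atan (edgeK y).
Proof. by rewrite atan_pi6; field. Qed.
End cube_parameter.

(** * Distances from a truncation plane *)

Section distances_in_the_cube.
Variables (R : realType) (y : R).
Hypotheses (y0 : 0 < y) (y1 : 1 < 3 * y ^+ 2) (y2 : 2 * y ^+ 2 < 1).

(* The hyperbolic tangent of half the distance between two adjacent truncation planes. *)
Definition edgeT := edgeK y / y.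

Lemma edgeT_sqr : edgeT ^+ 2 = (1 - 2 * y ^+ 2) / y ^+ 2.
Proof. by rewrite /edgeT exprMn exprVn edgeK_sqr. Qed.

Lemma edgeT_gt0 : 0 < edgeT.
Proof. by rewrite divr_gt0 // edgeK_gt0. Qed.

Lemma edgeT_compl : 1 - edgeT ^+ 2 = excess y / y ^+ 2.
Proof. by rewrite edgeT_sqr /excess; field; rewrite gt_eqF. Qed.

Lemma edgeT_compl_gt0 : 0 < 1 - edgeT ^+ 2.
Proof. by rewrite edgeT_compl divr_gt0 ?exprn_gt0 ?excess_gt0. Qed.

Lemma edgeT_bound : -1 < edgeT < 1.
Proof. by apply: ratio_lt1_sqr; move: edgeT_compl_gt0; lra. Qed.

Lemma sqr_y_edgeT : y ^+ 2 = 1 / (2 + edgeT ^+ 2).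
Proof.
rewrite edgeT_sqr; field; rewrite gt_eqF //=.
by have -> : 2 * y ^+ 2 + (1 - 2 * y ^+ 2) = 1 :> R by ring.
Qed.

Lemma cosh_atanh_sqr (k : R) : -1 < k < 1 -> cosh (atanh k) ^+ 2 = (1 - k ^+ 2)^-1.
Proof.
by move=> kk; have := tanh_sqr (atanh k); rewrite atanhK // => ->; rewrite invrK.
Qed.

Lemma sinh_atanh (k : R) : -1 < k < 1 -> sinh (atanh k) = k * cosh (atanh k).
Proof.
by move=> kk; rewrite -[X in X * _](atanhK kk) /tanh divfK // gt_eqF // cosh_gt0.
Qed.

Lemma cosh_double_atanh (k : R) : -1 < k < 1 ->
  cosh (2 * atanh k) = (1 + k ^+ 2) / (1 - k ^+ 2).
Proof.
move=> kk; have -> : 2 * atanh k = atanh k + atanh k by ring.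
rewrite coshD (sinh_atanh kk); have := cosh_atanh_sqr kk.
set c := cosh _ => c2; have -> : c * c + k * c * (k * c) = (1 + k ^+ 2) * c ^+ 2 by ring.
by rewrite c2.
Qed.

Lemma sinh_double_atanh (k : R) : -1 < k < 1 ->
  sinh (2 * atanh k) = 2 * k / (1 - k ^+ 2).
Proof.
move=> kk; have -> : 2 * atanh k = atanh k + atanh k by ring.
rewrite sinhD (sinh_atanh kk) -(cosh_atanh_sqr kk); ring.
Qed.

Lemma atanh_ge0 (k : R) : 0 <= k < 1 -> 0 <= atanh k.
Proof.
move=> /andP[k0 k1]; rewrite /atanh divr_ge0 // ln_ge0 // ler_pdivlMr; lra.
Qed.

(** The edge through both poles is orthogonal to both planes, so its crossings with them realize the
    distance. For the lower bound, [plane_chord_le] first reduces a pair of points to the distance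
    from [a] to the second plane. *)
Lemma edge_dist : setdist (polar_plane (vtx y 1)) (polar_plane (vtx y 2)) = 2 * atanh edgeT.
Proof.
have kb := edgeT_bound; have k0 := edgeT_gt0; have D0 := edgeT_compl_gt0.
have e0 := excess_gt0 y1; have d0 : 0 < 1 - 2 * y ^+ 2 by rewrite subr_gt0.
have yn : y != 0 by rewrite gt_eqF.
set C := (1 + edgeT ^+ 2) / (1 - edgeT ^+ 2).
have C1 : 1 <= C by rewrite /C ler_pdivlMr //; have := sqr_ge0 edgeT; lra.
have CE : C = (1 - y ^+ 2) / excess y.
  have en : excess y != 0 by rewrite gt_eqF.
  rewrite /C edgeT_compl edgeT_sqr; field.
  by rewrite en yn.
have dE : 2 * atanh edgeT = arcosh C.
  rewrite /C -(cosh_double_atanh kb) arcosh_cosh // mulr_ge0 // atanh_ge0 //.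
  by rewrite (ltW k0); case/andP: kb.
have v2 : nrm2 (vtx y 2) = 3 * y ^+ 2.
  by rewrite /nrm2 /dot /vtx /mkpt /px /py /pz /=; ring.
rewrite dE; apply: inf_attained.
  (* The edge [(y, *, -y)] meets the two planes at second coordinate [-mu] and [mu]. *)
  pose mu := (1 - 2 * y ^+ 2) / y.
  have hn : 2 * y ^+ 2 + mu ^+ 2 < 1.
    have -> : mu ^+ 2 = edgeT ^+ 2 * (1 - 2 * y ^+ 2) by rewrite edgeT_sqr /mu; field.
    have : 0 < (1 - edgeT ^+ 2) * (1 - 2 * y ^+ 2) by rewrite mulr_gt0.
    lra.
  have na : nrm2 (mkpt y (- mu) (- y)) = 2 * y ^+ 2 + mu ^+ 2.
    by rewrite /nrm2 /dot /mkpt /px /py /pz /=; ring.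
  have nb : nrm2 (mkpt y mu (- y)) = 2 * y ^+ 2 + mu ^+ 2.
    by rewrite /nrm2 /dot /mkpt /px /py /pz /=; ring.
  exists (mkpt y (- mu) (- y)), (mkpt y mu (- y)).
  have ha : hyp_space (mkpt y (- mu) (- y)) by rewrite /hyp_space /= na.
  have hb : hyp_space (mkpt y mu (- y)) by rewrite /hyp_space /= nb.
  split; [split => //|split; [split => //|split => //; split => //]].
  - by rewrite /dot /vtx /mkpt /mu /px /py /pz /=; field.
  - by rewrite /dot /vtx /mkpt /mu /px /py /pz /=; field.
  - rewrite hdistE //; congr arcosh; rewrite /chord na nb.
    have -> : dot (mkpt y (- mu) (- y)) (mkpt y mu (- y)) = 2 * y ^+ 2 - mu ^+ 2.
      by rewrite /dot /mkpt /px /py /pz /=; ring.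
    have -> : (1 - (2 * y ^+ 2 - mu ^+ 2)) ^+ 2 /
      ((1 - (2 * y ^+ 2 + mu ^+ 2)) * (1 - (2 * y ^+ 2 + mu ^+ 2))) = C ^+ 2.
      have -> : mu ^+ 2 = edgeT ^+ 2 * (1 - 2 * y ^+ 2) by rewrite edgeT_sqr /mu; field.
      have -> : 1 - (2 * y ^+ 2 - edgeT ^+ 2 * (1 - 2 * y ^+ 2)) = (1 - 2 * y ^+ 2) * (1 + edgeT ^+ 2) by ring.
      have -> : 1 - (2 * y ^+ 2 + edgeT ^+ 2 * (1 - 2 * y ^+ 2)) = (1 - 2 * y ^+ 2) * (1 - edgeT ^+ 2) by ring.
      by rewrite /C; field; rewrite !gt_eqF.
    by rewrite sqrtr_sqr ger0_norm //; lra.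
move=> _ [a [b [[a1 aB] [bB [_ [b1 ->]]]]]].
rewrite hdistE //; have B2 : 1 < nrm2 (vtx y 2) by rewrite v2.
have le := plane_chord_le B2 a1 bB.
have -> : C = Num.sqrt (C ^+ 2) by rewrite sqrtr_sqr ger0_norm //; lra.
apply: le_arcosh_sqrt; first by rewrite expr_ge1 //; lra.
apply: le_trans le; rewrite /plane_chord v2 -/(excess y).
have T0 : 0 < 1 - nrm2 a by rewrite subr_gt0.
have D2 : 1 - dot a (vtx y 2) = - (2 * y * py a).
  by move: aB; rewrite /dot /vtx /mkpt /px /py /pz /=; lra.
rewrite D2 CE -lerBlDl ler_pdivlMr ?mulr_gt0 //.
have aB' : y * (px a - py a - pz a) = 1.
  by move: aB; rewrite /dot /vtx /mkpt /px /py /pz /=; lra.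
have aE : px a - pz a = y^-1 + py a.
  have -> : y^-1 = px a - py a - pz a by rewrite -[LHS]mulr1 -aB' mulKf.
  by ring.
(* A sum of two squares, both zero exactly at the crossing point [(y, -mu, -y)]. *)
have key : (1 - 2 * y ^+ 2) * (1 - nrm2 a) <= excess y * py a ^+ 2.
  rewrite -subr_ge0.
  have -> : excess y * py a ^+ 2 - (1 - 2 * y ^+ 2) * (1 - nrm2 a) =
     (py a + (1 - 2 * y ^+ 2) / y) ^+ 2 / 2 + (1 - 2 * y ^+ 2) * (px a + pz a) ^+ 2 / 2.
    have -> : nrm2 a = py a ^+ 2 + (px a - pz a) ^+ 2 / 2 + (px a + pz a) ^+ 2 / 2.
      by rewrite /nrm2 /dot; field.
    by rewrite aE /excess; field.
  by rewrite addr_ge0 // divr_ge0 ?sqr_ge0 // mulr_ge0 ?sqr_ge0 // ltW.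
have -> : (((1 - y ^+ 2) / excess y) ^+ 2 - 1) * (excess y * (1 - nrm2 a)) =
   4 * y ^+ 2 / excess y * ((1 - 2 * y ^+ 2) * (1 - nrm2 a)).
  have -> : ((1 - y ^+ 2) / excess y) ^+ 2 - 1 = ((1 - y ^+ 2) ^+ 2 - excess y ^+ 2) / excess y ^+ 2.
    by field; rewrite gt_eqF.
  have -> : (1 - y ^+ 2) ^+ 2 - excess y ^+ 2 = 4 * y ^+ 2 * (1 - 2 * y ^+ 2) by rewrite /excess; ring.
  by field; rewrite gt_eqF.
have -> : (- (2 * y * py a)) ^+ 2 = 4 * y ^+ 2 / excess y * (excess y * py a ^+ 2).
  by field; rewrite gt_eqF.
by rewrite ler_pM2l // divr_gt0 // mulr_gt0 // exprn_gt0.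
Qed.

Lemma center_dist : let s := setdist (polar_plane (vtx y 1)) [set mkpt y 0 0] in
  0 <= s /\ cosh s ^+ 2 = 2 / (1 - edgeT ^+ 2).
Proof.
have B1 : 1 < nrm2 (vtx y 1) by rewrite nrm2_vtx1.
have nz : nrm2 (mkpt y 0 0) = y ^+ 2 by rewrite /nrm2 /dot /mkpt /px /py /pz /=; ring.
have n0 : 0 < 1 - y ^+ 2 by move: y2 (sqr_ge0 y); lra.
have e0 := excess_gt0 y1.
have z1 : nrm2 (mkpt y 0 0) < 1 by rewrite nz -subr_gt0.
rewrite (setdist_polar_point B1 z1); have pc := plane_chord_ge1 B1 z1.
have sc : 1 <= Num.sqrt (plane_chord (vtx y 1) (mkpt y 0 0)) by rewrite -[leLHS]sqrtr1 ler_wsqrtr.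
split; first exact: arcosh_ge0.
rewrite arcoshK // sqr_sqrtr; last by lra.
rewrite /plane_chord nrm2_vtx1 nz edgeT_compl -/(excess y).
have -> : dot (mkpt y 0 0) (vtx y 1) = y ^+ 2 by rewrite /dot /vtx /mkpt /px /py /pz /=; ring.
have yn : y != 0 by rewrite gt_eqF.
have -> : 1 + (1 - y ^+ 2) ^+ 2 / (excess y * (1 - y ^+ 2)) = (excess y + (1 - y ^+ 2)) / excess y.
  by field; rewrite !gt_eqF.
have -> : excess y + (1 - y ^+ 2) = 2 * y ^+ 2 by rewrite /excess; ring.
by field; rewrite !gt_eqF.
Qed.

Lemma origin_dist : let t := setdist (polar_plane (vtx y 1)) [set mkpt 0 0 0] in
  0 <= t /\ cosh t ^+ 2 = 3 / (1 - edgeT ^+ 2).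
Proof.
have B1 : 1 < nrm2 (vtx y 1) by rewrite nrm2_vtx1.
have nz : nrm2 (mkpt 0 0 0) = 0 :> R by rewrite /nrm2 /dot /mkpt /px /py /pz /=; ring.
have e0 := excess_gt0 y1.
have z1 : nrm2 (mkpt 0 0 0) < 1 :> R by rewrite nz.
rewrite (setdist_polar_point B1 z1); have pc := plane_chord_ge1 B1 z1.
have sc : 1 <= Num.sqrt (plane_chord (vtx y 1) (mkpt 0 0 0)) by rewrite -[leLHS]sqrtr1 ler_wsqrtr.
split; first exact: arcosh_ge0.
rewrite arcoshK // sqr_sqrtr; last by lra.
rewrite /plane_chord nrm2_vtx1 nz edgeT_compl -/(excess y).
have -> : dot (mkpt 0 0 0) (vtx y 1) = 0 by rewrite /dot /vtx /mkpt /px /py /pz /=; ring.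
rewrite !subr0 expr1n mulr1 invf_div mulrA.
have -> : 3 * y ^+ 2 = 1 + excess y by rewrite /excess; ring.
by field; rewrite gt_eqF.
Qed.
End distances_in_the_cube.

(** * The distances and volumes at order p *)

Section packing_parameters.
Variables (R : realType) (p : nat).
Hypothesis p7 : (7 <= p)%N.
Local Notation y := (yp (p%:R : R)).
Local Notation k := (edgeT y).

Definition truncation_area : R := pi - 6 * (pi / p%:R).

Lemma h_E : h_ R p = atanh k.
Proof.
rewrite /h_ edge_dist ?yp_gt0 ?yp_lo ?yp_hi //; by field.
Qed.

Lemma s_props : 0 <= s_ R p /\ cosh (s_ R p) ^+ 2 = 2 / (1 - k ^+ 2).
Proof. exact: (center_dist (yp_gt0 R p7) (yp_lo R p7) (yp_hi R p7)). Qed.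

Lemma t_props : 0 <= t_ R p /\ cosh (t_ R p) ^+ 2 = 3 / (1 - k ^+ 2).
Proof. exact: (origin_dist (yp_gt0 R p7) (yp_lo R p7) (yp_hi R p7)). Qed.

Lemma truncation_area_ge0 : 0 <= truncation_area.
Proof.
have pi0 := pi_gt0 R; have q7 : 7 <= p%:R :> R by rewrite ler_nat.
rewrite /truncation_area subr_ge0 mulrA ler_pdivrMr; last by lra.
by rewrite mulrC ler_pM2l //; lra.
Qed.

Lemma Vol_upper (s : R) : 0 <= s ->
  Vol p s <= truncation_area * (sinh s * cosh s + s) / 2.
Proof.
move=> s0; apply: le_trans (Vol_le (yp_gt0 R p7) (yp_lo R p7) (yp_hi R p7) s0) _.
rewrite layer_tanh mulrCA cube_angle atan_edgeK //.
rewrite le_eqVlt; apply/orP; left; apply/eqP; rewrite /truncation_area; ring.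
Qed.

(** From [cosh^2 = 2 / (1 - k^2)] at the face centre, [excess * sinh^2] equals [1 - y^2] there, the
    very limit in [Vol_eq]; [sinh] is monotone. *)
Lemma Vol_exact (s : R) : 6 / 10 <= 1 - y ^+ 2 -> 1 - y ^+ 2 <= 63 / 100 ->
  0 <= s -> s <= s_ R p ->
  Vol p s = truncation_area * (sinh s * cosh s + s) / 2.
Proof.
move=> n1 n2 s0 ss; have y0 := yp_gt0 R p7; have y1 := yp_lo R p7; have y2 := yp_hi R p7.
rewrite /Vol (Vol_eq y0 y1 y2 n1 n2 s0).
  rewrite layer_tanh mulrCA cube_angle atan_edgeK //.
  rewrite /truncation_area; ring.
have e0 := excess_gt0 y1.
have [sp sE] := s_props; rewrite (edgeT_compl y0 y2) in sE.
have : sinh s ^+ 2 <= sinh (s_ R p) ^+ 2.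
  by rewrite ler_pXn2r ?nnegrE ?sinh_ge0 // le_sinh.
have -> : sinh (s_ R p) ^+ 2 = (1 - y ^+ 2) / excess y.
  have := cosh2_sinh2 (s_ R p); rewrite sE => h.
  have -> : sinh (s_ R p) ^+ 2 = 2 / (excess y / y ^+ 2) - 1 by rewrite h; ring.
  have -> : 1 - y ^+ 2 = 2 * y ^+ 2 - excess y by rewrite /excess; ring.
  by field; rewrite !gt_eqF.
by rewrite ler_pdivlMr // mulrC.
Qed.
End packing_parameters.

(** * Numerators of the densities *)

Section numerators.
Variables (R : realType) (p : nat).
Hypothesis p7 : (7 <= p)%N.
Local Notation y := (yp (p%:R : R)).
Local Notation k := (edgeT y).
Local Notation h := (h_ R p).
Local Notation s := (s_ R p).
Local Notation t := (t_ R p).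
Local Notation A := (truncation_area R p).
Implicit Types (x u : R).

Lemma sinh_double u : sinh (2 * u) = 2 * (sinh u * cosh u).
Proof. by rewrite mulr2n mulrDl !mul1r sinhD; ring. Qed.

Lemma le_sinh_self u : 0 <= u -> u <= sinh u.
Proof.
move=> u0; rewrite -subr_ge0.
have d x : deriv_at (fun x => sinh x - x) x (cosh x - 1).
  have e1 : deriv_at (fun x : R => expR x) x (expR x) by exact: is_derive_expR.
  have e2 : deriv_at (fun x : R => expR (- x)) x (expR (- x) * -1).
    apply: (@deriv_comp _ expR (fun x => - x)); first exact: is_derive_expR.
    by apply: derivN; exact: deriv_id.
  rewrite /sinh /cosh; apply: deriv_eq.
    apply: derivD; last by apply: derivN; exact: deriv_id.
    by apply: derivM; [apply: derivD; [exact: e1|apply: derivN; exact: e2]|exact: deriv_cst].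
  by cbn beta; field.
have c1 x : 0 <= x <= u -> 0 <= cosh x - 1 by rewrite subr_ge0 cosh_ge1.
have := deriv_ge0_le u0 (fun x _ => d x) c1.
by have -> : sinh 0 - 0 = 0 :> R by rewrite /sinh oppr0 subrr mul0r addr0.
Qed.

Lemma edgeT_range : -1 < k < 1.
Proof. exact: (edgeT_bound (yp_gt0 R p7) (yp_lo R p7) (yp_hi R p7)). Qed.

Lemma edgeT_pos : 0 < k.
Proof. exact: (edgeT_gt0 (yp_gt0 R p7) (yp_hi R p7)). Qed.

Lemma edgeT_lt1 : k < 1. Proof. by case/andP: edgeT_range. Qed.

Lemma h_ge0 : 0 <= h.
Proof. by rewrite h_E // atanh_ge0 // (ltW edgeT_pos) edgeT_lt1. Qed.

Lemma sinh_2h : sinh (2 * h) = 2 * k / (1 - k ^+ 2).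
Proof. by rewrite h_E // sinh_double_atanh // edgeT_range. Qed.

Lemma cosh_2h : cosh (2 * h) = (1 + k ^+ 2) / (1 - k ^+ 2).
Proof. by rewrite h_E // cosh_double_atanh // edgeT_range. Qed.

Lemma Vol_bound u : 0 <= u -> Vol p u <= A / 2 * (sinh (2 * u) / 2 + u).
Proof.
move=> u0; apply: le_trans (Vol_upper p7 u0) _; rewrite sinh_double.
rewrite le_eqVlt; apply/orP; left; apply/eqP; by field.
Qed.

Lemma num3_le x : 0 <= x <= h ->
  4 * Vol p (h + x) + 4 * Vol p (h - x) <= 2 * A * (sinh (2 * h) * cosh (2 * x) + 2 * h).
Proof.
move=> /andP[x0 xh]; have h0 := h_ge0.
have v1 : 0 <= h + x by lra.
have v2 : 0 <= h - x by lra.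
have := Vol_bound v1; have := Vol_bound v2.
have -> : 2 * (h - x) = 2 * h + - (2 * x) by ring.
have -> : 2 * (h + x) = 2 * h + 2 * x by ring.
rewrite !sinhD sinhN coshN; lra.
Qed.

Lemma num3_eq x : 6 / 10 <= 1 - y ^+ 2 -> 1 - y ^+ 2 <= 63 / 100 ->
  0 <= x <= h -> h + x <= s ->
  4 * Vol p (h + x) + 4 * Vol p (h - x) = 2 * A * (sinh (2 * h) * cosh (2 * x) + 2 * h).
Proof.
move=> n1 n2 /andP[x0 xh] hs; have h0 := h_ge0.
rewrite !Vol_exact //; try lra.
have <- : sinh (2 * (h + x)) / 2 + sinh (2 * (h - x)) / 2 = sinh (2 * h) * cosh (2 * x).
  have -> : 2 * (h - x) = 2 * h + - (2 * x) by ring.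
  have -> : 2 * (h + x) = 2 * h + 2 * x by ring.
  by rewrite !sinhD sinhN coshN; field.
by rewrite !sinh_double; field.
Qed.

(** Using [sinh (2 h) <= cosh (2 h)], the part depending on [x] is at most [sinh (2 h)] times
    [4 cosh (2 x) - 2 sinh (2 x) = E + 3 / E] with [E = exp (2 x)]. That function is convex, so on
    [[1, Ex]] it is bounded by its end values, 4 and [Ex + 3 / Ex]. *)
Lemma num1_le x (M Ex : R) : 0 <= x <= h -> expR (2 * x) <= Ex ->
  4 <= M -> Ex + 3 / Ex <= M ->
  2 * Vol p (h + x) + 6 * Vol p (h - x) <= A / 2 * (sinh (2 * h) * M + 8 * h).
Proof.
move=> /andP[x0 xh] hE M4 hM; have h0 := h_ge0; have A0 := truncation_area_ge0 R p7.
have v1 : 0 <= h + x by lra.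
have v2 : 0 <= h - x by lra.
have := Vol_bound v1; have := Vol_bound v2.
have -> : 2 * (h - x) = 2 * h + - (2 * x) by ring.
have -> : 2 * (h + x) = 2 * h + 2 * x by ring.
rewrite !sinhD sinhN coshN.
have S0 : 0 <= sinh (2 * h) by rewrite sinh_ge0 // mulr_ge0.
have s0 : 0 <= sinh (2 * x) by rewrite sinh_ge0 // mulr_ge0.
have SC : sinh (2 * h) <= cosh (2 * h) by rewrite /sinh /cosh; have := expR_gt0 (- (2 * h)); lra.
have EM : expR (2 * x) + 3 / expR (2 * x) <= M.
  have x2 : 0 <= 2 * x by rewrite mulr_ge0.
  have e1 : 1 <= expR (2 * x) by case/andP: (expR_ge_inv x2).
  move: hE e1; set E := expR _ => hE e1.
  have E0 : 0 < E by lra.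
  have Ex0 : 0 < Ex by lra.
  rewrite -subr_ge0.
  have -> : M - (E + 3 / E) = (E * M - E ^+ 2 - 3) / E by field; rewrite gt_eqF.
  rewrite divr_ge0 ?(ltW E0) //.
  have hM' : Ex ^+ 2 + 3 <= M * Ex.
    have -> : Ex ^+ 2 + 3 = (Ex + 3 / Ex) * Ex by field; rewrite gt_eqF.
    by rewrite ler_pM2r.
  case: (lerP Ex 1) => Ex1.
    have -> : E = 1 by lra.
    lra.
  (* Convexity made explicit: [E M - E^2 - 3] is the interpolation of its values at 1 and [Ex] plus
     a nonnegative product. *)
  have : 0 <= (Ex - E) * (M - 4) + (E - 1) * (M * Ex - Ex ^+ 2 - 3).
    by rewrite addr_ge0 // mulr_ge0; lra.
  have h3 : 0 <= (Ex - E) * (E - 1) * (Ex - 1) by rewrite !mulr_ge0; lra.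
  move=> h4; rewrite -(@pmulr_lge0 _ (Ex - 1)); last by lra.
  have -> : (E * M - E ^+ 2 - 3) * (Ex - 1) = (Ex - E) * (M - 4) + (E - 1) * (M * Ex - Ex ^+ 2 - 3)
      + (Ex - E) * (E - 1) * (Ex - 1) by ring.
  by rewrite addr_ge0.
have key : 4 * (sinh (2 * h) * cosh (2 * x)) - 2 * (cosh (2 * h) * sinh (2 * x)) <= sinh (2 * h) * M.
  have h1 : sinh (2 * h) * sinh (2 * x) <= cosh (2 * h) * sinh (2 * x) by rewrite ler_wpM2r.
  have h2 : sinh (2 * h) * (4 * cosh (2 * x) - 2 * sinh (2 * x)) <= sinh (2 * h) * M.
    rewrite ler_wpM2l //; apply: le_trans EM.
    rewrite /cosh /sinh expRN; set E := expR _; lra.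
  lra.
have key2 : A / 2 * (4 * (sinh (2 * h) * cosh (2 * x)) - 2 * (cosh (2 * h) * sinh (2 * x)) + 8 * h - 4 * x)
   <= A / 2 * (sinh (2 * h) * M + 8 * h).
  by rewrite ler_wpM2l ?divr_ge0 //; lra.
by move: key2; rewrite !(mulrDr (A / 2)) !mulrN; lra.
Qed.

(** Opposite shifts cancel the odd terms, leaving [(sinh (2 t) + 3 sinh u) cosh (2 x)], and
    admissibility gives [2 x <= u]. The linear part is [2 t + 3 u = 4 h + 2 u], with
    [u <= sinh u]. *)
Lemma num2_le x (u := 2 * (2 * h - t)) : 0 <= x <= 2 * h - t -> x <= t ->
  Vol p (t + x) + Vol p (t - x) + 3 * Vol p (2 * h - t - x) + 3 * Vol p (2 * h - t + x) <=
  A / 2 * ((sinh (2 * t) + 3 * sinh u) * cosh u + 4 * h + 2 * sinh u).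
Proof.
move=> /andP[x0 xu] xt; have h0 := h_ge0; have A0 := truncation_area_ge0 R p7.
have t0 : 0 <= t by lra.
have v1 : 0 <= t + x by lra.
have v2 : 0 <= t - x by lra.
have v3 : 0 <= 2 * h - t - x by lra.
have v4 : 0 <= 2 * h - t + x by lra.
have := Vol_bound v1; have := Vol_bound v2; have := Vol_bound v3; have := Vol_bound v4.
have -> : 2 * (2 * h - t - x) = u + - (2 * x) by rewrite /u; ring.
have -> : 2 * (2 * h - t + x) = u + 2 * x by rewrite /u; ring.
have -> : 2 * (t - x) = 2 * t + - (2 * x) by ring.
have -> : 2 * (t + x) = 2 * t + 2 * x by ring.
have u0 : 0 <= u by rewrite /u; lra.
rewrite !sinhD sinhN coshN.
have c1 : cosh (2 * x) <= cosh u by apply: le_cosh; rewrite ?mulr_ge0 // /u; lra.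
have su := le_sinh_self u0.
have t2 : 0 <= 2 * t by rewrite mulr_ge0.
have w0 : 0 <= sinh (2 * t) + 3 * sinh u by have := sinh_ge0 t2; have := sinh_ge0 u0; lra.
have key : (sinh (2 * t) + 3 * sinh u) * cosh (2 * x) <= (sinh (2 * t) + 3 * sinh u) * cosh u.
  by rewrite ler_wpM2l.
have ut : 4 * h = u + 2 * t by rewrite /u; ring.
have key2 : A / 2 * ((sinh (2 * t) + 3 * sinh u) * cosh (2 * x) + 2 * t + 3 * u) <=
   A / 2 * ((sinh (2 * t) + 3 * sinh u) * cosh u + 4 * h + 2 * sinh u).
  by rewrite ler_wpM2l ?divr_ge0 //; lra.
move=> w4 w3 w2 w1; apply: le_trans key2.
have -> : A / 2 * ((sinh (2 * t) + 3 * sinh u) * cosh (2 * x) + 2 * t + 3 * u) =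
 A / 2 * ((sinh (2 * t) * cosh (2 * x) + cosh (2 * t) * sinh (2 * x)) / 2 + (t + x)) +
 A / 2 * ((sinh (2 * t) * cosh (2 * x) + cosh (2 * t) * - sinh (2 * x)) / 2 + (t - x)) +
 3 * (A / 2 * ((sinh u * cosh (2 * x) + cosh u * - sinh (2 * x)) / 2 + (2 * h - t - x))) +
 3 * (A / 2 * ((sinh u * cosh (2 * x) + cosh u * sinh (2 * x)) / 2 + (2 * h - t + x))).
  by have -> : 2 * h - t = u / 2 by [rewrite /u; field]; field.
lra.
Qed.
End numerators.

(** * Bounds of the cube volume from bounds of x atanh x *)

Section volume_formula.
Variables (R : realType) (y : R).
Hypotheses (y0 : 0 < y) (y1 : 1 < 3 * y ^+ 2) (y2 : 2 * y ^+ 2 < 1).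
Local Notation k := (edgeT y).
Implicit Types (m : R) (q Q : R -> R).
Local Notation mu := (@lebesgue_measure R).

Definition tipSlope := y ^+ 2 * excess y / ((1 - y ^+ 2) * (1 - 2 * y ^+ 2)).
Definition tipR m := 2 * y ^+ 2 / (1 - y ^+ 2) - tipSlope * tipT y m ^+ 2.

Lemma tipX_inv_sqr m : 0 <= m <= 1 -> (tipX y m 1) ^- 2 = tipR m.
Proof.
move=> /andP[m0 m1]; have E0 := colE_gt0 y1 y2 m0 ler01; have D0 := tip_den_gt0 y2 m0.
have n0 : 0 < 1 - y ^+ 2 by move: y2 (sqr_ge0 y); lra.
have d0 : 0 < 1 - 2 * y ^+ 2 by rewrite subr_gt0.
rewrite tipX1 // !exprMn exprVn exprMn invfM invrK sqr_sqrtr ?ltW // colE1.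
rewrite /tipR /tipT /tipSlope !exprMn exprVn edgeK_sqr // /colW /excess.
field; rewrite !gt_eqF //.
Qed.

Lemma tipT_range m : 0 <= m <= 1 -> 0 <= tipT y m <= edgeK y.
Proof.
move=> /andP[m0 m1]; have D0 := tip_den_gt0 y2 m0; have K0 := edgeK_gt0 y2.
have n0 : 0 < 1 - y ^+ 2 by move: y2 (sqr_ge0 y); lra.
rewrite /tipT divr_ge0 ?mulr_ge0 ?(ltW K0) ?(ltW D0) //= ler_pdivrMr // ler_pM2l //.
have : 0 <= (1 - y ^+ 2) * (1 - m) by rewrite mulr_ge0 ?(ltW n0) // subr_ge0.
lra.
Qed.

(** The shape fits the measure [dT / (1 + T^2)]: the constant integrates to an arctangent and the
    second term to a primitive of [q]. The subtracted [k atanh k] is the value of [x atanh x] at the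
    end [r = 0]. *)
Definition tipApprox n0 q m := y / colW y m / 2 * (n0 + (1 + tipT y m ^+ 2) * q (tipT y m) - k * atanh k).

Lemma tipApprox_integral n0 q Q :
  (forall T, deriv_at Q T (q T)) -> (forall T, {for T, continuous q}) ->
  (forall m, 0 <= m <= 1 -> {for m, continuous (tipApprox n0 q)}) /\
  fine (\int[mu]_(m in `[0%R, 1%R]) (tipApprox n0 q m)%:E)%E =
  ((n0 * atan (edgeK y) + (Q (edgeK y) - Q 0)) / k - atanh k * atan (edgeK y)) / 2.
Proof.
move=> dQ cq; have K0 := edgeK_gt0 y2; have k0 : 0 < k by rewrite divr_gt0.
have cont m : 0 <= m <= 1 -> {for m, continuous (tipApprox n0 q)}.
  move=> /andP[m0 m1]; have W0 := colW_gt0 y2 m0.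
  have cT : {for m, continuous (tipT y)} by exact: (deriv_continuous (deriv_tipT y2 m0)).
  have cqT : {for m, continuous (fun m => q (tipT y m))}.
    by apply: (@continuous_comp _ _ _ (tipT y) q); [exact: cT|exact: cq].
  apply: cvgM; first by apply: cvgM; [exact: (colW_continuous y2)|exact: cvg_cst].
  apply: cvgB; last exact: cvg_cst.
  apply: cvgD; first exact: cvg_cst.
  apply: cvgM; last exact: cqT.
  apply: cvgD; first exact: cvg_cst.
  by apply: (@continuous_comp _ _ _ (tipT y) (fun T => T ^+ 2)); [exact: cT|exact: exprn_continuous].
split; first exact: cont.
set F := fun m => ((n0 * atan (tipT y m) + Q (tipT y m)) / k - atanh k * atan (tipT y m)) / 2.
suff dF : forall m, 0 <= m <= 1 -> deriv_at F m (tipApprox n0 q m).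
  by rewrite (fine_integral_derive ler01 dF cont) /F tipT1 tipT0 atan0; field; rewrite gt_eqF.
move=> m /andP[m0 m1]; have W0 := colW_gt0 y2 m0; have D0 := tip_den_gt0 y2 m0.
have n1 : 0 < 1 - y ^+ 2 by move: y2 (sqr_ge0 y); lra.
have dA := deriv_tip_angle y0 y2 m0.
have dT : deriv_at (tipT y) m ((1 + tipT y m ^+ 2) * (y / colW y m * k)).
  apply: deriv_eq (deriv_tipT y2 m0) _; rewrite tipT_sqr // /edgeT.
  by field; rewrite !gt_eqF.
apply: deriv_eq.
  apply: derivM; last exact: deriv_cst.
  apply: derivD.
    apply: derivM; last exact: deriv_cst.
    apply: derivD.
      by apply: derivM; [exact: deriv_cst|exact: dA].
    by apply: (@deriv_comp _ Q (tipT y)); [exact: dQ|exact: dT].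
  by apply: derivN; apply: derivM; [exact: deriv_cst|exact: dA].
cbn beta; rewrite /tipApprox -/(edgeT y); field; rewrite !gt_eqF //.
Qed.

Lemma hvol_Cr_ge n0 q Q :
  (forall T, deriv_at Q T (q T)) -> (forall T, {for T, continuous q}) ->
  (forall m, 0 <= m <= 1 ->
     n0 + (1 + tipT y m ^+ 2) * q (tipT y m) <= tipX y m 1 * atanh (tipX y m 1)) ->
  24 * ((n0 * atan (edgeK y) + (Q (edgeK y) - Q 0)) / k - atanh k * atan (edgeK y)) <= hvol (Cr y).
Proof.
move=> dQ cq le; have [ca E] := tipApprox_integral n0 dQ cq.
have : fine (\int[mu]_(m in `[0%R, 1%R]) (tipApprox n0 q m)%:E)%E <=
    fine (\int[mu]_(m in `[0%R, 1%R]) (tipF y m)%:E)%E.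
  apply: fine_integral_le => //; first by move=> m mm; exact: tipF_continuous.
  move=> m mm; case/andP: (mm) => m0 _; have W0 := colW_gt0 y2 m0.
  rewrite /tipApprox /tipF tipX0 // -/k ler_pM2l ?lerB ?le //.
  by rewrite !divr_gt0.
rewrite E hvol_Cr //; lra.
Qed.

Lemma hvol_Cr_le n0 q Q :
  (forall T, deriv_at Q T (q T)) -> (forall T, {for T, continuous q}) ->
  (forall m, 0 <= m <= 1 ->
     tipX y m 1 * atanh (tipX y m 1) <= n0 + (1 + tipT y m ^+ 2) * q (tipT y m)) ->
  hvol (Cr y) <= 24 * ((n0 * atan (edgeK y) + (Q (edgeK y) - Q 0)) / k - atanh k * atan (edgeK y)).
Proof.
move=> dQ cq le; have [ca E] := tipApprox_integral n0 dQ cq.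
have : fine (\int[mu]_(m in `[0%R, 1%R]) (tipF y m)%:E)%E <=
    fine (\int[mu]_(m in `[0%R, 1%R]) (tipApprox n0 q m)%:E)%E.
  apply: fine_integral_le => //; first by move=> m mm; exact: tipF_continuous.
  move=> m mm; case/andP: (mm) => m0 _; have W0 := colW_gt0 y2 m0.
  rewrite /tipApprox /tipF tipX0 // -/k ler_pM2l ?lerB ?le //.
  by rewrite !divr_gt0.
rewrite E hvol_Cr //; lra.
Qed.
End volume_formula.

(** * Series and tangent bounds *)

Section series_bounds.
Variable R : realType.
Implicit Types (x k : R) (n : nat).

Definition atanS n x : R := \sum_(i < n) (-1) ^+ i * x ^+ i.*2.+1 / i.*2.+1%:R.
Definition atanhS n x : R := \sum_(i < n) x ^+ i.*2.+1 / i.*2.+1%:R.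

Lemma deriv_sum n (f df : nat -> R -> R) x :
  (forall i, deriv_at (f i) x (df i x)) ->
  deriv_at (fun x => \sum_(i < n) f i x) x (\sum_(i < n) df i x).
Proof.
move=> d; elim: n => [|n IH].
  rewrite big_ord0; have -> : (fun x => \sum_(i < 0) f i x) = (fun=> 0).
    by apply/funext => u; rewrite big_ord0.
  exact: deriv_cst.
rewrite big_ord_recr /=.
have -> : (fun x => \sum_(i < n.+1) f i x) = (fun x => \sum_(i < n) f i x + f n x).
  by apply/funext => u; rewrite big_ord_recr.
exact: derivD.
Qed.

Lemma deriv_odd_monomial i x :
  deriv_at (fun x => x ^+ i.*2.+1 / i.*2.+1%:R) x (x ^+ i.*2).
Proof.
apply: deriv_eq; first by derivs.
have : i.*2.+1%:R != 0 :> R by rewrite pnatr_eq0.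
cbn beta; rewrite [_.-1]/=; move: (i.*2.+1%:R : R) => N N0.
by field.
Qed.

Lemma deriv_atanS n x : deriv_at (atanS n) x ((1 - (- x ^+ 2) ^+ n) / (1 + x ^+ 2)).
Proof.
have p0 : 1 + x ^+ 2 != 0 by rewrite gt_eqF // ltr_pwDl ?sqr_ge0.
apply: deriv_eq.
  apply: (@deriv_sum n (fun i x => (-1) ^+ i * x ^+ i.*2.+1 / i.*2.+1%:R)
    (fun i x => (-1) ^+ i * x ^+ i.*2) x) => i.
  have -> : (fun x : R => (-1) ^+ i * x ^+ i.*2.+1 / i.*2.+1%:R) =
     (fun x => (-1) ^+ i * (x ^+ i.*2.+1 / i.*2.+1%:R)) by apply/funext => u; rewrite mulrA.
  apply: deriv_eq; first by apply: derivM; [exact: deriv_cst|exact: deriv_odd_monomial].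
  by rewrite mulr0 addr0.
apply: (mulIf p0); rewrite divfK //.
elim: n => [|n IH]; first by rewrite big_ord0 mul0r expr0 subrr.
rewrite big_ord_recr /= mulrDl IH [in RHS]exprS (exprNn (x ^+ 2)) -mul2n (exprM x).
by move: ((x ^+ 2) ^+ n) ((-1) ^+ n) => a b; ring.
Qed.

Lemma deriv_atanhS n x : -1 < x < 1 -> deriv_at (atanhS n) x ((1 - (x ^+ 2) ^+ n) / (1 - x ^+ 2)).
Proof.
move=> /andP[x1 x2]; have p0 : 1 - x ^+ 2 != 0.
  have -> : 1 - x ^+ 2 = (1 - x) * (1 + x) by ring.
  by rewrite gt_eqF // mulr_gt0; lra.
apply: deriv_eq.
  apply: (@deriv_sum n (fun i x => x ^+ i.*2.+1 / i.*2.+1%:R) (fun i x => x ^+ i.*2) x) => i.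
  exact: deriv_odd_monomial.
apply: (mulIf p0); rewrite divfK //.
elim: n => [|n IH]; first by rewrite big_ord0 mul0r expr0 subrr.
rewrite big_ord_recr /= mulrDl IH (exprS (x ^+ 2)) -mul2n (exprM x).
by move: ((x ^+ 2) ^+ n) => a; ring.
Qed.

Lemma atanS0 n : atanS n 0 = 0.
Proof. by rewrite /atanS big1 // => i _; rewrite expr0n /= mulr0 mul0r. Qed.

Lemma atanhS0 n : atanhS n 0 = 0.
Proof. by rewrite /atanhS big1 // => i _; rewrite expr0n /= mul0r. Qed.

Lemma atanh0 : atanh 0 = 0 :> R.
Proof. by rewrite /atanh addr0 subr0 divr1 ln1 mul0r. Qed.

Lemma deriv_atan1 x : deriv_at (@atan R) x (1 + x ^+ 2)^-1.
Proof. exact: is_derive1_atan. Qed.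

Lemma deriv_atanh1 x : -1 < x < 1 -> deriv_at (@atanh R) x (1 - x ^+ 2)^-1.
Proof.
move=> xb; apply: deriv_eq; first by apply: deriv_atanh; [exact: xb|exact: deriv_id].
by rewrite mulr1.
Qed.

(** After an even number of terms the difference has derivative [u^(4 n) / (1 + u^2) >= 0]; after an
    odd number, as in [atan_le], the sign is reversed. *)
Lemma atan_ge n x : 0 <= x -> atanS n.*2 x <= atan x.
Proof.
move=> x0; rewrite -subr_ge0.
have := @deriv_ge0_le _ (fun x => atan x - atanS n.*2 x) (fun x => (- x ^+ 2) ^+ n.*2 / (1 + x ^+ 2)) 0 x x0.
rewrite atan0 atanS0 subrr; apply => u /andP[u0 _].
  have p0 : 1 + u ^+ 2 != 0 by rewrite gt_eqF // ltr_pwDl ?sqr_ge0.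
  apply: deriv_eq; first by apply: derivD; [exact: deriv_atan1|apply: derivN; exact: deriv_atanS].
  by field.
rewrite -mul2n exprM; apply: divr_ge0; first by rewrite exprn_ge0 // sqr_ge0.
by rewrite addr_ge0 // sqr_ge0.
Qed.

Lemma atan_le n x : 0 <= x -> atan x <= atanS n.*2.+1 x.
Proof.
move=> x0; rewrite -subr_ge0.
have := @deriv_ge0_le _ (fun x => atanS n.*2.+1 x - atan x) (fun x => x ^+ 2 * (- x ^+ 2) ^+ n.*2 / (1 + x ^+ 2)) 0 x x0.
rewrite atan0 atanS0 subrr; apply => u /andP[u0 _].
  have p0 : 1 + u ^+ 2 != 0 by rewrite gt_eqF // ltr_pwDl ?sqr_ge0.
  apply: deriv_eq; first by apply: derivD; [exact: deriv_atanS|apply: derivN; exact: deriv_atan1].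
  by rewrite exprS; field.
rewrite -mul2n exprM; apply: divr_ge0; last by rewrite addr_ge0 // sqr_ge0.
by apply: mulr_ge0; [exact: sqr_ge0|rewrite exprn_ge0 // sqr_ge0].
Qed.

Lemma atanh_ge n x : 0 <= x < 1 -> atanhS n x <= atanh x.
Proof.
move=> /andP[x0 x1]; rewrite -subr_ge0.
have := @deriv_ge0_le _ (fun x => atanh x - atanhS n x) (fun x => (x ^+ 2) ^+ n / (1 - x ^+ 2)) 0 x x0.
rewrite atanh0 atanhS0 subrr; apply => u /andP[u0 ux].
  have ub : -1 < u < 1 by apply/andP; split; lra.
  have p0 : 1 - u ^+ 2 != 0.
    have -> : 1 - u ^+ 2 = (1 - u) * (1 + u) by ring.
    by rewrite gt_eqF // mulr_gt0; lra.
  apply: deriv_eq; first by apply: derivD; [exact: deriv_atanh1|apply: derivN; exact: deriv_atanhS].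
  by field.
have -> : 1 - u ^+ 2 = (1 - u) * (1 + u) by ring.
by rewrite divr_ge0 ?exprn_ge0 ?sqr_ge0 // mulr_ge0; lra.
Qed.

(** The derivative [u^(2 n) / (1 - u^2)] of the remainder is at most [u^(2 n) / (1 - x^2)] for
    [u <= x]. *)
Lemma atanh_le n x : 0 <= x < 1 ->
  atanh x <= atanhS n x + x ^+ n.*2.+1 / (n.*2.+1%:R * (1 - x ^+ 2)).
Proof.
move=> /andP[x0 x1]; rewrite -subr_ge0.
have px : 0 < 1 - x ^+ 2.
  have -> : 1 - x ^+ 2 = (1 - x) * (1 + x) by ring.
  by rewrite mulr_gt0; lra.
pose F u := atanhS n u + u ^+ n.*2.+1 / n.*2.+1%:R / (1 - x ^+ 2) - atanh u.
have := @deriv_ge0_le _ F (fun u => (u ^+ 2) ^+ n * ((1 - x ^+ 2)^-1 - (1 - u ^+ 2)^-1)) 0 x x0.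
have -> : F 0 = 0 by rewrite /F atanh0 atanhS0 expr0n /= !mul0r addr0 subrr.
have -> : F x = atanhS n x + x ^+ n.*2.+1 / (n.*2.+1%:R * (1 - x ^+ 2)) - atanh x.
  by rewrite /F invfM mulrA.
apply => u /andP[u0 ux].
  have ub : -1 < u < 1 by apply/andP; split; lra.
  have p0 : 1 - u ^+ 2 != 0.
    have -> : 1 - u ^+ 2 = (1 - u) * (1 + u) by ring.
    by rewrite gt_eqF // mulr_gt0; lra.
  apply: deriv_eq.
    apply: derivD; last by apply: derivN; exact: deriv_atanh1.
    apply: derivD; first exact: deriv_atanhS.
    apply: derivM; last exact: deriv_cst.
    exact: deriv_odd_monomial.
  cbn beta; rewrite mulr0 add0r -[in u ^+ n.*2]mul2n (exprM u).
  by move: ((u ^+ 2) ^+ n) => a; field; rewrite p0 gt_eqF.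
have pu : 0 < 1 - u ^+ 2.
  have -> : 1 - u ^+ 2 = (1 - u) * (1 + u) by ring.
  by rewrite mulr_gt0; lra.
rewrite mulr_ge0 ?exprn_ge0 ?sqr_ge0 // subr_ge0 lef_pV2 ?posrE //.
by rewrite lerD2l lerN2 ler_pXn2r ?nnegrE.
Qed.

Lemma atanhD x k : -1 < x < 1 -> -1 < k < 1 ->
  atanh x = atanh k + atanh ((x - k) / (1 - x * k)).
Proof.
move=> /andP[x1 x2] /andP[k1 k2].
have p : 0 < 1 - x * k by nra.
rewrite /atanh -mulrDl; congr (_ / 2).
have h1 : 0 < (1 + k) / (1 - k) by rewrite divr_gt0; lra.
have e : (1 + (x - k) / (1 - x * k)) / (1 - (x - k) / (1 - x * k)) =
   (1 + x) * (1 - k) / ((1 - x) * (1 + k)).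
  have n1 : (1 - x) * (1 + k) != 0 by rewrite gt_eqF // mulr_gt0; lra.
  have n2 : (1 - x * k - (x - k)) != 0.
    by have -> : 1 - x * k - (x - k) = (1 - x) * (1 + k) by ring.
  field; do ?[apply/andP; split]; rewrite ?n2 // gt_eqF //; lra.
have h2 : 0 < (1 + x) * (1 - k) / ((1 - x) * (1 + k)) by rewrite divr_gt0 // mulr_gt0; lra.
rewrite -lnM ?posrE ?e //; congr ln; field.
by apply/and3P; split; rewrite gt_eqF //; lra.
Qed.

Lemma deriv0_cst (f : R -> R) : (forall u, 0 <= u -> deriv_at f u 0) ->
  forall u, 0 <= u -> f u = f 0.
Proof.
move=> d u u0; apply/eqP; rewrite eq_le; apply/andP; split.
  rewrite -lerN2; apply: (@deriv_ge0_le _ (fun x => - f x) (fun=> 0)) => // v /andP[v0 _].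
  by apply: deriv_eq (derivN (d v v0)) _; rewrite oppr0.
by apply: (@deriv_ge0_le _ f (fun=> 0)) => // v /andP[v0 _]; exact: d.
Qed.

(** Both sides have the same derivative in [x] and agree at [x = k]; nonnegativity keeps the
    denominator away from 0. *)
Lemma atan_sub x k : 0 <= k -> 0 <= x -> atan x = atan k + atan ((x - k) / (1 + x * k)).
Proof.
move=> k0 x0.
have d u : 0 <= u -> deriv_at (fun x => atan x - atan ((x - k) / (1 + x * k))) u 0.
  move=> u0; have p : 0 < 1 + u * k by rewrite ltr_pwDl // mulr_ge0.
  apply: deriv_eq; first by derivs; rewrite gt_eqF.
  cbn beta; have n1 : 0 < 1 + u ^+ 2 by rewrite ltr_pwDl ?sqr_ge0.
  have n2 : 0 < 1 + k ^+ 2 by rewrite ltr_pwDl ?sqr_ge0.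
  have -> : 1 + ((u - k) / (1 + u * k)) ^+ 2 = (1 + u ^+ 2) * (1 + k ^+ 2) / (1 + u * k) ^+ 2.
    by field; rewrite gt_eqF.
  by field; rewrite !gt_eqF.
have := deriv0_cst d x0; have := deriv0_cst d k0.
by rewrite /= subrr mul0r atan0 subr0 => -> h; rewrite -[LHS](subrK (atan ((x - k) / (1 + x * k)))) h.
Qed.

Lemma atanh_mono x k : 0 <= x -> x <= k -> k < 1 -> atanh x <= atanh k.
Proof.
move=> x0 xk k1; apply: (@deriv_ge0_le _ _ (fun u => (1 - u ^+ 2)^-1)) => // u /andP[ux uk].
  by apply: deriv_atanh1; apply/andP; split; lra.
have -> : 1 - u ^+ 2 = (1 - u) * (1 + u) by ring.
by rewrite invr_ge0 mulr_ge0; lra.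
Qed.

Lemma atan_mono x k : x <= k -> atan x <= atan k.
Proof.
move=> xk; apply: (@deriv_ge0_le _ _ (fun u => (1 + u ^+ 2)^-1)) => // u _.
  exact: deriv_atan1.
by rewrite invr_ge0 addr_ge0 ?sqr_ge0.
Qed.

(* The right-hand side is the tangent of [x atanh x], as a function of [1 / x ^ 2], at [x0]. *)
Lemma tangent_bound (x0 V A B x : R) : 0 < x0 < 1 -> V <= atanh x0 ->
  A = 3 * V * x0 / 2 + x0 ^+ 2 / (2 * (1 - x0 ^+ 2)) ->
  B = (x0 ^+ 4 + A * x0 ^+ 2 * (1 - x0 ^+ 2)) / (3 * (1 - x0 ^+ 2)) -> 0 <= A ->
  0 < x < 1 -> A - B * x ^- 2 <= x * atanh x.
Proof.
move=> /andP[a0 a1] hV AE BE A0 /andP[x0' x1].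
set z := x0 ^+ 2; have z1 : 0 < 1 - z.
  have -> : 1 - z = (1 - x0) * (1 + x0) by rewrite /z; ring.
  by rewrite mulr_gt0; lra.
have z0 : 0 < z by rewrite exprn_gt0.
have B3 : 3 * B = z * A + z ^+ 2 / (1 - z).
  by rewrite BE /z; field; rewrite gt_eqF.
(* [u * G u] is the gap to be shown nonnegative. [A] is chosen so that [G x0 = atanh x0 - V], and
   [B] so that the derivative vanishes at [x0], where it changes from negative to positive. *)
pose G (u : R) := atanh u - A * u^-1 + B * (u^-1) ^+ 3.
pose dG (u : R) := (u ^+ 2 - z) * (u ^+ 2 + z + A * (1 - u ^+ 2 - z) + 3 * B) / (u ^+ 4 * (1 - u ^+ 2)).
have u2 (u : R) : 0 < u < 1 -> 0 < 1 - u ^+ 2.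
  move=> /andP[u0 u1]; have -> : 1 - u ^+ 2 = (1 - u) * (1 + u) by ring.
  by rewrite mulr_gt0; lra.
have d (u : R) : 0 < u < 1 -> deriv_at G u (dG u).
  move=> uu; have p := u2 u uu; case/andP: uu => u0 u1.
  have ub : -1 < u < 1 by apply/andP; split; lra.
  have un : u != 0 by rewrite gt_eqF.
  apply: deriv_eq.
    apply: derivD; last first.
      apply: derivM; first exact: deriv_cst.
      by apply: derivX; apply: derivV; [exact: un|exact: deriv_id].
    apply: derivD; first exact: (deriv_atanh1 ub).
    apply: derivN; apply: derivM; first exact: deriv_cst.
    by apply: derivV; [exact: un|exact: deriv_id].
  cbn beta; rewrite /dG.
  have -> : (u ^+ 2 - z) * (u ^+ 2 + z + A * (1 - u ^+ 2 - z) + 3 * B) =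
     u ^+ 4 + A * u ^+ 2 * (1 - u ^+ 2) - 3 * B * (1 - u ^+ 2).
    by rewrite B3; field; rewrite gt_eqF.
  by field; rewrite un gt_eqF.
have brk (u : R) : 0 < u < 1 -> 0 <= (u ^+ 2 + z + A * (1 - u ^+ 2 - z) + 3 * B) / (u ^+ 4 * (1 - u ^+ 2)).
  move=> uu; have p := u2 u uu; case/andP: uu => u0 u1.
  rewrite divr_ge0 ?mulr_ge0 ?exprn_ge0 ?(ltW p) ?(ltW u0) //.
  have -> : u ^+ 2 + z + A * (1 - u ^+ 2 - z) + 3 * B =
     u ^+ 2 + z + A * (1 - u ^+ 2) + z ^+ 2 / (1 - z) by rewrite B3; ring.
  apply: addr_ge0; last by rewrite divr_ge0 ?sqr_ge0 ?(ltW z1).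
  apply: addr_ge0; last by rewrite mulr_ge0 // ltW.
  by rewrite addr_ge0 ?sqr_ge0 // ltW.
have G0 : 0 <= G x0.
  have -> : G x0 = (atanh x0 - V).
    rewrite /G BE AE /z; field; rewrite gt_eqF //; rewrite gt_eqF //.
  by rewrite subr_ge0.
have Gx : 0 <= G x.
  case: (lerP x0 x) => hx.
    apply: le_trans G0 _; apply: (@deriv_ge0_le _ _ dG) => // u /andP[ux uk].
      by apply: d; apply/andP; split; lra.
    have uu : 0 < u < 1 by apply/andP; split; lra.
    rewrite /dG -mulrA mulr_ge0 ?brk // subr_ge0 /z ler_pXn2r ?nnegrE //; lra.
  apply: le_trans G0 _; rewrite -lerN2.
  apply: (@deriv_ge0_le _ (fun u => - G u) (fun u => - dG u)) => [|u /andP[ux uk]|u /andP[ux uk]].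
  - exact: ltW.
  - by apply: derivN; apply: d; apply/andP; split; lra.
  have uu : 0 < u < 1 by apply/andP; split; lra.
  rewrite /dG -mulrA -mulNr mulr_ge0 ?brk // opprB subr_ge0 /z ler_pXn2r ?nnegrE //; lra.
rewrite -subr_ge0.
have -> : x * atanh x - (A - B * x ^- 2) = x * G x by rewrite /G; field; rewrite gt_eqF.
by rewrite mulr_ge0 // ltW.
Qed.
End series_bounds.

Section volume_lower_bound.
Variables (R : realType) (y : R).
Hypotheses (y0 : 0 < y) (y1 : 1 < 3 * y ^+ 2) (y2 : 2 * y ^+ 2 < 1).
Local Notation k := (edgeT y).

Lemma tipSlopeE : tipSlope y = (1 - k ^+ 2) / (k ^+ 2 * (1 + k ^+ 2)).
Proof.
have n0 : 0 < 1 - y ^+ 2 by move: y2 (sqr_ge0 y); lra.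
have d0 : 0 < 1 - 2 * y ^+ 2 by rewrite subr_gt0.
rewrite edgeT_compl // edgeT_sqr // /tipSlope.
have -> : 1 + (1 - 2 * y ^+ 2) / y ^+ 2 = (1 - y ^+ 2) / y ^+ 2 by field; rewrite gt_eqF.
by field; rewrite !gt_eqF.
Qed.

Lemma tipX1_range m : 0 <= m <= 1 -> 0 < tipX y m 1 < 1.
Proof.
move=> mm; case/andP: (mm) => m0 m1.
have h1 : (0 <= (1 : R)) && ((1 : R) <= 1) by rewrite ler01 lexx.
have /andP[_ ->] := tipX_bound y0 y1 y2 mm h1; rewrite andbT tipX1 //.
have E0 := colE_gt0 y1 y2 m0 ler01.
by rewrite divr_gt0 ?tip_den_gt0 // mulr_gt0 // sqrtr_gt0.
Qed.

(** The tangent is affine in [x^-2 = tipR m], and [k^-2] is the constant term of [tipR] plus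
    [tipSlope]. Hence it equals [A - B / k^2] plus [B * tipSlope] times [1 + T^2]: the shape of
    [tipApprox] with constant [q]. *)
Lemma volume_lower (x0 V A B : R) : 0 < x0 < 1 -> V <= atanh x0 ->
  A = 3 * V * x0 / 2 + x0 ^+ 2 / (2 * (1 - x0 ^+ 2)) ->
  B = (x0 ^+ 4 + A * x0 ^+ 2 * (1 - x0 ^+ 2)) / (3 * (1 - x0 ^+ 2)) -> 0 <= A ->
  24 * y * (atan (edgeK y) / edgeK y * (A - k * atanh k - B / k ^+ 2) +
    B * ((1 - k ^+ 2) / (k ^+ 2 * (1 + k ^+ 2)))) <= hvol (Cr y).
Proof.
move=> xx hV AE BE A0; have K0 := edgeK_gt0 y2; have k0 : 0 < k by rewrite edgeT_gt0.
have n0 : 0 < 1 - y ^+ 2 by move: y2 (sqr_ge0 y); lra.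
have d0 : 0 < 1 - 2 * y ^+ 2 by rewrite subr_gt0.
have dQ T : deriv_at (fun T => B * tipSlope y * T) T (B * tipSlope y).
  by apply: deriv_eq; [apply: derivM; [exact: deriv_cst|exact: deriv_id]|rewrite mulr1 mulr0 addr0].
have := @hvol_Cr_ge _ _ y0 y1 y2 (A - B / k ^+ 2) (fun=> B * tipSlope y) (fun T => B * tipSlope y * T) dQ.
move=> /(_ (fun T => @cst_continuous _ _ _ T)) H.
apply: le_trans (H _); last first.
  move=> m mm; apply: le_trans (tangent_bound xx hV AE BE A0 (tipX1_range mm)).
  rewrite (tipX_inv_sqr y0 y1 y2 mm) /tipR.
  have -> : (k ^+ 2)^-1 = 2 * y ^+ 2 / (1 - y ^+ 2) + tipSlope y.
    rewrite edgeT_sqr // /tipSlope /excess; field; by rewrite !gt_eqF.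
  by rewrite le_eqVlt; apply/orP; left; apply/eqP; ring.
rewrite mulr0 subr0 tipSlopeE le_eqVlt; apply/orP; left; apply/eqP.
have kn : k != 0 by rewrite gt_eqF.
have -> : edgeK y = y * k by rewrite /edgeT mulrC divfK // gt_eqF.
have p1 : 1 + k ^+ 2 != 0 by rewrite gt_eqF // ltr_pwDl ?sqr_ge0.
by field; rewrite kn p1 gt_eqF.
Qed.
End volume_lower_bound.

(** * From bounds of hyperbolic functions to bounds of densities *)

Section density_bounds.
Variables (R : realType) (p : nat).
Hypothesis p7 : (7 <= p)%N.
Local Notation y := (yp (p%:R : R)).
Local Notation k := (edgeT y).
Local Notation h := (h_ R p).
Local Notation s := (s_ R p).
Local Notation t := (t_ R p).
Local Notation A := (truncation_area R p).
Implicit Types (x u : R).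

Lemma one_sub_sqr_gt0 : 0 < 1 - k ^+ 2.
Proof. exact: (edgeT_compl_gt0 (yp_gt0 R p7) (yp_lo R p7) (yp_hi R p7)). Qed.

Lemma cosh_double u : cosh (2 * u) = 2 * cosh u ^+ 2 - 1.
Proof.
have -> : 2 * u = u + u by ring.
rewrite coshD; have := cosh2_sinh2 u => h.
have -> : sinh u * sinh u = cosh u ^+ 2 - 1 by rewrite h; ring.
by ring.
Qed.

Lemma expR_cosh_sinh u : expR u = cosh u + sinh u.
Proof. by rewrite /cosh /sinh; field. Qed.

Lemma expR_2h : expR (2 * h) = (1 + k) / (1 - k).
Proof.
have D0 := one_sub_sqr_gt0; have k1 := edgeT_lt1 R p7; have k0 := edgeT_pos R p7.
rewrite expR_cosh_sinh cosh_2h // sinh_2h //.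
have -> : 1 - k ^+ 2 = (1 - k) * (1 + k) by ring.
by field; rewrite !gt_eqF //; lra.
Qed.

Lemma cosh_2s_sub_2h : cosh (2 * (s - h)) =
  ((3 + k ^+ 2) * (1 + k ^+ 2) - 4 * k * Num.sqrt (2 * (1 + k ^+ 2))) / (1 - k ^+ 2) ^+ 2.
Proof.
have D0 := one_sub_sqr_gt0; have [s0 sE] := s_props R p7.
have -> : 2 * (s - h) = 2 * s + - (2 * h) by ring.
rewrite coshD sinhN coshN cosh_2h // sinh_2h // cosh_double sE.
set g := Num.sqrt _.
have w0 : 0 <= 2 * (1 + k ^+ 2) by rewrite mulr_ge0 // addr_ge0 ?sqr_ge0.
have g2 : g ^+ 2 = 2 * (1 + k ^+ 2) by rewrite /g sqr_sqrtr.
have -> : sinh (2 * s) = 2 * g / (1 - k ^+ 2).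
  apply/eqP; rewrite -(@eqrXn2 _ 2) ?sinh_ge0 ?mulr_ge0 ?sqrtr_ge0 ?invr_ge0 ?(ltW D0) //.
  have := cosh2_sinh2 (2 * s); rewrite cosh_double sE => E.
  have -> : sinh (2 * s) ^+ 2 = (2 * (2 / (1 - k ^+ 2)) - 1) ^+ 2 - 1 by rewrite E; ring.
  have -> : (2 * g / (1 - k ^+ 2)) ^+ 2 = 4 * g ^+ 2 / (1 - k ^+ 2) ^+ 2.
    by field; rewrite gt_eqF.
  rewrite g2; apply/eqP.
  by field; rewrite gt_eqF.
by field; rewrite gt_eqF.
Qed.

Lemma cosh_2t : cosh (2 * t) = (5 + k ^+ 2) / (1 - k ^+ 2).
Proof.
have D0 := one_sub_sqr_gt0; have [t0 tE] := t_props R p7.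
by rewrite cosh_double tE; field; rewrite gt_eqF.
Qed.

(** With [C = cosh (2 t)], [exp (2 t)] is [2 C - exp (- 2 t)], and [exp (- 2 t) <= 1 / C] because
    [C <= exp (2 t)]. No square root enters. *)
Lemma expR_2t_lower : 2 * cosh (2 * t) - (cosh (2 * t))^-1 <= expR (2 * t).
Proof.
have c0 := cosh_gt0 (2 * t); have := expR_mulN (2 * t).
have [t0 _] := t_props R p7.
have S0 : 0 <= sinh (2 * t) by rewrite sinh_ge0 // mulr_ge0.
have E := expR_cosh_sinh (2 * t).
have cE : cosh (2 * t) = (expR (2 * t) + expR (- (2 * t))) / 2 by [].
move=> m1; have h1 : expR (- (2 * t)) <= (cosh (2 * t))^-1.
  rewrite -div1r ler_pdivlMr //.
  have : expR (- (2 * t)) * cosh (2 * t) <= expR (- (2 * t)) * expR (2 * t).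
    by rewrite ler_pM2l ?expR_gt0 //; lra.
  by rewrite (mulrC _ (expR (2 * t))) m1.
lra.
Qed.

Lemma adm1_le x : adm1 p x -> 0 <= x <= h /\ x <= t - h.
Proof.
move=> [x0]; rewrite lerBrDr !le_min => /andP[/andP[h1 _] h3]; split; last by lra.
by rewrite x0 /=; lra.
Qed.

Lemma adm2_le x : adm2 p x -> 0 <= x <= 2 * h - t /\ x <= t.
Proof. by move=> [x0]; rewrite !le_min => /andP[/andP[h1 h2] _]; rewrite x0. Qed.

Lemma adm3_le x : adm3 p x -> 0 <= x <= h /\ x <= s - h.
Proof. by move=> [x0]; rewrite !le_min => /andP[h1 h2]; rewrite x0. Qed.

(** [Eu] bounds [exp u] for [u = 2 (2 h - t)]: the product of [exp u] and [exp (2 t)] is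
    [exp (4 h)], the square of [(1 + k) / (1 - k)]. Also [sinh (2 t)] is replaced by the rational
    [Ct = cosh (2 t)]. *)
Lemma num2_final x (Eu : R) (Ct := (5 + k ^+ 2) / (1 - k ^+ 2)) : adm2 p x ->
  ((1 + k) / (1 - k)) ^+ 2 <= Eu * (2 * Ct - Ct^-1) -> 1 <= Eu ->
  Vol p (t + x) + Vol p (t - x) + 3 * Vol p (2 * h - t - x) + 3 * Vol p (2 * h - t + x) <=
  A / 2 * ((Ct + 3 * ((Eu - Eu^-1) / 2)) * ((Eu + Eu^-1) / 2) + 4 * h + (Eu - Eu^-1)).
Proof.
move=> /adm2_le[xx xt] hE E1; have A0 := truncation_area_ge0 R p7.
apply: le_trans (num2_le p7 xx xt) _; set u := 2 * (2 * h - t).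
have u0 : 0 <= u by case/andP: xx => *; rewrite /u; lra.
have c2t := cosh_2t; rewrite -/Ct in c2t.
have Ct0 : 0 < 2 * Ct - Ct^-1.
  have c1 : 1 <= Ct by rewrite -c2t cosh_ge1.
  have : Ct^-1 <= 1 by rewrite invf_le1 //; lra.
  lra.
have eu : expR u <= Eu.
  have : expR u * expR (2 * t) = ((1 + k) / (1 - k)) ^+ 2.
    by rewrite -expRD -expR_2h expr2 -expRD; congr expR; rewrite /u; ring.
  move=> E; rewrite -(@ler_pM2r _ (2 * Ct - Ct^-1)) //; apply: le_trans hE; rewrite -E.
  by rewrite ler_wpM2l ?expR_ge0 // -c2t expR_2t_lower.
have e1 : 1 <= expR u by case/andP: (expR_ge_inv u0).
have i1 : Eu^-1 <= expR (- u) by rewrite expRN lef_pV2 ?posrE ?expR_gt0 //; lra.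
have su : sinh u <= (Eu - Eu^-1) / 2 by rewrite /sinh; lra.
have cu : cosh u <= (Eu + Eu^-1) / 2.
  rewrite /cosh expRN; move: e1 eu; set e := expR u => e1 eu.
  rewrite ler_pM2r // -subr_ge0.
  have -> : Eu + Eu^-1 - (e + e^-1) = (Eu - e) * (Eu * e - 1) / (Eu * e).
    by field; rewrite !gt_eqF //; lra.
  rewrite divr_ge0 ?mulr_ge0 ?subr_ge0 //; try lra.
  by rewrite -[1]mulr1 ler_pM.
have s0 := sinh_ge0 u0; have c0 := cosh_gt0 u.
have st : sinh (2 * t) <= Ct.
  by rewrite -c2t /sinh /cosh; have := expR_gt0 (- (2 * t)); lra.
have [t0 _] := t_props R p7.
have st0 : 0 <= sinh (2 * t) by rewrite sinh_ge0 // mulr_ge0.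
rewrite ler_wpM2l ?divr_ge0 //.
have : (sinh (2 * t) + 3 * sinh u) * cosh u <= (Ct + 3 * ((Eu - Eu^-1) / 2)) * ((Eu + Eu^-1) / 2).
  by apply: ler_pM => //; lra.
lra.
Qed.

(** [c] bounds [cosh (2 x)] in the third family and [Ex] bounds [exp (2 x)] in the first;
    [Ex + 3 / Ex <= 4 c] puts the first numerator under the same bound as the third. *)
Lemma delta_bounds (c b Ex : R) : 0 < V0 R p -> 1 <= c ->
  (forall x, 0 <= x <= h -> x <= s - h -> cosh (2 * x) <= c) ->
  (forall x, 0 <= x <= h -> x <= t - h -> expR (2 * x) <= Ex) ->
  Ex + 3 / Ex <= 4 * c ->
  2 * A * (2 * k / (1 - k ^+ 2) * c + 2 * h) <= b * V0 R p ->
  (forall x, adm2 p x ->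
    Vol p (t + x) + Vol p (t - x) + 3 * Vol p (2 * h - t - x) + 3 * Vol p (2 * h - t + x)
      <= b * V0 R p) ->
  forall x, (adm1 p x -> delta1 p x <= b) /\ (adm2 p x -> delta2 p x <= b) /\
    (adm3 p x -> delta3 p x <= b).
Proof.
move=> V00 c1 hc hE hM hN h2 x; have A0 := truncation_area_ge0 R p7.
have S0 : 0 <= sinh (2 * h) by rewrite sinh_ge0 // mulr_ge0 // h_ge0.
split; [|split].
- move=> /adm1_le[xx xt]; rewrite /delta1 ler_pdivrMr //; apply: le_trans hN.
  apply: le_trans (num1_le p7 xx (hE x xx xt) _ hM) _; first by lra.
  by rewrite sinh_2h // le_eqVlt; apply/orP; left; apply/eqP; field; rewrite gt_eqF ?one_sub_sqr_gt0.
- by move=> ax; rewrite /delta2 ler_pdivrMr //; exact: h2.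
- move=> /adm3_le[xx xs]; rewrite /delta3 ler_pdivrMr //; apply: le_trans hN.
  apply: le_trans (num3_le p7 xx) _; rewrite -sinh_2h // ler_wpM2l ?mulr_ge0 // lerD2r.
  by rewrite ler_wpM2l // hc.
Qed.
End density_bounds.

(** * Orders at least 8 *)

Ltac series := rewrite /atanS /atanhS !big_ord_recr big_ord0 /= !(doubleS, double0).

Section atanh_numerals.
Variable R : realType.

(** Values of [atanh] at these fractions are half logarithms of small rationals, so they reduce to
    [atanh (1/3) = (ln 2) / 2], [atanh (1/5) = (ln (3/2)) / 2] and [atanh (1/9) = (ln (5/4)) / 2],
    whose series converge fast. *)
Lemma atanh_split (x k d : R) : -1 < x < 1 -> -1 < k < 1 -> (x - k) = d * (1 - x * k) ->
  atanh x = atanh k + atanh d.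
Proof.
move=> xx kk E; rewrite (atanhD xx kk) E mulfK //.
case/andP: xx => x1 x2; case/andP: kk => k1 k2; rewrite gt_eqF //.
have : 0 < (1 - x) * (1 + k) by rewrite mulr_gt0 //; lra.
have : 0 < (1 + x) * (1 - k) by rewrite mulr_gt0 //; lra.
nra.
Qed.

Lemma atanh_le_frac n (x e : R) : 0 <= x < 1 -> 1 <= e * (1 - x ^+ 2) ->
  atanh x <= atanhS n x + x ^+ n.*2.+1 / n.*2.+1%:R * e.
Proof.
move=> xx he; apply: le_trans (atanh_le n xx) _; case/andP: xx => x0 x1.
have d0 : 0 < 1 - x ^+ 2 by nra.
rewrite lerD2l invfM mulrA ler_wpM2l ?divr_ge0 ?exprn_ge0 //.
by rewrite -div1r ler_pdivrMr.
Qed.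

Lemma atanh_third : d4 346 573 590 200 <= @atanh R (1 / 3) <= d4 346 573 590 400.
Proof.
have h : 0 <= (1 / 3 : R) < 1 by apply/andP; split; lra.
apply/andP; split.
  apply: le_trans (atanh_ge 9 h); series; lra.
apply: le_trans (@atanh_le_frac 9 _ (9 / 8) h _) _; [lra|series; lra].
Qed.

Lemma atanh_fifth : d4 202 732 554 0 <= @atanh R (1 / 5) <= d4 202 732 554 100.
Proof.
have h : 0 <= (1 / 5 : R) < 1 by apply/andP; split; lra.
apply/andP; split.
  apply: le_trans (atanh_ge 7 h); series; lra.
apply: le_trans (@atanh_le_frac 6 _ (25 / 24) h _) _; [lra|series; lra].
Qed.

Lemma atanh_11_13 : d2 1242 450 <= @atanh R (11 / 13).
Proof.
rewrite (@atanh_split (11 / 13) (1 / 3) (5 / 7)); [|lra..].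
rewrite (@atanh_split (5 / 7) (1 / 3) (1 / 2)); [|lra..].
rewrite (@atanh_split (1 / 2) (1 / 3) (1 / 5)); [|lra..].
have /andP[h1 _] := atanh_third; have /andP[h2 _] := atanh_fifth; lra.
Qed.

Lemma atanh_9_11 : d2 1151 290 <= @atanh R (9 / 11).
Proof.
rewrite (@atanh_split (9 / 11) (1 / 3) (2 / 3)); [|lra..].
rewrite (@atanh_split (2 / 3) (1 / 3) (3 / 7)); [|lra..].
rewrite (@atanh_split (3 / 7) (1 / 3) (1 / 9)); [|lra..].
have /andP[h1 _] := atanh_third.
have h : 0 <= (1 / 9 : R) < 1 by apply/andP; split; lra.
have := atanh_ge 3 h; series; lra.
Qed.
End atanh_numerals.

(** * Rational estimates valid for every order *)

Section large_order.
Variables (R : realType) (p : nat).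
Hypothesis p7 : (7 <= p)%N.
Local Notation y := (yp (p%:R : R)).
Local Notation k := (edgeT y).
Local Notation h := (h_ R p).
Local Notation s := (s_ R p).
Local Notation t := (t_ R p).

Lemma order_gt6 : 6 < (p%:R : R).
Proof. by rewrite (ltr_nat R 6 p). Qed.

Lemma edgeT_cos : cos (2 * pi / p%:R) * (1 + k ^+ 2) = 1 :> R.
Proof.
have c1 := cos_gt_half order_gt6; have := sqr_y_edgeT (yp_gt0 R p7) (yp_hi R p7).
rewrite (yp_sqr R p7); set c := cos _ in c1 *; set z := k ^+ 2 => E.
have z0 : 0 <= z by rewrite sqr_ge0.
have : c / (1 + c) * ((1 + c) * (2 + z)) = 1 / (2 + z) * ((1 + c) * (2 + z)) by rewrite E.
have -> : c / (1 + c) * ((1 + c) * (2 + z)) = c * (2 + z) by field; rewrite gt_eqF //; lra.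
have -> : 1 / (2 + z) * ((1 + c) * (2 + z)) = 1 + c by field; rewrite gt_eqF //; lra.
by lra.
Qed.

Lemma edgeK_sqr_edgeT : edgeK y ^+ 2 = k ^+ 2 / (2 + k ^+ 2).
Proof.
have y0 := yp_gt0 R p7; have y1 := yp_lo R p7; have y2 := yp_hi R p7.
have -> : edgeK y = k * y by rewrite /edgeT divfK // gt_eqF.
by rewrite exprMn; rewrite (sqr_y_edgeT y0 y2) mul1r.
Qed.

Lemma atan_ratio_le : atan (edgeK y) / edgeK y <=
  1 - k ^+ 2 / (3 * (2 + k ^+ 2)) + (k ^+ 2) ^+ 2 / (5 * (2 + k ^+ 2) ^+ 2).
Proof.
have y2 := yp_hi R p7; have K0 := edgeK_gt0 y2; have E := edgeK_sqr_edgeT.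
have z0 : 0 < 2 + k ^+ 2 by rewrite ltr_pwDl ?sqr_ge0.
rewrite ler_pdivrMr //; apply: le_trans (atan_le 1 (ltW K0)) _.
series; rewrite le_eqVlt; apply/orP; left; apply/eqP.
have -> : (k ^+ 2) ^+ 2 / (5 * (2 + k ^+ 2) ^+ 2) = (k ^+ 2 / (2 + k ^+ 2)) ^+ 2 / 5.
  by field; rewrite gt_eqF.
have -> : k ^+ 2 / (3 * (2 + k ^+ 2)) = k ^+ 2 / (2 + k ^+ 2) / 3.
  by field; rewrite gt_eqF.
by rewrite -E; field.
Qed.

Lemma edgeT_atanh_le : k * atanh k <=
  k ^+ 2 * (1 + k ^+ 2 / 3 + (k ^+ 2) ^+ 2 / 5 + (k ^+ 2) ^+ 3 / (7 * (1 - k ^+ 2))).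
Proof.
have k0 := edgeT_pos R p7; have k1 := edgeT_lt1 R p7; have D0 := one_sub_sqr_gt0 R p7.
have kk : 0 <= k < 1 by rewrite ltW.
apply: le_trans (ler_wpM2l (ltW k0) (atanh_le 3 kk)) _.
series; rewrite le_eqVlt; apply/orP; left; apply/eqP.
by field; rewrite gt_eqF.
Qed.

(** [volume_lower] with its transcendental parts replaced by [U], [H] and [r]. They occur only in
    the subtracted product, and [A <= H + r] makes upper bounds the right ones there. *)
Lemma density_le (x0 V A B U H r : R) :
  0 < x0 < 1 -> V <= atanh x0 ->
  A = 3 * V * x0 / 2 + x0 ^+ 2 / (2 * (1 - x0 ^+ 2)) ->
  B = (x0 ^+ 4 + A * x0 ^+ 2 * (1 - x0 ^+ 2)) / (3 * (1 - x0 ^+ 2)) -> 0 <= A -> 0 <= B ->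
  atan (edgeK y) / edgeK y <= U -> k * atanh k <= H -> B / k ^+ 2 <= r -> A <= H + r ->
  0 < B * ((1 - k ^+ 2) / (k ^+ 2 * (1 + k ^+ 2))) - U * (H + r - A) ->
  24 * y * (B * ((1 - k ^+ 2) / (k ^+ 2 * (1 + k ^+ 2))) - U * (H + r - A)) <= V0 R p.
Proof.
move=> xx hV AE BE A0 B0 hU hH hr hHr F0.
have y0 := yp_gt0 R p7; have y1 := yp_lo R p7; have y2 := yp_hi R p7.
apply: le_trans (volume_lower y0 y1 y2 xx hV AE BE A0).
have K0 := edgeK_gt0 y2; rewrite ler_wpM2l //; first by rewrite mulr_ge0 // ltW.
have a0 : 0 <= atan (edgeK y) / edgeK y by rewrite divr_ge0 ?(ltW K0) //; have := atan_ge 0 (ltW K0); rewrite /atanS big_ord0.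
set al := atan _ / _ in hU a0 *.
have : al * (H + r - A) <= U * (H + r - A) by rewrite ler_wpM2r //; lra.
have : al * (k * atanh k + B / k ^+ 2) <= al * (H + r) by rewrite ler_wpM2l //; lra.
lra.
Qed.

(** Places the second family under the bound of the third, so that no separate comparison with [V_0]
    is needed; [l] stands for [h] in the numerical check. *)
Lemma num2_dominated x (c Eu l : R) (Ct := (5 + k ^+ 2) / (1 - k ^+ 2)) : adm2 p x ->
  ((1 + k) / (1 - k)) ^+ 2 <= Eu * (2 * Ct - Ct^-1) -> 1 <= Eu -> l <= h ->
  (Ct + 3 * ((Eu - Eu^-1) / 2)) * ((Eu + Eu^-1) / 2) + (Eu - Eu^-1) <=
    4 * (2 * k / (1 - k ^+ 2) * c + l) ->
  Vol p (t + x) + Vol p (t - x) + 3 * Vol p (2 * h - t - x) + 3 * Vol p (2 * h - t + x) <=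
  2 * truncation_area R p * (2 * k / (1 - k ^+ 2) * c + 2 * h).
Proof.
move=> ax hE E1 lh hc; apply: le_trans (num2_final p7 ax hE E1) _.
have A0 := truncation_area_ge0 R p7.
set X := (X in X + 4 * h + _); set Y := 2 * k / _ * c.
have {}hc : X + (Eu - Eu^-1) <= 4 * (Y + l) := hc.
have -> : 2 * truncation_area R p * (Y + 2 * h) = truncation_area R p / 2 * (4 * (Y + 2 * h)) by field.
rewrite ler_wpM2l ?divr_ge0 //.
move: hc lh; clearbody X Y; clear => hc lh.
lra.
Qed.

(** [gk] is a rational lower bound for [k sqrt (2 (1 + k^2))], certified by its square. *)
Lemma cosh_2s_sub_2h_le (gk c x : R) : 0 <= x <= h -> x <= s - h ->
  0 <= gk -> gk ^+ 2 <= 2 * (1 + k ^+ 2) * k ^+ 2 ->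
  (3 + k ^+ 2) * (1 + k ^+ 2) - 4 * gk <= c * (1 - k ^+ 2) ^+ 2 -> cosh (2 * x) <= c.
Proof.
move=> /andP[x0 _] xs g0 hg hc; have D0 := one_sub_sqr_gt0 R p7.
have k0 := edgeT_pos R p7.
apply: (@le_trans _ _ (cosh (2 * (s - h)))); first by rewrite cosh_le; lra.
rewrite (cosh_2s_sub_2h R p7) ler_pdivrMr ?exprn_gt0 //; apply: le_trans hc.
have w0 : 0 <= 2 * (1 + k ^+ 2) by rewrite mulr_ge0 // addr_ge0 ?sqr_ge0.
suff : gk <= k * Num.sqrt (2 * (1 + k ^+ 2)) by lra.
have p0 : 0 <= k * Num.sqrt (2 * (1 + k ^+ 2)) by rewrite mulr_ge0 ?(ltW k0) ?sqrtr_ge0.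
rewrite -(@ler_pXn2r _ 2) ?nnegrE //.
have g2 : Num.sqrt (2 * (1 + k ^+ 2)) ^+ 2 = 2 * (1 + k ^+ 2) by rewrite sqr_sqrtr.
by rewrite [X in _ <= X]exprMn g2 mulrC.
Qed.

(** Admissibility with [x >= 0] forces [t <= 2 h], that is [3 (1 - k^2) <= (1 + k^2)^2], which fails
    for such small [k]: the second family is empty from [p = 9] on. *)
Lemma not_adm2 (x : R) : k ^+ 2 <= 31 / 100 -> ~ adm2 p x.
Proof.
move=> z1 /adm2_le[/andP[x0 xh] _]; have [t0 tE] := t_props R p7; have D0 := one_sub_sqr_gt0 R p7.
have th : cosh t <= cosh (2 * h) by rewrite cosh_le; lra.
have : cosh t ^+ 2 <= cosh (2 * h) ^+ 2 by rewrite ler_pXn2r ?nnegrE ?(ltW (cosh_gt0 _)).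
rewrite tE (cosh_2h R p7).
have -> : ((1 + k ^+ 2) / (1 - k ^+ 2)) ^+ 2 = (1 + k ^+ 2) ^+ 2 / (1 - k ^+ 2) ^+ 2.
  by field; rewrite gt_eqF.
rewrite ler_pdivlMr ?exprn_gt0 //.
have -> : 3 / (1 - k ^+ 2) * (1 - k ^+ 2) ^+ 2 = 3 * (1 - k ^+ 2) by field; rewrite gt_eqF.
move: z1 (sqr_ge0 k); set z := k ^+ 2; nra.
Qed.

Lemma expR_2x_le (x : R) : 0 <= x <= h -> expR (2 * x) <= (1 + k) / (1 - k).
Proof. by move=> /andP[_ xh]; rewrite -(expR_2h R p7) ler_expR ler_pM2l. Qed.

Lemma expR_2h_sum (c : R) : 1 + k ^+ 2 - k <= c * (1 - k ^+ 2) ->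
  (1 + k) / (1 - k) + 3 / ((1 + k) / (1 - k)) <= 4 * c.
Proof.
move=> hc; have D0 := one_sub_sqr_gt0 R p7; have k0 := edgeT_pos R p7; have k1 := edgeT_lt1 R p7.
have -> : (1 + k) / (1 - k) + 3 / ((1 + k) / (1 - k)) = 4 * (1 + k ^+ 2 - k) / (1 - k ^+ 2).
  have -> : 1 - k ^+ 2 = (1 - k) * (1 + k) by ring.
  by field; rewrite !gt_eqF //; lra.
by rewrite ler_pdivrMr //; lra.
Qed.
End large_order.

Section small_orders.
Variables (R : realType) (p : nat).
Hypothesis p7 : (7 <= p)%N.
Local Notation y := (yp (p%:R : R)).
Local Notation k := (edgeT y).
Local Notation h := (h_ R p).
Local Notation s := (s_ R p).
Local Notation t := (t_ R p).

(** The area is [(p - 6) atan (edgeK)] and [edgeK = y k], so after splitting off the ratio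
    [atan (edgeK) / edgeK] both sides carry a factor [y], which cancels. What is left are bounds in
    [k^2]. *)
Lemma density_bound (x0 V A B c U H r g q b : R) :
  0 < x0 < 1 -> V <= atanh x0 ->
  A = 3 * V * x0 / 2 + x0 ^+ 2 / (2 * (1 - x0 ^+ 2)) ->
  B = (x0 ^+ 4 + A * x0 ^+ 2 * (1 - x0 ^+ 2)) / (3 * (1 - x0 ^+ 2)) -> 0 <= A -> 0 <= B ->
  atan (edgeK y) / edgeK y <= U -> k * atanh k <= H -> B / k ^+ 2 <= r -> A <= H + r ->
  g <= (1 - k ^+ 2) / (k ^+ 2 * (1 + k ^+ 2)) -> k ^+ 2 / (1 - k ^+ 2) <= q -> 0 < b ->
  0 < B * g - U * (H + r - A) -> 0 <= c ->
  2 * (p%:R - 6) * U * (2 * q * c + 2 * H) <= b * 24 * (B * g - U * (H + r - A)) ->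
  0 < V0 R p /\ 2 * truncation_area R p * (2 * k / (1 - k ^+ 2) * c + 2 * h) <= b * V0 R p.
Proof.
move=> xx hV AE BE A0 B0 hU hH hr hHr hg hq b0 F0 c0 hN.
have y0 := yp_gt0 R p7; have y2 := yp_hi R p7; have K0 := edgeK_gt0 y2.
have k0 := edgeT_pos R p7; have D0 := one_sub_sqr_gt0 R p7.
have hBg : B * g <= B * ((1 - k ^+ 2) / (k ^+ 2 * (1 + k ^+ 2))) by rewrite ler_wpM2l.
have F1 : 0 < B * ((1 - k ^+ 2) / (k ^+ 2 * (1 + k ^+ 2))) - U * (H + r - A) by lra.
have := density_le p7 xx hV AE BE A0 B0 hU hH hr hHr F1 => hV0.
have y24 : 0 < 24 * y by rewrite mulr_gt0.
have hV1 : 24 * y * (B * g - U * (H + r - A)) <= V0 R p.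
  by apply: le_trans hV0; rewrite ler_wpM2l ?(ltW y24) //; lra.
split; first by apply: lt_le_trans hV1; rewrite mulr_gt0.
apply: (@le_trans _ _ (b * (24 * y * (B * g - U * (H + r - A))))); last by rewrite ler_pM2l.
set al := atan (edgeK y) / edgeK y in hU.
have a0 : 0 <= al by rewrite divr_ge0 ?(ltW K0) //; have := atan_ge 0 (ltW K0); rewrite /atanS big_ord0.
have p6 := order_gt6 R p7.
have AA : truncation_area R p = (p%:R - 6) * (al * (y * k)).
  have aE : pi / p%:R = al * edgeK y :> R by rewrite /al divfK ?gt_eqF // (atan_edgeK R p7).
  have -> : y * k = edgeK y by rewrite /edgeT mulrC divfK // gt_eqF.
  by rewrite -aE /truncation_area; field; rewrite gt_eqF //; lra.
have -> : 2 * truncation_area R p * (2 * k / (1 - k ^+ 2) * c + 2 * h) =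
    y * (2 * (p%:R - 6) * (al * (2 * (k ^+ 2 / (1 - k ^+ 2)) * c + 2 * (k * atanh k)))).
  by rewrite AA (h_E R p7); field; rewrite gt_eqF.
have -> : b * (24 * y * (B * g - U * (H + r - A))) = y * (b * 24 * (B * g - U * (H + r - A))) by ring.
rewrite ler_pM2l //; apply: le_trans hN; rewrite -[X in _ <= X]mulrA.
have p60 : 0 <= 2 * (p%:R - 6) :> R by clear -p7 p6; lra.
rewrite ler_wpM2l //.
have X0 : 0 <= 2 * (k ^+ 2 / (1 - k ^+ 2)) * c + 2 * (k * atanh k).
  have kk : 0 <= k < 1 by rewrite ltW // (edgeT_lt1 R p7).
  have h0 := mulr_ge0 (ltW k0) (atanh_ge0 kk).
  have z0 : 0 <= k ^+ 2 / (1 - k ^+ 2) by rewrite divr_ge0 ?sqr_ge0 ?(ltW D0).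
  have zc := mulr_ge0 z0 c0; clear -p7 h0 zc; lra.
apply: ler_pM => //.
have zc : k ^+ 2 / (1 - k ^+ 2) * c <= q * c by rewrite ler_wpM2r.
clear -p7 hH zc; lra.
Qed.

Lemma deltas_le (c b : R) : 0 < V0 R p -> 1 <= c ->
  (forall x, 0 <= x <= h -> x <= s - h -> cosh (2 * x) <= c) ->
  1 + k ^+ 2 - k <= c * (1 - k ^+ 2) ->
  2 * truncation_area R p * (2 * k / (1 - k ^+ 2) * c + 2 * h) <= b * V0 R p ->
  (forall x, adm2 p x ->
    Vol p (t + x) + Vol p (t - x) + 3 * Vol p (2 * h - t - x) + 3 * Vol p (2 * h - t + x)
      <= b * V0 R p) ->
  forall x, (adm1 p x -> delta1 p x <= b) /\ (adm2 p x -> delta2 p x <= b) /\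
    (adm3 p x -> delta3 p x <= b).
Proof.
move=> V00 c1 hc hk hN h2.
apply: (@delta_bounds _ _ p7 c b ((1 + k) / (1 - k))) => //.
- by move=> x xx _; exact: (expR_2x_le p7).
- exact: (expR_2h_sum p7).
Qed.
End small_orders.

(* The tangent of x atanh x at x0 = 11/13, where atanh x0 = (ln 12) / 2. *)
Section tangent_11_13.
Variable R : realType.
Definition A13 : R := 3 * d2 1242 450 * (11 / 26) + 121 / 96.
Definition B13 : R := (121 / 169) * (121 / 144) + A13 * (121 / 507).
End tangent_11_13.
Arguments A13 {R}.
Arguments B13 {R}.

(** * Order 8 *)

Section order_8_numerals.
Variable R : realType.
Implicit Types k z : R.

Lemma ler_square (a b : R) : 0 <= a -> a <= b -> a ^+ 2 <= b ^+ 2.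
Proof. by move=> a0 ab; rewrite (@ler_pXn2r _ 2) ?nnegrE //; exact: le_trans ab. Qed.

Lemma order8_atan z : d2 414 213 <= z -> z <= d2 414 214 ->
  1 - z / (3 * (2 + z)) + z ^+ 2 / (5 * (2 + z) ^+ 2) <= d2 948 700.
Proof.
move=> z1 z2.
have h1 : z / (2 + z) <= d2 171 574 by rewrite ler_pdivrMr; lra.
have h2 : d2 171 572 <= z / (2 + z) by rewrite ler_pdivlMr; lra.
have n0 : 2 + z != 0 by rewrite gt_eqF //; lra.
have -> : z / (3 * (2 + z)) = z / (2 + z) / 3 by field.
have -> : z ^+ 2 / (5 * (2 + z) ^+ 2) = (z / (2 + z)) ^+ 2 / 5 by field.
have h0 : 0 <= z / (2 + z) by lra.
have := ler_square h0 h1; lra.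
Qed.

Lemma order8_atanh z : d2 414 213 <= z -> z <= d2 414 214 ->
  z * (1 + z / 3 + z ^+ 2 / 5 + z ^+ 3 / (7 * (1 - z))) <= d2 492 800.
Proof.
move=> z1 z2; have z0 : 0 <= z by lra.
have q2 := ler_square z0 z2.
have q3 : z ^+ 3 <= d2 71 69.
  have -> : z ^+ 3 = z * z ^+ 2 by ring.
  apply: (@le_trans _ _ (d2 414 214 * d2 414 214 ^+ 2)); last by lra.
  by apply: ler_pM => //; exact: sqr_ge0.
have q4 : z ^+ 3 / (7 * (1 - z)) <= d2 17 333 by rewrite ler_pdivrMr; lra.
have q5 : 0 <= z ^+ 3 / (7 * (1 - z)) by rewrite divr_ge0 ?exprn_ge0 //; lra.
apply: (@le_trans _ _ (d2 414 214 * (1 + d2 414 214 / 3 + d2 414 214 ^+ 2 / 5 + d2 17 333))); last lra.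
by apply: ler_pM => //; have := sqr_ge0 z; lra.
Qed.

Lemma order8_slope z : d2 414 213 <= z -> z <= d2 414 214 -> d2 999 990 <= (1 - z) / (z * (1 + z)).
Proof.
move=> z1 z2; have q1 : z * (1 + z) <= d2 585 788 by nra.
rewrite ler_pdivlMr; first by lra.
by rewrite mulr_gt0 //; lra.
Qed.

Lemma order8_ratio z : d2 414 213 <= z -> z <= d2 414 214 -> z / (1 - z) <= d2 707 110.
Proof. by move=> h1 h2; rewrite ler_pdivrMr; lra. Qed.

Lemma order8_gap z : d2 414 213 <= z -> z <= d2 414 214 ->
  (d2 1082 390) ^+ 2 <= 2 * (1 + z) * z /\
  (3 + z) * (1 + z) - 4 * d2 1082 390 <= d2 1454 0 * (1 - z) ^+ 2.
Proof. by move=> z1 z2; split; nra. Qed.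

Lemma order8_num2 k z C : C = (5 + z) / (1 - z) ->
  d2 643 593 <= k -> k <= d2 643 596 -> d2 414 213 <= z -> z <= d2 414 214 ->
  ((1 + k) / (1 - k)) ^+ 2 <= 12 / 10 * (2 * C - C^-1) /\
  (C + 3 * ((12 / 10 - (12 / 10)^-1) / 2)) * ((12 / 10 + (12 / 10)^-1) / 2) + (12 / 10 - (12 / 10)^-1) <=
    4 * (2 * k / (1 - z) * d2 1454 0 + 0).
Proof.
move=> CE k1 k2 z1 z2.
have q3 : 92 / 10 <= C by clear -CE z1 z2; rewrite CE ler_pdivlMr; lra.
have q5 : C <= 925 / 100 by clear -CE z1 z2; rewrite CE ler_pdivrMr; lra.
have q1 : (1 + k) / (1 - k) <= 462 / 100 by clear -k1 k2; rewrite ler_pdivrMr; lra.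
have q2 : 0 <= (1 + k) / (1 - k) by clear -k1 k2; rewrite divr_ge0; lra.
have q4 : C^-1 <= 11 / 100 by clear -q3; rewrite -div1r ler_pdivrMr; lra.
have q6 : 219 / 100 <= 2 * k / (1 - z) by clear -k1 z1 z2; rewrite ler_pdivlMr; lra.
have -> : (12 / 10 : R)^-1 = 10 / 12 by clear; field.
have aux (u v w D : R) : 0 <= u -> u <= 462 / 100 -> v <= 11 / 100 -> 92 / 10 <= D -> D <= 925 / 100 ->
    219 / 100 <= w -> u ^+ 2 <= 12 / 10 * (2 * D - v) /\
    (D + 3 * ((12 / 10 - 10 / 12) / 2)) * ((12 / 10 + 10 / 12) / 2) + (12 / 10 - 10 / 12) <=
    4 * (w * d2 1454 0 + 0).
  clear => *; split; last by lra.
  have u2 : u ^+ 2 <= (462 / 100) ^+ 2 by exact: ler_square.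
  lra.
exact: aux.
Qed.
End order_8_numerals.

Section order_8.
Variable R : realType.
Local Notation y := (yp (8%:R : R)).
Local Notation k := (edgeT y).

(** The cosine of [pi / 4] turns [edgeT_cos] into [(1 + k^2)^2 = 2], so [k^2 = sqrt 2 - 1]. *)
Lemma edgeT8_sqr : d2 414 213 <= k ^+ 2 <= d2 414 214.
Proof.
have E := edgeT_cos R (isT : 7 <= 8)%N; have k0 := sqr_ge0 k.
have c1 := cos_gt_half (order_gt6 R (isT : 7 <= 8)%N).
have c0 : 2 * cos (2 * pi / 8%:R) ^+ 2 = 1 :> R.
  have := @cos2 R (2 * pi / 8%:R).
  have -> : 2 * pi / 8%:R + 2 * pi / 8%:R = pi / 2 :> R by field.
  by rewrite cos_pihalf; lra.
move: E c0 k0 c1; set z := k ^+ 2; set c := cos _ => E c0 k0 c1.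
have w2 : (1 + z) ^+ 2 = 2.
  have : 2 * c ^+ 2 * (1 + z) ^+ 2 = (1 + z) ^+ 2 by rewrite c0 mul1r.
  have -> : 2 * c ^+ 2 * (1 + z) ^+ 2 = 2 * (c * (1 + z)) ^+ 2 by ring.
  by rewrite E; lra.
apply/andP; split; nra.
Qed.

Lemma edgeT8 : d2 643 593 <= k <= d2 643 596.
Proof.
have /andP[h1 h2] := edgeT8_sqr; have k0 := edgeT_pos R (isT : 7 <= 8)%N.
by apply/andP; split; nra.
Qed.

Lemma order8_le x :
  (adm1 8 x -> delta1 8 x <= d2 849 300 :> R) /\ (adm2 8 x -> delta2 8 x <= d2 849 300 :> R) /\
    (adm3 8 x -> delta3 8 x <= d2 849 300 :> R).
Proof.
have p7 : (7 <= 8)%N by []. have /andP[z1 z2] := edgeT8_sqr; have /andP[k1 k2] := edgeT8.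
have z0 : 0 < k ^+ 2 by clear -z1; lra.
(* After the tangent data come [c] (above [cosh (2 (s - h))]), [U], [H], [r], [g], [q] and the
   density [b = 0.8493]; all but [b] are bounds near [k^2 = sqrt 2 - 1], rounded to the safe
   side. *)
have [||||||||||||||||V0p hN] := @density_bound R 8 p7 (11 / 13) (d2 1242 450) A13 B13 (d2 1454 0)
  (d2 948 700) (d2 492 800) (d2 3087 300) (d2 999 990) (d2 707 110) (d2 849 300).
- by clear; apply/andP; split; lra.
- exact: atanh_11_13.
- by rewrite /A13; field.
- by rewrite /B13; field.
- by clear; rewrite /A13; lra.
- by clear; rewrite /B13 /A13; lra.
- by apply: le_trans (atan_ratio_le R p7) _; exact: (order8_atan z1 z2).
- by apply: le_trans (edgeT_atanh_le R p7) _; exact: (order8_atanh z1 z2).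
- by clear -z1 z0; rewrite /B13 /A13 ler_pdivrMr //; lra.
- by clear; rewrite /A13; lra.
- exact: (order8_slope z1 z2).
- exact: (order8_ratio z1 z2).
- by clear; lra.
- by clear; rewrite /B13 /A13; lra.
- by clear; lra.
- by clear; rewrite /B13 /A13; lra.
have [g1 g2] := order8_gap z1 z2.
apply: (@deltas_le R 8 p7 (d2 1454 0) (d2 849 300) V0p); last first.
- have [h1 h2] := order8_num2 erefl k1 k2 z1 z2.
  have h3 : 1 <= (12 / 10 : R) by clear; lra.
  by move=> u au; apply: le_trans (@num2_dominated R 8 p7 u (d2 1454 0) (12 / 10) 0 au h1 h3 (h_ge0 R p7) h2) hN.
- exact: hN.
- by clear -z1 z2 k1; lra.
- by move=> u xx xs; apply: (@cosh_2s_sub_2h_le R 8 p7 (d2 1082 390) _ u xx xs _ g1 g2); clear; lra.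
- by clear; lra.
Qed.
End order_8.

(** * Order 9 *)

Section order_9_numerals.
Variable R : realType.
Implicit Types k z : R.

Lemma order9_atan z : d2 305 407 <= z -> z <= d2 305 408 ->
  1 - z / (3 * (2 + z)) + z ^+ 2 / (5 * (2 + z) ^+ 2) <= d2 959 400.
Proof.
move=> z1 z2.
have h1 : z / (2 + z) <= d2 132 476 by rewrite ler_pdivrMr; lra.
have h2 : d2 132 474 <= z / (2 + z) by rewrite ler_pdivlMr; lra.
have n0 : 2 + z != 0 by rewrite gt_eqF //; lra.
have -> : z / (3 * (2 + z)) = z / (2 + z) / 3 by field.
have -> : z ^+ 2 / (5 * (2 + z) ^+ 2) = (z / (2 + z)) ^+ 2 / 5 by field.
have h0 : 0 <= z / (2 + z) by lra.
have := ler_square h0 h1; lra.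
Qed.

Lemma order9_atanh z : d2 305 407 <= z -> z <= d2 305 408 ->
  z * (1 + z / 3 + z ^+ 2 / 5 + z ^+ 3 / (7 * (1 - z))) <= d2 344 0.
Proof.
move=> z1 z2; have z0 : 0 <= z by lra.
have q2 := ler_square z0 z2.
have q3 : z ^+ 3 <= d2 28 487.
  have -> : z ^+ 3 = z * z ^+ 2 by ring.
  apply: (@le_trans _ _ (d2 305 408 * d2 305 408 ^+ 2)); last by lra.
  by apply: ler_pM => //; exact: sqr_ge0.
have q4 : z ^+ 3 / (7 * (1 - z)) <= d2 5 860 by rewrite ler_pdivrMr; lra.
have q5 : 0 <= z ^+ 3 / (7 * (1 - z)) by rewrite divr_ge0 ?exprn_ge0 //; lra.
apply: (@le_trans _ _ (d2 305 408 * (1 + d2 305 408 / 3 + d2 305 408 ^+ 2 / 5 + d2 5 860))); last lra.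
by apply: ler_pM => //; have := sqr_ge0 z; lra.
Qed.

Lemma order9_slope z : d2 305 407 <= z -> z <= d2 305 408 -> d2 1742 200 <= (1 - z) / (z * (1 + z)).
Proof.
move=> z1 z2; have q1 : z * (1 + z) <= d2 398 683 by nra.
rewrite ler_pdivlMr; first by lra.
by rewrite mulr_gt0 //; lra.
Qed.

Lemma order9_ratio z : d2 305 407 <= z -> z <= d2 305 408 -> z / (1 - z) <= d2 439 700.
Proof. by move=> h1 h2; rewrite ler_pdivrMr; lra. Qed.

Lemma order9_gap z : d2 305 407 <= z -> z <= d2 305 408 ->
  (d2 892 900) ^+ 2 <= 2 * (1 + z) * z /\
  (3 + z) * (1 + z) - 4 * d2 892 900 <= d2 1541 0 * (1 - z) ^+ 2.
Proof. by move=> z1 z2; split; nra. Qed.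

(** The cubic expresses that three times the angle is [2 pi / 3]. Its reciprocal form
    [w^3 - 6 w^2 + 8] is decreasing on [[1, 2]], so comparing values at two decimals encloses
    [w = 1 + z]. *)
Lemma order9_root z c : 0 <= z -> 1 / 2 < c -> c * (1 + z) = 1 -> 8 * c ^+ 3 - 6 * c + 1 = 0 ->
  d2 305 407 <= z <= d2 305 408.
Proof.
move=> z0 c1 E E3; set w := 1 + z in E.
have w1 : 1 <= w by rewrite /w; lra.
have w2 : w <= 2 by nra.
have F : w ^+ 3 - 6 * w ^+ 2 + 8 = 0.
  have : (8 * c ^+ 3 - 6 * c + 1) * w ^+ 3 = 0 by rewrite E3 mul0r.
  have -> : (8 * c ^+ 3 - 6 * c + 1) * w ^+ 3 =
    8 * (c * w) ^+ 3 - 6 * (c * w) * w ^+ 2 + w ^+ 3 by ring.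
  by rewrite E; lra.
have mono (a b : R) : 1 <= a -> a <= 2 -> 1 <= b -> b <= 2 ->
    a ^+ 3 - 6 * a ^+ 2 <= b ^+ 3 - 6 * b ^+ 2 -> b <= a.
  move=> a1 a2 b1 b2 h; rewrite leNgt; apply/negP => ab.
  have : 0 < (b - a) * (6 * (a + b) - a ^+ 2 - a * b - b ^+ 2) by rewrite mulr_gt0; nra.
  lra.
have h1 : d2 1305 407 <= w by clear -F mono w1 w2; apply: mono; lra.
have h2 : w <= d2 1305 408 by clear -F mono w1 w2; apply: mono; lra.
by move: h1 h2; rewrite /w; clear; move=> *; apply/andP; split; lra.
Qed.
End order_9_numerals.

Section order_9.
Variable R : realType.
Local Notation y := (yp (9%:R : R)).
Local Notation k := (edgeT y).

Lemma edgeT9_sqr : d2 305 407 <= k ^+ 2 <= d2 305 408.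
Proof.
have p7 : (7 <= 9)%N by [].
apply: (order9_root (sqr_ge0 k) (cos_gt_half (order_gt6 R p7)) (edgeT_cos R p7)).
rewrite -[X in X + 1]addrC; have := @cos3 R (2 * pi / 9%:R).
have -> : 2 * pi / 9%:R + 2 * pi / 9%:R + 2 * pi / 9%:R = pi - 2 * pi / 6 :> R by field.
rewrite cosB cospi sinpi cos_pi3; set c := cos _; lra.
Qed.

Lemma order9_le x :
  (adm1 9 x -> delta1 9 x <= d2 849 300 :> R) /\ (adm2 9 x -> delta2 9 x <= d2 849 300 :> R) /\
    (adm3 9 x -> delta3 9 x <= d2 849 300 :> R).
Proof.
have p7 : (7 <= 9)%N by []. have /andP[z1 z2] := edgeT9_sqr.
have k1 : 1 / 2 <= k by have k0 := edgeT_pos R p7; clear -z1 k0; nra.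
have z0 : 0 < k ^+ 2 by clear -z1; lra.
have [||||||||||||||||V0p hN] := @density_bound R 9 p7 (11 / 13) (d2 1242 450) A13 B13 (d2 1541 0)
  (d2 959 400) (d2 344 0) (d2 4187 200) (d2 1742 200) (d2 439 700) (d2 849 300).
- by clear; apply/andP; split; lra.
- exact: atanh_11_13.
- by rewrite /A13; field.
- by rewrite /B13; field.
- by clear; rewrite /A13; lra.
- by clear; rewrite /B13 /A13; lra.
- by apply: le_trans (atan_ratio_le R p7) _; exact: (order9_atan z1 z2).
- by apply: le_trans (edgeT_atanh_le R p7) _; exact: (order9_atanh z1 z2).
- by clear -z1 z0; rewrite /B13 /A13 ler_pdivrMr //; lra.
- by clear; rewrite /A13; lra.
- exact: (order9_slope z1 z2).
- exact: (order9_ratio z1 z2).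
- by clear; lra.
- by clear; rewrite /B13 /A13; lra.
- by clear; lra.
- by clear; rewrite /B13 /A13; lra.
have [g1 g2] := order9_gap z1 z2.
apply: (@deltas_le R 9 p7 (d2 1541 0) (d2 849 300) V0p); last first.
- have zz : k ^+ 2 <= 31 / 100 by clear -z2; lra.
  by move=> u /(not_adm2 p7 zz).
- exact: hN.
- by clear -z1 z2 k1; lra.
- by move=> u xx xs; apply: (@cosh_2s_sub_2h_le R 9 p7 (d2 892 900) _ u xx xs _ g1 g2); clear; lra.
- by clear; lra.
Qed.
End order_9.

(** * Orders at least 10, uniformly *)

Section large_orders.
Variable R : realType.
Implicit Types k z : R.
(* The tangent of x atanh x at x0 = 9/11, where atanh x0 = (ln 10) / 2. *)
Definition A11 : R := 27 * d2 1151 290 / 22 + 81 / 80.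
Definition B11 : R := (81 / 121) * (81 / 120) + A11 * (27 / 121).

(** Five terms of the arctangent series at [1 / sqrt 3], where the value is [pi / 6]. *)
Lemma pi_le : pi <= 3143 / 10 ^+ 3 :> R.
Proof.
have s0 : 0 <= Num.sqrt 3 :> R by rewrite sqrtr_ge0.
have s2 : Num.sqrt 3 ^+ 2 = 3 :> R by rewrite sqr_sqrtr.
set w : R := (Num.sqrt 3)^-1; have w0 : 0 <= w by rewrite invr_ge0.
have w2 : w ^+ 2 = 1 / 3 by rewrite exprVn s2; field.
have w1 : w <= d2 577 351.
  by clear -w0 w2; rewrite leNgt; apply/negP => h; nra.
have := atan_le 2 w0; rewrite (atan_pi6 R); series.
have -> : 0 + (-1) ^+ 0 * w ^+ 1 / 1 + (-1) ^+ 1 * w ^+ 3 / 3 + (-1) ^+ 2 * w ^+ 5 / 5 +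
   (-1) ^+ 3 * w ^+ 7 / 7 + (-1) ^+ 4 * w ^+ 9 / 9 =
  w * (1 - w ^+ 2 / 3 + (w ^+ 2) ^+ 2 / 5 - (w ^+ 2) ^+ 3 / 7 + (w ^+ 2) ^+ 4 / 9) by field.
rewrite w2; clear -w1; lra.
Qed.

Lemma large_atanh z : 0 <= z -> z <= d2 236 80 ->
  z * (1 + z / 3 + z ^+ 2 / 5 + z ^+ 3 / (7 * (1 - z))) <= z * (1 + d2 392 0 * z).
Proof.
move=> z0 z1; rewrite ler_wpM2l //.
have d0 : 0 < 7 * (1 - z) by lra.
have h0 : z ^+ 2 <= d2 236 80 * z by rewrite expr2 ler_wpM2r.
have h1 : z ^+ 3 <= d2 55 734 * z.
  have := ler_wpM2l z0 h0; have -> : z ^+ 3 = z * z ^+ 2 by ring.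
  clear -h0 z0; lra.
have h2 : z ^+ 3 / (7 * (1 - z)) <= d2 10 430 * z by rewrite ler_pdivrMr //; nra.
lra.
Qed.

(** A lower bound for [V_0 / (24 y)] that stays uniform as [z = k^2] tends to 0, where both terms
    grow like [B11 / z]. *)
Lemma large_volume z : 0 < z -> z <= d2 236 80 ->
  604 / 10 ^+ 3 <= B11 * ((1 - z) / (z * (1 + z))) -
    (1 - z / (3 * (2 + z)) + z ^+ 2 / (5 * (2 + z) ^+ 2)) *
    (z * (1 + z / 3 + z ^+ 2 / 5 + z ^+ 3 / (7 * (1 - z))) + B11 / z - A11).
Proof.
move=> z0 z1; have hH := large_atanh (ltW z0) z1.
set H := z * (_ + _ / _) in hH *; move: hH; move: H => H hH.
have hA : d2 2425 446 <= A11 <= d2 2425 447 by clear; apply/andP; rewrite /A11; split; lra.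
have hB : d2 993 74 <= B11 <= d2 993 75 by clear; apply/andP; rewrite /B11 /A11; split; lra.
move: hA hB; move: A11 B11 => A B /andP[A1 A2] /andP[B1 B2].
have n0 : 2 + z != 0 by clear -z0; rewrite gt_eqF //; lra.
have n1 : 1 + z != 0 by clear -z0; rewrite gt_eqF //; lra.
have nz : z != 0 by rewrite gt_eqF.
set u := 1 / (2 + z); set v := 2 / (1 + z).
(* Chord of the convex function [2 / (1 + z)] from 0 to [sqrt 5 - 2], the value of [z] at [p = 10];
   its slope is the golden ratio, rounded. *)
have hv : v <= 2 - d2 1618 0 * z by clear -z0 z1; rewrite /v ler_pdivrMr; nra.
have u1 : 1 / 2 - z / 4 <= u by clear -z0 z1; rewrite /u ler_pdivlMr; nra.
have u2 : u <= 1 / 2 by clear -z0 z1; rewrite /u ler_pdivrMr; lra.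
(* Since [(1 - z) / (z (1 + z)) = 1 / z - v], the two singular terms [B / z] cancel. *)
have -> : B * ((1 - z) / (z * (1 + z))) -
    (1 - z / (3 * (2 + z)) + z ^+ 2 / (5 * (2 + z) ^+ 2)) * (H + B / z - A) =
    B * (- v + u / 3 - z * u ^+ 2 / 5) + (1 - z * u / 3 + z ^+ 2 * u ^+ 2 / 5) * (A - H).
  by rewrite /u /v; field; rewrite n0 n1 nz.
have u0 : 0 <= u by clear -z0 z1 u1; lra.
have uu : u ^+ 2 <= 1 / 4 by clear -u0 u2; nra.
have zu : z * u <= z / 2 by clear -z0 u2; nra.
have zuu : z * u ^+ 2 <= z / 4 by clear -z0 uu; nra.
have e1 : - (11 / 6) + (d2 1484 0) * z <= - v + u / 3 - z * u ^+ 2 / 5 by clear -hv u1 zuu z0; lra.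
have e2 : B * (- (11 / 6) + (d2 1484 0) * z) <= B * (- v + u / 3 - z * u ^+ 2 / 5).
  by rewrite ler_wpM2l //; clear -B1; lra.
have e3 : 1 - z / 6 <= 1 - z * u / 3 + z ^+ 2 * u ^+ 2 / 5.
  have := mulr_ge0 (sqr_ge0 z) (sqr_ge0 u); clear -zu z0; lra.
have e4 : A - z - d2 392 0 * z ^+ 2 <= A - H by clear -hH; lra.
have z2 : z ^+ 2 <= d2 236 80 * z by rewrite expr2 ler_wpM2r // ltW.
have e5 : (1 - z / 6) * (A - z - d2 392 0 * z ^+ 2) <= (1 - z * u / 3 + z ^+ 2 * u ^+ 2 / 5) * (A - H).
  apply: (ler_pM _ _ e3 e4); first by clear -z1; lra.
  by clear -z1 z2 A1; lra.
apply: le_trans (lerD e2 e5).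
have e6 : d2 993 74 * (11 / 6 - d2 1484 0 * z) + d2 0 2 >= B * (11 / 6 - d2 1484 0 * z) by clear -B1 B2 z0 z1; nra.
have e7 : (1 - z / 6) * (A - z - d2 392 0 * z ^+ 2) >= d2 2425 446 - d2 1405 0 * z - d2 226 0 * z ^+ 2.
  by clear -A1 A2 z0 z1 z2; nra.
clear -e6 e7 z0 z1 z2; lra.
Qed.

(** Bounds the area times [k]. The area grows with [p] while [k] shrinks, so the maximum is
    interior: about [3.143 k - 3.871 k^2], largest near [k = 0.406], whence the completed square. *)
Lemma large_angle k a : 0 <= k -> k ^+ 2 <= d2 236 80 ->
  d2 668 700 * k - (d2 668 700 * k) ^+ 3 / 3 <= a -> (3143 / 10 ^+ 3 - 6 * a) * k <= 64 / 100.
Proof.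
move=> k0 k2 ha.
have h1 : 6 * (d2 668 700 * k - (d2 668 700 * k) ^+ 3 / 3) * k <= 6 * a * k by rewrite ler_wpM2r // ler_pM2l.
have h2 : k ^+ 4 <= d2 236 80 * k ^+ 2.
  have -> : k ^+ 4 = k ^+ 2 * k ^+ 2 by ring.
  by rewrite ler_wpM2r // sqr_ge0.
have h3 : (3143 / 10 ^+ 3) * k - d2 3871 0 * k ^+ 2 <= 64 / 100.
  have := sqr_ge0 (k - 406 / 10 ^+ 3); lra.
have := sqr_ge0 k; clear -h1 h2 h3; lra.
Qed.

Lemma large_bracket z : 0 <= z -> z <= d2 236 80 -> (1 + z) / (1 - z) ^+ 2 + (1 + d2 392 0 * z) <= d2 3211 0.
Proof.
move=> z0 z1; have : (1 + z) / (1 - z) ^+ 2 <= d2 2118 200.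
  by rewrite ler_pdivrMr ?exprn_gt0; nra.
lra.
Qed.
End large_orders.
Arguments A11 {R}.
Arguments B11 {R}.

Section order_ge10.
Variable R : realType.
Local Notation y p := (yp (p%:R : R)).
Local Notation k p := (edgeT (y p)).

(** Monotonicity of the cosine reduces to [p = 10], where for the angle [pi / 5] the relation
    between threefold and twofold angle gives [4 c^2 - 2 c - 1 = 0]. *)
Lemma edgeT10_sqr p : (10 <= p)%N -> k p ^+ 2 <= d2 236 80.
Proof.
move=> p10; have p7 : (7 <= p)%N by exact: leq_trans p10.
have c1 := @cos_gt_half R 10 ltac:(lra).
have p10R : (10 : R) <= p%:R by rewrite (ler_nat R 10 p).
have hc : cos (2 * pi / 10) <= cos (2 * pi / p%:R) :> R.
  have pi0 := pi_gt0 R.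
  have h1 : 2 * @pi R / p%:R <= 2 * pi / 10 by rewrite ler_wpM2l ?mulr_ge0 ?(ltW pi0) // lef_pV2 ?posrE //; lra.
  have h2 : 0 <= 2 * @pi R / p%:R by rewrite divr_ge0 ?mulr_ge0 ?(ltW pi0).
  have h3 : 2 * @pi R / 10 <= pi by rewrite ler_pdivrMr //; lra.
  by rewrite leNgt; apply/negP; rewrite ltr_cos ?in_itv /= ?h2 ?(le_trans h2 h1) ?(le_trans h1 h3) ?h3 // ltNge h1.
have c0 : 4 * cos (2 * pi / 10) ^+ 2 - 2 * cos (2 * pi / 10) - 1 = 0 :> R.
  have := @cos3 R (2 * pi / 10); have := @cos2 R (2 * pi / 10).
  have -> : 2 * pi / 10 + 2 * pi / 10 + 2 * pi / 10 = pi - (2 * pi / 10 + 2 * pi / 10) :> R by field.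
  rewrite cosB cospi sinpi => ->; move: c1; set c := cos _ => c1 E.
  have : (4 * c ^+ 2 - 2 * c - 1) * (c + 1) = 0 by lra.
  by move/eqP; rewrite mulf_eq0 => /orP[/eqP //|/eqP]; lra.
have := edgeT_cos R p7; move: hc c0 c1 (sqr_ge0 (k p)).
set c := cos (_ / p%:R); set z := k p ^+ 2; set c' := cos _; clear => hc c0 c1 z0 E.
have c2 : d2 809 16 <= c' by nra.
nra.
Qed.

Lemma order10_le p x : (10 <= p)%N ->
  (adm1 p x -> delta1 p x <= d2 849 300 :> R) /\ (adm2 p x -> delta2 p x <= d2 849 300 :> R) /\
    (adm3 p x -> delta3 p x <= d2 849 300 :> R).
Proof.
move=> p10; have p7 : (7 <= p)%N by exact: leq_trans p10.
have y0 := yp_gt0 R p7; have y2 := yp_hi R p7; have K0 := edgeK_gt0 y2.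
have z1 := edgeT10_sqr p10; have k0 := edgeT_pos R p7; have D0 := one_sub_sqr_gt0 R p7.
have z0 : 0 < k p ^+ 2 by rewrite exprn_gt0.
have hF := large_volume z0 z1.
have hH := edgeT_atanh_le R p7.
have F0 : 0 < (604 / 10 ^+ 3 : R) by clear; lra.
have B0 : 0 <= (B11 : R) by clear; rewrite /B11 /A11; lra.
have xx : 0 < (9 / 11 : R) < 1 by clear; apply/andP; split; lra.
have AE : (A11 : R) = 3 * d2 1151 290 * (9 / 11) / 2 + (9 / 11) ^+ 2 / (2 * (1 - (9 / 11) ^+ 2)).
  by clear; rewrite /A11; field.
have BE : (B11 : R) = ((9 / 11) ^+ 4 + A11 * (9 / 11) ^+ 2 * (1 - (9 / 11) ^+ 2)) / (3 * (1 - (9 / 11) ^+ 2)).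
  by clear; rewrite /B11; field.
have A0 : 0 <= (A11 : R) by clear; rewrite /A11; lra.
have hr : (A11 : R) <= k p ^+ 2 * (1 + k p ^+ 2 / 3 + (k p ^+ 2) ^+ 2 / 5 + (k p ^+ 2) ^+ 3 / (7 * (1 - k p ^+ 2))) + B11 / k p ^+ 2.
  have h1 : 4 <= B11 / k p ^+ 2 by clear -z0 z1; rewrite ler_pdivlMr // /B11 /A11; lra.
  have h2 : 0 <= k p * atanh (k p).
    have kk : 0 <= k p < 1 by rewrite ltW // (edgeT_lt1 R p7).
    exact: (mulr_ge0 (ltW k0) (atanh_ge0 kk)).
  have h3 : (A11 : R) <= 3 by clear; rewrite /A11; lra.
  lra.
have hV := density_le p7 xx (atanh_9_11 R) AE BE A0 B0 (atan_ratio_le R p7) hH (lexx _) hr (lt_le_trans F0 hF).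
have y24 : 0 < 24 * (y p) by rewrite mulr_gt0.
have {hF hr}hV : 24 * (y p) * (604 / 10 ^+ 3) <= V0 R p.
  by apply: le_trans hV; rewrite ler_wpM2l ?(ltW y24).
have yl : d2 668 700 <= (y p).
  have := sqr_y_edgeT y0 y2 => yE.
  have : d2 447 170 <= (y p) ^+ 2 by rewrite yE; clear -z0 z1; rewrite ler_pdivlMr; lra.
  by clear -y0 => hy; rewrite leNgt; apply/negP => h; nra.
have V00 : 0 < V0 R p by apply: lt_le_trans hV; rewrite mulr_gt0.
have hV1 : 9693 / 10 ^+ 3 <= V0 R p by clear -hV yl; lra.
have zz : k p ^+ 2 <= 31 / 100 by clear -z1; lra.
(* For these orders the bound [cosh (2 h)], coming from [x <= h], is precise enough as [c]. *)
apply: (@deltas_le R p p7 ((1 + k p ^+ 2) / (1 - k p ^+ 2)) (d2 849 300) V00); last first.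
- by move=> u /(not_adm2 p7 zz).
- have hB := large_bracket (ltW z0) z1.
  have hA : truncation_area R p * k p <= 64 / 100.
    have ha := @large_angle R (k p) (pi / p%:R) (ltW k0) z1.
    apply: le_trans (ha _).
      by rewrite ler_wpM2r ?(ltW k0) // /truncation_area lerD2r; exact: pi_le.
    rewrite -(atan_edgeK R p7).
    have v0 : 0 <= d2 668 700 * k p by clear -k0; lra.
    apply: le_trans (le_trans (atan_ge 1 v0) (atan_mono _)).
      by series; clear; lra.
    have -> : edgeK (y p) = (y p) * k p by rewrite /edgeT mulrC divfK // gt_eqF.
    by rewrite ler_pM2r.
  have A1 := truncation_area_ge0 R p7.
  have hh : h_ R p <= k p * (1 + d2 392 0 * k p ^+ 2).
    rewrite -(ler_pM2l k0) (h_E R p7); apply: le_trans (le_trans hH (large_atanh (ltW z0) z1)) _.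
    have -> : k p * (k p * (1 + d2 392 0 * k p ^+ 2)) = k p ^+ 2 * (1 + d2 392 0 * k p ^+ 2) by ring.
    exact: lexx.
  have -> : 2 * truncation_area R p * (2 * k p / (1 - k p ^+ 2) * ((1 + k p ^+ 2) / (1 - k p ^+ 2)) + 2 * h_ R p) =
    4 * (truncation_area R p * k p * ((1 + k p ^+ 2) / (1 - k p ^+ 2) ^+ 2) + truncation_area R p * h_ R p).
    by field; rewrite gt_eqF.
  have e1 : truncation_area R p * h_ R p <= truncation_area R p * k p * (1 + d2 392 0 * k p ^+ 2).
    by rewrite -mulrA ler_wpM2l.
  have P0 : 0 <= truncation_area R p * k p by rewrite mulr_ge0 // ltW.
  have X0 : 0 <= (1 + k p ^+ 2) / (1 - k p ^+ 2) ^+ 2 + (1 + d2 392 0 * k p ^+ 2).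
    apply: addr_ge0; last by clear -z0; lra.
    by rewrite divr_ge0 ?sqr_ge0 // addr_ge0 ?sqr_ge0.
  have e2 : truncation_area R p * k p * ((1 + k p ^+ 2) / (1 - k p ^+ 2) ^+ 2 + (1 + d2 392 0 * k p ^+ 2)) <= 64 / 100 * d2 3211 0.
    exact: (ler_pM P0 X0 hA hB).
  rewrite mulrDr in e2; clear -e1 e2 hV1; lra.
- by rewrite divfK ?gt_eqF //; clear -k0; lra.
- move=> u /andP[u0 uh] _; rewrite -(cosh_2h R p7) cosh_le; clear -u0 uh; lra.
- by rewrite ler_pdivlMr //; clear -z0; lra.
Qed.
End order_ge10.

(** * Order 7 *)

Lemma inv_sqrt_props (R : realType) (a : R) : 1 < a ->
  [/\ 0 < (Num.sqrt a)^-1, (Num.sqrt a)^-1 < 1 & (Num.sqrt a)^-1 ^- 2 = a].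
Proof.
move=> a1; have s1 : 1 < Num.sqrt a by rewrite -[1]sqrtr1 ltr_sqrt //; lra.
have s0 : 0 < Num.sqrt a by lra.
split; [by rewrite invr_gt0|by rewrite invf_lt1|].
by rewrite exprVn invrK sqr_sqrtr //; lra.
Qed.

(** * Polynomial bounds of x atanh x from its differential equation *)

Section atanh_approximation.
Variables (R : realType) (al rho sg : R) (P dP : R -> R).
Hypotheses (rho0 : 0 < rho) (dPE : forall u, deriv_at P u (dP u)).

(* For [x = r ^ (-1/2)] and [r = al - rho * u] the sign condition says that [sg * (atanh x - P u / x)]
   increases with [x]: its derivative is [sg * r / (r - 1) / rho] times the bracket. *)
Lemma atanh_approximation u :
  (forall v, 0 <= v <= u ->
     0 <= sg * (rho + (al - rho * v - 1) * (rho * P v - 2 * (al - rho * v) * dP v))) ->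
  0 <= u -> 1 < al - rho * u ->
  sg * P 0 <= sg * ((Num.sqrt al)^-1 * atanh (Num.sqrt al)^-1) ->
  sg * P u <= sg * ((Num.sqrt (al - rho * u))^-1 * atanh (Num.sqrt (al - rho * u))^-1).
Proof.
move=> hK u0 r1 h0.
have al1 : al - rho * u <= al by rewrite gerBl mulr_ge0 // ltW.
pose w x := (al - x ^- 2) / rho.
pose g x := sg * (atanh x - P (w x) * x^-1).
set x1 := (Num.sqrt al)^-1 in h0 *; set x2 := (Num.sqrt (al - rho * u))^-1.
have [x10 x11 x1E] := inv_sqrt_props (lt_le_trans r1 al1).
have [x20 x21 x2E] := inv_sqrt_props r1; rewrite -/x1 in x10 x11 x1E; rewrite -/x2 in x20 x21 x2E.
have w1 : w x1 = 0 by rewrite /w x1E subrr mul0r.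
have w2 : w x2 = u by rewrite /w x2E; field; rewrite gt_eqF.
have x12 : x1 <= x2.
  by rewrite lef_pV2 ?posrE ?sqrtr_gt0 ?ler_sqrt //; lra.
have rng x : x1 <= x <= x2 -> [/\ 0 < x, x < 1 & 0 <= w x <= u].
  move=> /andP[a b]; have x0 : 0 < x by lra.
  have sq (p q : R) : 0 < p -> p <= q -> q ^- 2 <= p ^- 2.
    move=> p0 pq; rewrite lef_pV2 ?posrE ?exprn_gt0 //; last lra.
    by rewrite (@ler_pXn2r _ 2) ?nnegrE //; lra.
  have := sq _ _ x10 a; have := sq _ _ x0 b; rewrite x1E x2E => q1 q2.
  split; [done|lra|]; rewrite /w divr_ge0 ?(ltW rho0) ?subr_ge0 //= ler_pdivrMr //; lra.
have : g x1 <= g x2.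
  apply: (@deriv_ge0_le _ _ (fun x => sg * ((1 - x ^+ 2)^-1 -
      (P (w x) * (- x ^- 2 * 1) + x^-1 * (dP (w x) * (2 * x ^- 3 / rho)))))) => //.
    move=> x /rng[x0 xl _]; have xb : -1 < x < 1 by apply/andP; split; lra.
    have xn : x != 0 by rewrite gt_eqF.
    apply: deriv_eq.
      apply: derivM; first exact: deriv_cst.
      apply: derivD; first exact: (deriv_atanh1 xb).
      apply: derivN; apply: derivM.
        apply: deriv_comp; first exact: dPE.
        apply: derivM; last exact: deriv_cst.
        apply: derivD; first exact: deriv_cst.
        apply: derivN; apply: derivV; first by rewrite expf_neq0.
        by apply: derivX; exact: deriv_id.
      by apply: derivV; [exact: xn|exact: deriv_id].
    cbn beta; rewrite -/(w x).
    have -> : 2%:R * x ^+ 2.-1 = 2 * x by [].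
    have d0 : 1 - x ^+ 2 != 0.
      have -> : 1 - x ^+ 2 = (1 - x) * (1 + x) by ring.
      by rewrite gt_eqF // mulr_gt0; lra.
    by field; rewrite d0 xn gt_eqF.
  move=> x /rng[x0 xl wx]; have := hK _ wx.
  have -> : al - rho * w x = x ^- 2 by rewrite /w; field; rewrite !gt_eqF.
  move=> K0; have d0 : 0 < 1 - x ^+ 2.
    have -> : 1 - x ^+ 2 = (1 - x) * (1 + x) by ring.
    by rewrite mulr_gt0; lra.
  have c0 : 0 <= ((1 - x ^+ 2) * rho)^-1 by rewrite invr_ge0 mulr_ge0 ?(ltW d0) ?(ltW rho0).
  apply: le_trans (mulr_ge0 c0 K0) _; rewrite le_eqVlt; apply/orP; left; apply/eqP.
  by field; rewrite !gt_eqF.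
rewrite /g w1 w2 => hg.
have h1 : 0 <= sg * (atanh x1 - P 0 * x1^-1).
  have -> : sg * (atanh x1 - P 0 * x1^-1) = x1^-1 * (sg * (x1 * atanh x1) - sg * P 0).
    by field; rewrite gt_eqF.
  by rewrite mulr_ge0 ?invr_ge0 ?(ltW x10) // subr_ge0.
have := mulr_ge0 (ltW x20) (le_trans h1 hg).
have -> : x2 * (sg * (atanh x2 - P u * x2^-1)) = sg * (x2 * atanh x2) - sg * P u.
  by field; rewrite gt_eqF.
by rewrite subr_ge0.
Qed.
End atanh_approximation.

Section atanh_sandwich.
Variables (R : realType) (al rho : R) (P dP : R -> R).
Hypotheses (rho0 : 0 < rho) (dPE : forall u, deriv_at P u (dP u)).

Lemma id_atanh_mono (x x' : R) : 0 <= x -> x <= x' -> x' < 1 -> x * atanh x <= x' * atanh x'.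
Proof.
move=> x0 xx x1; apply: ler_pM => //; last exact: atanh_mono.
by apply: atanh_ge0; rewrite x0 /=; exact: le_lt_trans x1.
Qed.

Lemma sqr_inv_le (p q : R) : 0 < p -> 0 < q -> (p <= q) = (q ^- 2 <= p ^- 2).
Proof.
by move=> p0 q0; rewrite lef_pV2 ?posrE ?exprn_gt0 // (@ler_pXn2r _ 2) ?nnegrE ?(ltW p0) ?(ltW q0).
Qed.

(** Rationals [al], [rho] and [x0] stand in for algebraic numbers. As [x atanh x] increases, it is
    enough that [x0] lies below [al^(-1/2)] and [x] above [(al - rho u)^(-1/2)]; [atanh_le_poly]
    rounds the other way. *)
Lemma poly_le_atanh (x0 u x : R) :
  (forall v, 0 <= v <= u ->
     0 <= rho + (al - rho * v - 1) * (rho * P v - 2 * (al - rho * v) * dP v)) ->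
  0 <= u -> 0 < x0 -> al * x0 ^+ 2 <= 1 -> P 0 <= x0 * atanh x0 ->
  0 < x < 1 -> x ^- 2 <= al - rho * u -> P u <= x * atanh x.
Proof.
move=> hK u0 x00 hx0 hP /andP[xp x1] hx.
have xi : 1 < x ^- 2 by rewrite invf_gt1 ?exprn_gt0 // expr_lt1 // ltW.
have r1 : 1 < al - rho * u by exact: lt_le_trans hx.
have a1 : 1 < al by apply: lt_le_trans r1 _; rewrite gerBl mulr_ge0 // ltW.
have [i0 i1 iE] := inv_sqrt_props a1; have [j0 j1 jE] := inv_sqrt_props r1.
have := @atanh_approximation R al rho 1 P dP rho0 dPE u; rewrite !mul1r => H.
apply: le_trans (H _ u0 r1 _) _.
- by move=> v hv; rewrite mul1r; exact: hK.
- by apply: le_trans hP _; apply: id_atanh_mono; rewrite ?(ltW x00) // (sqr_inv_le x00 i0) iE -div1r ler_pdivlMr ?exprn_gt0.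
- by apply: id_atanh_mono; rewrite ?(ltW j0) // (sqr_inv_le j0 xp) jE.
Qed.

Lemma atanh_le_poly (x0 u x : R) :
  (forall v, 0 <= v <= u ->
     rho + (al - rho * v - 1) * (rho * P v - 2 * (al - rho * v) * dP v) <= 0) ->
  0 <= u -> 0 < x0 < 1 -> 1 <= al * x0 ^+ 2 -> x0 * atanh x0 <= P 0 -> 1 < al - rho * u ->
  0 < x -> al - rho * u <= x ^- 2 -> x * atanh x <= P u.
Proof.
move=> hK u0 /andP[x00 x01] hx0 hP r1 xp hx.
have a1 : 1 < al by apply: lt_le_trans r1 _; rewrite gerBl mulr_ge0 // ltW.
have [i0 i1 iE] := inv_sqrt_props a1; have [j0 j1 jE] := inv_sqrt_props r1.
have := @atanh_approximation R al rho (-1) P dP rho0 dPE u; rewrite !mulN1r !lerN2 => H.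
apply: le_trans (H _ u0 r1 _).
- by apply: id_atanh_mono; rewrite ?(ltW xp) // (sqr_inv_le xp j0) jE.
- by move=> v hv; rewrite mulN1r oppr_ge0; exact: hK.
- by apply: le_trans _ hP; apply: id_atanh_mono; rewrite ?(ltW i0) // (sqr_inv_le i0 x00) iE -div1r ler_pdivrMr ?exprn_gt0.
Qed.
End atanh_sandwich.

(** * Polynomial bounds of degree 7 *)

Section degree_seven.
Variables (R : realType) (n0 q0 q1 q2 q3 q4 q5 q6 : R).

Definition pol7 (u : R) := q0 + q1 * u + q2 * u ^+ 2 + q3 * u ^+ 3 + q4 * u ^+ 4 + q5 * u ^+ 5 + q6 * u ^+ 6.
Definition dpol7 (u : R) := q1 + 2 * q2 * u + 3 * q3 * u ^+ 2 + 4 * q4 * u ^+ 3 + 5 * q5 * u ^+ 4 + 6 * q6 * u ^+ 5.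
(** A polynomial of degree 7 divided with remainder by [1 + u], which under [u = T^2] gives the
    shape of [tipApprox]; [n0] is its value at [u = -1]. *)
Definition approx7 (u : R) := n0 + (1 + u) * pol7 u.
Definition dapprox7 (u : R) := pol7 u + (1 + u) * dpol7 u.
Definition prim7 (T : R) := q0 * T + q1 * T ^+ 3 / 3 + q2 * T ^+ 5 / 5 + q3 * T ^+ 7 / 7 + q4 * T ^+ 9 / 9 + q5 * T ^+ 11 / 11 + q6 * T ^+ 13 / 13.
(** [prim7 T / T] as a polynomial in [v = T^2]. Since [edgeK = y k], the quotient
    [prim7 (edgeK) / k] becomes [y] times its value at [edgeK^2]. *)
Definition mean7 (v : R) := q0 + q1 * v / 3 + q2 * v ^+ 2 / 5 + q3 * v ^+ 3 / 7 + q4 * v ^+ 4 / 9 + q5 * v ^+ 5 / 11 + q6 * v ^+ 6 / 13.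

Lemma deriv_approx7 u : deriv_at approx7 u (dapprox7 u).
Proof.
apply: deriv_eq; first by rewrite /approx7 /pol7; derivs.
by rewrite /dapprox7 /pol7 /dpol7 /=; ring.
Qed.

Lemma deriv_prim7 T : deriv_at prim7 T (pol7 (T ^+ 2)).
Proof.
apply: deriv_eq; first by rewrite /prim7; derivs.
by rewrite /pol7 /=; field.
Qed.

Lemma continuous_pol7 (T : R) : {for T, continuous (fun T : R => pol7 (T ^+ 2))}.
Proof. by apply: deriv_continuous; rewrite /pol7; derivs. Qed.

Lemma prim7_mean T k : k != 0 -> prim7 (T * k) / k = T * mean7 ((T * k) ^+ 2).
Proof. by move=> k0; rewrite /prim7 /mean7; field. Qed.

Lemma prim7_0 : prim7 0 = 0.
Proof. by rewrite /prim7 !expr0n /=; ring. Qed.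

Variable y : R.
Hypotheses (y0 : 0 < y) (y1 : 1 < 3 * y ^+ 2) (y2 : 2 * y ^+ 2 < 1) (T2 : edgeK y ^+ 2 <= 232 / 10 ^+ 3).
Local Notation k := (edgeT y).

Lemma tipT_sqr_range m : 0 <= m <= 1 -> 0 <= tipT y m ^+ 2 <= 232 / 10 ^+ 3.
Proof.
move=> /(tipT_range y2)/andP[t0 t1]; rewrite sqr_ge0 /=; apply: le_trans T2.
by rewrite (@ler_pXn2r _ 2) ?nnegrE //; exact: le_trans t1.
Qed.

Lemma volume7_eq :
  24 * ((n0 * atan (edgeK y) + (prim7 (edgeK y) - prim7 0)) / k - atanh k * atan (edgeK y)) =
  24 * (atan (edgeK y) * (n0 / k - atanh k) + y * mean7 (edgeK y ^+ 2)).
Proof.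
have k0 : k != 0 by rewrite gt_eqF // (edgeT_gt0 y0 y2).
have KE : edgeK y = y * k by rewrite /edgeT mulrC divfK // gt_eqF.
have -> : y * mean7 (edgeK y ^+ 2) = prim7 (edgeK y) / k by rewrite KE (prim7_mean _ k0).
by rewrite prim7_0; field.
Qed.

Lemma volume7_ge (al rho x0 : R) : 0 < rho -> rho <= tipSlope y -> 2 * y ^+ 2 / (1 - y ^+ 2) <= al ->
  (forall v, 0 <= v <= 232 / 10 ^+ 3 ->
     0 <= rho + (al - rho * v - 1) * (rho * approx7 v - 2 * (al - rho * v) * dapprox7 v)) ->
  0 < x0 -> al * x0 ^+ 2 <= 1 -> approx7 0 <= x0 * atanh x0 ->
  24 * (atan (edgeK y) * (n0 / k - atanh k) + y * mean7 (edgeK y ^+ 2)) <= hvol (Cr y).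
Proof.
move=> rho0 hrho hal hK x00 hx0 h0.
rewrite -volume7_eq; apply: (hvol_Cr_ge y0 y1 y2 deriv_prim7 continuous_pol7) => m mm.
have /andP[u0 u1] := tipT_sqr_range mm; have /andP[p0 p1] := tipX1_range y0 y1 y2 mm.
apply: (poly_le_atanh rho0 deriv_approx7 _ u0 x00 hx0 h0); first by move=> v /andP[v0 v1]; apply: hK; rewrite v0 (le_trans v1).
- by rewrite p0.
- rewrite (tipX_inv_sqr y0 y1 y2 mm) /tipR.
  by have := ler_wpM2r u0 hrho; move: hal; lra.
Qed.

Lemma volume7_le (al rho x0 : R) : 0 < rho -> tipSlope y <= rho -> al <= 2 * y ^+ 2 / (1 - y ^+ 2) ->
  (forall v, 0 <= v <= 232 / 10 ^+ 3 ->
     rho + (al - rho * v - 1) * (rho * approx7 v - 2 * (al - rho * v) * dapprox7 v) <= 0) ->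
  0 < x0 < 1 -> 1 <= al * x0 ^+ 2 -> x0 * atanh x0 <= approx7 0 -> 1 < al - rho * (232 / 10 ^+ 3) ->
  hvol (Cr y) <= 24 * (atan (edgeK y) * (n0 / k - atanh k) + y * mean7 (edgeK y ^+ 2)).
Proof.
move=> rho0 hrho hal hK xx hx0 h0 r1.
rewrite -volume7_eq; apply: (hvol_Cr_le y0 y1 y2 deriv_prim7 continuous_pol7) => m mm.
have /andP[u0 u1] := tipT_sqr_range mm; have /andP[p0 p1] := tipX1_range y0 y1 y2 mm.
apply: (atanh_le_poly rho0 deriv_approx7 _ u0 xx hx0 h0 _ p0).
- by move=> v /andP[v0 v1]; apply: hK; rewrite v0 (le_trans v1).
- by apply: lt_le_trans r1 _; rewrite lerD2l lerN2 ler_pM2l.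
- rewrite (tipX_inv_sqr y0 y1 y2 mm) /tipR.
  by have := ler_wpM2r u0 hrho; move: hal; lra.
Qed.
End degree_seven.

(* Chebyshev interpolants of degree 7, shifted by a multiple of [u] so that the sign conditions hold
   with positive Bernstein coefficients on [[0, 232 / 10 ^+ 3]]. *)
Arguments approx7 : clear implicits.
Arguments dapprox7 : clear implicits.
Arguments mean7 : clear implicits.
Notation lower7 f := (f ((i4 17 417 604 637) / 10 ^+ 9) ((- (i4 16 540 833 168)) / 10 ^+ 9) ((i4 17 306 66 393) / 10 ^+ 9) ((- (i4 16 482 354 25)) / 10 ^+ 9) ((i4 17 348 53 501) / 10 ^+ 9) ((- (i4 15 11 965 678)) / 10 ^+ 9) ((i4 12 82 313 437) / 10 ^+ 9)) (only parsing).
Notation lower7_const := ((- (i4 16 119 944 472)) / 10 ^+ 9) (only parsing).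
Notation upper7 f := (f ((i4 17 417 786 985) / 10 ^+ 9) ((- (i4 16 540 934 927)) / 10 ^+ 9) ((i4 17 306 169 124) / 10 ^+ 9) ((- (i4 16 482 455 143)) / 10 ^+ 9) ((i4 17 348 156 383) / 10 ^+ 9) ((- (i4 15 12 57 776)) / 10 ^+ 9) ((i4 12 82 383 66) / 10 ^+ 9)) (only parsing).
Notation upper7_const := ((- (i4 16 120 126 184)) / 10 ^+ 9) (only parsing).

Section approximation_signs.
Variable R : realType.
Implicit Types u : R.

Lemma approx7_scaled_sign (n0 q0 q1 q2 q3 q4 q5 q6 a r S M u : R) : S != 0 -> M != 0 ->
  r / S + (a / S - r / S * u - 1) *
    (r / S * approx7 R (n0 / M) (q0 / M) (q1 / M) (q2 / M) (q3 / M) (q4 / M) (q5 / M) (q6 / M) u -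
     2 * (a / S - r / S * u) * dapprox7 R (q0 / M) (q1 / M) (q2 / M) (q3 / M) (q4 / M) (q5 / M) (q6 / M) u) =
  (r * S * M + (a - r * u - S) *
    (r * approx7 R n0 q0 q1 q2 q3 q4 q5 q6 u - 2 * (a - r * u) * dapprox7 R q0 q1 q2 q3 q4 q5 q6 u)) / (S ^+ 2 * M).
Proof. by move=> S0 M0; rewrite /approx7 /dapprox7 /pol7 /dpol7; field; rewrite S0 M0. Qed.

(* Integer coefficients keep the certificates small. *)
Lemma lower7_integer_sign u : 0 <= u -> 0 <= 232 - 10 ^+ 3 * u ->
  0 <= i3 4 89 909 * 10 ^+ 7 * 10 ^+ 9 + (i3 12 469 797 - i3 4 89 909 * u - 10 ^+ 7) *
    (i3 4 89 909 * approx7 R (- (i4 16 119 944 472)) (i4 17 417 604 637) (- (i4 16 540 833 168)) (i4 17 306 66 393) (- (i4 16 482 354 25)) (i4 17 348 53 501) (- (i4 15 11 965 678)) (i4 12 82 313 437) u -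
     2 * (i3 12 469 797 - i3 4 89 909 * u) * dapprox7 R (i4 17 417 604 637) (- (i4 16 540 833 168)) (i4 17 306 66 393) (- (i4 16 482 354 25)) (i4 17 348 53 501) (- (i4 15 11 965 678)) (i4 12 82 313 437) u).
Proof.
move=> u0 u1.
(* The expression has degree 8 in [u]; [lra] writes it as a nonnegative combination of these
   Bernstein polynomials. *)
have b0 : 0 <= u ^+ 0 * (232 - 10 ^+ 3 * u) ^+ 8 by rewrite mulr_ge0 ?exprn_ge0.
have b1 : 0 <= u ^+ 1 * (232 - 10 ^+ 3 * u) ^+ 7 by rewrite mulr_ge0 ?exprn_ge0.
have b2 : 0 <= u ^+ 2 * (232 - 10 ^+ 3 * u) ^+ 6 by rewrite mulr_ge0 ?exprn_ge0.
have b3 : 0 <= u ^+ 3 * (232 - 10 ^+ 3 * u) ^+ 5 by rewrite mulr_ge0 ?exprn_ge0.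
have b4 : 0 <= u ^+ 4 * (232 - 10 ^+ 3 * u) ^+ 4 by rewrite mulr_ge0 ?exprn_ge0.
have b5 : 0 <= u ^+ 5 * (232 - 10 ^+ 3 * u) ^+ 3 by rewrite mulr_ge0 ?exprn_ge0.
have b6 : 0 <= u ^+ 6 * (232 - 10 ^+ 3 * u) ^+ 2 by rewrite mulr_ge0 ?exprn_ge0.
have b7 : 0 <= u ^+ 7 * (232 - 10 ^+ 3 * u) ^+ 1 by rewrite mulr_ge0 ?exprn_ge0.
have b8 : 0 <= u ^+ 8 * (232 - 10 ^+ 3 * u) ^+ 0 by rewrite mulr_ge0 ?exprn_ge0.
rewrite /approx7 /dapprox7 /pol7 /dpol7.
move: b0 b1 b2 b3 b4 b5 b6 b7 b8; clear; move=> *.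
lra.
Qed.

Lemma upper7_integer_sign u : 0 <= u -> 0 <= 232 - 10 ^+ 3 * u ->
  i3 4 89 910 * 10 ^+ 7 * 10 ^+ 9 + (i3 12 469 796 - i3 4 89 910 * u - 10 ^+ 7) *
    (i3 4 89 910 * approx7 R (- (i4 16 120 126 184)) (i4 17 417 786 985) (- (i4 16 540 934 927)) (i4 17 306 169 124) (- (i4 16 482 455 143)) (i4 17 348 156 383) (- (i4 15 12 57 776)) (i4 12 82 383 66) u -
     2 * (i3 12 469 796 - i3 4 89 910 * u) * dapprox7 R (i4 17 417 786 985) (- (i4 16 540 934 927)) (i4 17 306 169 124) (- (i4 16 482 455 143)) (i4 17 348 156 383) (- (i4 15 12 57 776)) (i4 12 82 383 66) u) <= 0.
Proof.
move=> u0 u1.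
have b0 : 0 <= u ^+ 0 * (232 - 10 ^+ 3 * u) ^+ 8 by rewrite mulr_ge0 ?exprn_ge0.
have b1 : 0 <= u ^+ 1 * (232 - 10 ^+ 3 * u) ^+ 7 by rewrite mulr_ge0 ?exprn_ge0.
have b2 : 0 <= u ^+ 2 * (232 - 10 ^+ 3 * u) ^+ 6 by rewrite mulr_ge0 ?exprn_ge0.
have b3 : 0 <= u ^+ 3 * (232 - 10 ^+ 3 * u) ^+ 5 by rewrite mulr_ge0 ?exprn_ge0.
have b4 : 0 <= u ^+ 4 * (232 - 10 ^+ 3 * u) ^+ 4 by rewrite mulr_ge0 ?exprn_ge0.
have b5 : 0 <= u ^+ 5 * (232 - 10 ^+ 3 * u) ^+ 3 by rewrite mulr_ge0 ?exprn_ge0.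
have b6 : 0 <= u ^+ 6 * (232 - 10 ^+ 3 * u) ^+ 2 by rewrite mulr_ge0 ?exprn_ge0.
have b7 : 0 <= u ^+ 7 * (232 - 10 ^+ 3 * u) ^+ 1 by rewrite mulr_ge0 ?exprn_ge0.
have b8 : 0 <= u ^+ 8 * (232 - 10 ^+ 3 * u) ^+ 0 by rewrite mulr_ge0 ?exprn_ge0.
rewrite /approx7 /dapprox7 /pol7 /dpol7.
move: b0 b1 b2 b3 b4 b5 b6 b7 b8; clear; move=> *.
lra.
Qed.

Lemma lower7_sign u : 0 <= u <= 232 / 10 ^+ 3 ->
  0 <= i3 4 89 909 / 10 ^+ 7 + (i3 12 469 797 / 10 ^+ 7 - i3 4 89 909 / 10 ^+ 7 * u - 1) *
    (i3 4 89 909 / 10 ^+ 7 * lower7 (approx7 R lower7_const) u -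
     2 * (i3 12 469 797 / 10 ^+ 7 - i3 4 89 909 / 10 ^+ 7 * u) * lower7 (dapprox7 R) u).
Proof.
move=> /andP[u0 u1]; have e7 n : (10 : R) ^+ n != 0 by rewrite expf_neq0 // pnatr_eq0.
rewrite approx7_scaled_sign; [|exact: e7..].
apply: divr_ge0; last by rewrite mulr_ge0 ?sqr_ge0 ?exprn_ge0.
by apply: (lower7_integer_sign u0); clear -u1; lra.
Qed.

Lemma upper7_sign u : 0 <= u <= 232 / 10 ^+ 3 ->
  i3 4 89 910 / 10 ^+ 7 + (i3 12 469 796 / 10 ^+ 7 - i3 4 89 910 / 10 ^+ 7 * u - 1) *
    (i3 4 89 910 / 10 ^+ 7 * upper7 (approx7 R upper7_const) u -
     2 * (i3 12 469 796 / 10 ^+ 7 - i3 4 89 910 / 10 ^+ 7 * u) * upper7 (dapprox7 R) u) <= 0.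
Proof.
move=> /andP[u0 u1]; have e7 n : (10 : R) ^+ n != 0 by rewrite expf_neq0 // pnatr_eq0.
rewrite approx7_scaled_sign; [|exact: e7..].
apply: mulr_le0_ge0; last by rewrite invr_ge0 mulr_ge0 ?sqr_ge0 ?exprn_ge0.
by apply: (upper7_integer_sign u0); clear -u1; lra.
Qed.
End approximation_signs.

(** * Numerical values of atan and atanh *)

Section inverse_function_numerals.
Variable R : realType.
Implicit Types x k lo hi : R.

(** Passing to the difference from a nearby rational leaves an arctangent of a small argument,
    enclosed by [lo] and [hi] through cross-multiplication; two or three terms of the series then
    give many digits. *)
Lemma atan_near x k lo hi : 0 <= k -> 0 <= x -> 0 <= lo ->
  lo * (1 + x * k) <= x - k -> x - k <= hi * (1 + x * k) ->
  lo - lo ^+ 3 / 3 <= atan x - atan k <= hi - hi ^+ 3 / 3 + hi ^+ 5 / 5.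
Proof.
move=> k0 x0 l0 h1 h2; rewrite (atan_sub k0 x0) addrAC subrr add0r.
have d0 : 0 < 1 + x * k by rewrite ltr_pwDl ?mulr_ge0.
have dl : lo <= (x - k) / (1 + x * k) by rewrite ler_pdivlMr.
have du : (x - k) / (1 + x * k) <= hi by rewrite ler_pdivrMr.
have hi0 : 0 <= hi by apply: le_trans (le_trans dl du).
apply/andP; split.
  by apply: le_trans (le_trans (atan_ge 1 l0) (atan_mono dl)); series; clear; lra.
by apply: le_trans (le_trans (atan_mono du) (atan_le 1 hi0)) _; series; clear; lra.
Qed.

Lemma atanh_near x k lo hi e : -1 < k < 1 -> -1 < x < 1 -> 0 <= lo -> hi < 1 ->
  lo * (1 - x * k) <= x - k -> x - k <= hi * (1 - x * k) -> 1 <= e * (1 - hi ^+ 2) ->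
  lo + lo ^+ 3 / 3 <= atanh x - atanh k <= hi + hi ^+ 3 / 3 + hi ^+ 5 / 5 * e.
Proof.
move=> kk xx l0 hi1 h1 h2 he; rewrite (atanhD xx kk) addrAC subrr add0r.
have d0 : 0 < 1 - x * k.
  case/andP: kk => k1 k2; case/andP: xx => x1 x2.
  have : 0 < (1 - x) * (1 + k) by rewrite mulr_gt0 //; lra.
  have : 0 < (1 + x) * (1 - k) by rewrite mulr_gt0 //; lra.
  lra.
have dl : lo <= (x - k) / (1 - x * k) by rewrite ler_pdivlMr.
have du : (x - k) / (1 - x * k) <= hi by rewrite ler_pdivrMr.
set d := _ / _ in dl du *.
have hi0 : 0 <= hi < 1 by rewrite hi1 andbT; apply: le_trans (le_trans dl du).
have lo0 : 0 <= lo < 1 by rewrite l0; apply: le_lt_trans (le_trans dl du) hi1.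
have d1 : d < 1 by apply: le_lt_trans du hi1.
apply/andP; split.
  by apply: le_trans (le_trans (atanh_ge 2 lo0) (atanh_mono l0 dl d1)); series; clear; lra.
apply: le_trans (le_trans (atanh_mono (le_trans l0 dl) du hi1) (atanh_le_frac 2 hi0 he)) _.
by series; clear; lra.
Qed.

Lemma atan_half : d3 463 647 608 <= atan (1 / 2 : R) <= d3 463 647 610.
Proof.
have h3 : 0 <= (1 / 3 : R) by lra.
have h7 : 0 <= (1 / 7 : R) by lra.
have h2 : 0 <= (1 / 2 : R) by lra.
have E := @atan_sub R (1 / 2) (1 / 3) h3 h2.
have e7 : (1 / 2 - 1 / 3) / (1 + 1 / 2 * (1 / 3)) = 1 / 7 :> R by field.
rewrite e7 in E; rewrite {}E.
have a1 : d4 321 750 554 0 <= atan (1 / 3 : R) by apply: le_trans (atan_ge 5 h3); series; clear; lra.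
have a2 : atan (1 / 3 : R) <= d4 321 750 555 0 by apply: le_trans (atan_le 4 h3) _; series; clear; lra.
have b1 : d4 141 897 54 0 <= atan (1 / 7 : R) by apply: le_trans (atan_ge 3 h7); series; clear; lra.
have b2 : atan (1 / 7 : R) <= d4 141 897 55 0 by apply: le_trans (atan_le 2 h7) _; series; clear; lra.
by clear -a1 a2 b1 b2; apply/andP; split; lra.
Qed.

Lemma atanh_7_9 : d4 1039 720 770 600 <= @atanh R (7 / 9) <= d4 1039 720 771 200.
Proof.
rewrite (@atanh_split R (7 / 9) (1 / 3) (3 / 5)); [|lra..].
rewrite (@atanh_split R (3 / 5) (1 / 3) (1 / 3)); [|lra..].
have /andP[] := atanh_third R; lra.
Qed.

Lemma atanh_17_19 : d4 1445 185 878 600 <= @atanh R (17 / 19) <= d4 1445 185 879 400.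
Proof.
rewrite (@atanh_split R (17 / 19) (1 / 3) (4 / 5)); [|lra..].
rewrite (@atanh_split R (4 / 5) (1 / 3) (7 / 11)); [|lra..].
rewrite (@atanh_split R (7 / 11) (1 / 3) (5 / 13)); [|lra..].
rewrite (@atanh_split R (5 / 13) (1 / 5) (1 / 5)); [|lra..].
have /andP[] := atanh_third R; have /andP[] := atanh_fifth R; lra.
Qed.

(** The point is [al^(-1/2)] for [al = 1.2469797], rounded down, close to the hyperbolic tangent of
    the distance to a face centre. Its [atanh] is reached from 17/19, whose [atanh] is
    [(ln 18) / 2]. *)
Lemma anchor_lower : lower7 (approx7 R lower7_const) 0 <= d4 895 509 700 0 * atanh (d4 895 509 700 0).
Proof.
have kk : -1 < (17 / 19 : R) < 1 by apply/andP; split; lra.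
have := @atanh_near (d4 895 509 700 0) (17 / 19) (d4 3 888 505 551) (d3 4 0 0) 2 kk.
move=> /(_ ltac:(clear; lra) ltac:(clear; lra) ltac:(clear; lra) ltac:(clear; lra) ltac:(clear; lra) ltac:(clear; lra)) /andP[h _].
have /andP[h1 _] := atanh_17_19.
have : d4 1449 74 403 0 <= atanh (d4 895 509 700 0) :> R by clear -h h1; lra.
clear => h; rewrite /approx7 /pol7; lra.
Qed.

Lemma anchor_upper : d4 895 509 800 0 * atanh (d4 895 509 800 0) <= upper7 (approx7 R upper7_const) 0.
Proof.
have kk : -1 < (17 / 19 : R) < 1 by apply/andP; split; lra.
have := @atanh_near (d4 895 509 800 0) (17 / 19) 0 (d4 3 889 10 436) 2 kk.
move=> /(_ ltac:(clear; lra) ltac:(clear; lra) ltac:(clear; lra) ltac:(clear; lra) ltac:(clear; lra) ltac:(clear; lra)) /andP[_ h].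
have /andP[_ h1] := atanh_17_19.
have : atanh (d4 895 509 800 0) <= d4 1449 74 909 900 :> R by clear -h h1; lra.
clear => h; rewrite /approx7 /pol7; lra.
Qed.
End inverse_function_numerals.

(** * Enclosures of the parameters at order 7 *)

Section order_7.
Variable R : realType.
Local Notation y := (yp (7%:R : R)).
Local Notation k := (edgeT y).
Local Notation z := (k ^+ 2).
Let p7 : (7 <= 7)%N. Proof. by []. Qed.

(** For [x = 2 pi / 7] the cosines of [3 x] and [4 x] agree; the root [c = 1] is divided out. *)
Lemma order7_cos : 8 * cos (2 * pi / 7%:R) ^+ 3 + 4 * cos (2 * pi / 7%:R) ^+ 2 - 4 * cos (2 * pi / 7%:R) - 1 = 0 :> R.
Proof.
have c1 := cos_lt1 (order_gt6 R p7); set x := 2 * pi / 7%:R in c1 *.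
have E : cos (x + x + x) = cos ((x + x) + (x + x)).
  have -> : (x + x) + (x + x) = - (x + x + x) + pi *+ 2 by rewrite -mulr_natr /x; field.
  by rewrite cosD2pi cosN.
move: E c1; rewrite cos3 2!cos2; set c := cos x => E c1.
have : (c - 1) * (8 * c ^+ 3 + 4 * c ^+ 2 - 4 * c - 1) = 0 by lra.
by move/eqP; rewrite mulf_eq0 => /orP[/eqP|/eqP //]; lra.
Qed.

(** The reciprocal [w = 1 + u] is a root of [w^3 + 4 w^2 - 4 w - 8], increasing on [[1, 2]], so
    values at two decimals enclose it. *)
Lemma order7_root (u c : R) : 0 <= u -> 1 / 2 < c -> c * (1 + u) = 1 ->
  8 * c ^+ 3 + 4 * c ^+ 2 - 4 * c - 1 = 0 -> d4 603 875 471 609 <= u <= d4 603 875 471 610.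
Proof.
move=> u0 c1 E E3; have [w wE] : exists w, w = 1 + u by exists (1 + u).
rewrite -wE in E; have w1 : 1 <= w by lra.
have w2 : w <= 2 by clear -E c1 w1; nra.
have F : w ^+ 3 + 4 * w ^+ 2 - 4 * w - 8 = 0.
  have : (8 * c ^+ 3 + 4 * c ^+ 2 - 4 * c - 1) * w ^+ 3 = 0 by rewrite E3 mul0r.
  have -> : (8 * c ^+ 3 + 4 * c ^+ 2 - 4 * c - 1) * w ^+ 3 =
    8 * (c * w) ^+ 3 + 4 * (c * w) ^+ 2 * w - 4 * (c * w) * w ^+ 2 - w ^+ 3 by ring.
  by rewrite E; lra.
have mono (a b : R) : 1 <= a -> a <= 2 -> 1 <= b -> b <= 2 ->
    b ^+ 3 + 4 * b ^+ 2 - 4 * b <= a ^+ 3 + 4 * a ^+ 2 - 4 * a -> b <= a.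
  move=> a1 a2 b1 b2 h; rewrite leNgt; apply/negP => ab.
  have : 0 < (b - a) * (a ^+ 2 + a * b + b ^+ 2 + 4 * (a + b) - 4).
    by rewrite mulr_gt0 ?subr_gt0 //; clear -a1 b1; nra.
  lra.
have h1 : d4 1603 875 471 609 <= w by clear -F mono w1 w2; apply: mono; lra.
have h2 : w <= d4 1603 875 471 610 by clear -F mono w1 w2; apply: mono; lra.
by clear -h1 h2 wE; apply/andP; split; lra.
Qed.

Lemma edgeT7_sqr : d4 603 875 471 609 <= z <= d4 603 875 471 610.
Proof. exact: (order7_root (sqr_ge0 k) (cos_gt_half (order_gt6 R p7)) (edgeT_cos R p7) order7_cos). Qed.

Lemma sqr_between (x l u : R) : 0 <= x -> 0 <= l -> l ^+ 2 <= x ^+ 2 -> x ^+ 2 <= u ^+ 2 -> 0 <= u -> l <= x <= u.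
Proof.
move=> x0 l0 h1 h2 u0; apply/andP; split.
  by rewrite -(@ler_pXn2r _ 2) ?nnegrE.
by rewrite -(@ler_pXn2r _ 2) ?nnegrE.
Qed.

Lemma edgeT7 : d4 777 94 248 858 <= k <= d4 777 94 248 860.
Proof.
have /andP[z1 z2] := edgeT7_sqr; have k0 := edgeT_pos R p7.
apply: sqr_between; [exact: ltW|clear; lra| | |clear; lra].
  by apply: le_trans z1; clear; lra.
by apply: le_trans z2 _; clear; lra.
Qed.

Lemma yp7 : d4 619 711 984 118 <= y <= d4 619 711 984 119.
Proof.
have /andP[z1 z2] := edgeT7_sqr; have y0 := yp_gt0 R p7.
have yE := sqr_y_edgeT y0 (yp_hi R p7).
apply: sqr_between; [exact: ltW|clear; lra| | |clear; lra]; rewrite yE.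
  by rewrite ler_pdivlMr; clear -z1 z2; lra.
by rewrite ler_pdivrMr; clear -z1 z2; lra.
Qed.

Lemma edgeK7_sqr : d4 231 914 113 479 <= edgeK y ^+ 2 <= d4 231 914 113 480.
Proof.
have /andP[z1 z2] := edgeT7_sqr; rewrite (edgeK_sqr_edgeT R p7); apply/andP; split.
  by rewrite ler_pdivlMr; clear -z1 z2; lra.
by rewrite ler_pdivrMr; clear -z1 z2; lra.
Qed.

Lemma edgeK7 : d4 481 574 618 806 <= edgeK y <= d4 481 574 618 809.
Proof.
have /andP[z1 z2] := edgeK7_sqr; have k0 := edgeK_gt0 (yp_hi R p7).
apply: sqr_between; [exact: ltW|clear; lra| | |clear; lra].
  by apply: le_trans z1; clear; lra.
by apply: le_trans z2 _; clear; lra.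
Qed.

Lemma atan_edgeK7 : d3 448 798 949 <= atan (edgeK y) <= d3 448 798 952.
Proof.
have /andP[z1 z2] := edgeK7; have /andP[a1 a2] := atan_half R.
have h1 : 0 <= (1 / 2 : R) by clear; lra.
have := @atan_near R (1 / 2) (edgeK y) (d4 14 849 749 870) (d4 14 849 749 880).
move=> /(_ ltac:(clear -z1; lra) h1 ltac:(clear; lra) ltac:(clear -z1 z2; lra) ltac:(clear -z1 z2; lra)).
by move=> /andP[b1 b2]; apply/andP; split; [clear -a1 b2|clear -a2 b1]; lra.
Qed.

Lemma h7 : d3 1037 992 911 <= h_ R 7 <= d3 1037 992 913.
Proof.
have /andP[k1 k2] := edgeT7; have /andP[a1 a2] := atanh_7_9 R; rewrite (h_E R p7).
have kk : -1 < k < 1 by clear -k1 k2; apply/andP; split; lra.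
have xx : -1 < (7 / 9 : R) < 1 by clear; apply/andP; split; lra.
have := @atanh_near R (7 / 9) k (d4 1 727 857 390) (d4 1 727 857 410) 2 kk xx.
move=> /(_ ltac:(clear; lra) ltac:(clear; lra) ltac:(clear -k1 k2; lra) ltac:(clear -k1 k2; lra) ltac:(clear; lra)).
by move=> /andP[b1 b2]; apply/andP; split; [clear -a1 b2|clear -a2 b1]; lra.
Qed.
End order_7.

(** * Volume and numerator at order 7 *)

Section order_7_volume.
Variable R : realType.
Local Notation y := (yp (7%:R : R)).
Local Notation k := (edgeT y).
Local Notation z := (k ^+ 2).
Local Notation h := (h_ R 7).
Local Notation s := (s_ R 7).
Local Notation t := (t_ R 7).
Local Notation a := (atan (edgeK y)).
Implicit Types v : R.

Lemma expr_between n (l v u : R) : 0 <= l -> l <= v -> v <= u -> l ^+ n <= v ^+ n /\ v ^+ n <= u ^+ n.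
Proof.
move=> l0 lv vu; have v0 := le_trans l0 lv; have u0 := le_trans v0 vu.
by split; rewrite lerXn2r ?nnegrE.
Qed.

Lemma mean7_bounds v : d4 231 914 113 479 <= v -> v <= d4 231 914 113 480 ->
  16 + d3 300 513 910 <= lower7 (mean7 R) v /\ upper7 (mean7 R) v <= 16 + d3 300 689 349.
Proof.
move=> v1 v2; have l0 : 0 <= d4 231 914 113 479 :> R by clear; lra.
have [a2 b2] := expr_between 2 l0 v1 v2; have [a3 b3] := expr_between 3 l0 v1 v2.
have [a4 b4] := expr_between 4 l0 v1 v2; have [a5 b5] := expr_between 5 l0 v1 v2.
have [a6 b6] := expr_between 6 l0 v1 v2.
rewrite /mean7; split; [clear -v2 a2 b3 a4 b5 a6|clear -v1 b2 a3 b4 a5 b6]; lra.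
Qed.

Lemma inv_edgeT7 : d4 1286 845 194 730 <= k^-1 <= d4 1286 845 194 740.
Proof.
have /andP[k1 k2] := edgeT7 R; have k0 := edgeT_pos R (isT : 7 <= 7)%N.
rewrite -[k^-1]div1r; apply/andP; split.
  by rewrite (ler_pdivlMr _ _ k0); clear -k1 k2; lra.
by rewrite (ler_pdivrMr _ _ k0); clear -k1 k2; lra.
Qed.

(** The ends of this enclosure and of [tip_level7] are the rationals [rho] and [al] for which the
    sign conditions of the polynomials are certified. *)
Lemma tipSlope7 : (i3 4 89 909 / 10 ^+ 7) <= tipSlope y <= (i3 4 89 910 / 10 ^+ 7).
Proof.
have /andP[z1 z2] := edgeT7_sqr R; have p7 : (7 <= 7)%N by [].
rewrite (tipSlopeE (yp_gt0 R p7) (yp_hi R p7)); clear p7; move: z1 z2; move: z => u z1 z2.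
have u0 : 0 < u * (1 + u) by clear -z1; rewrite mulr_gt0; lra.
have q1 : u ^+ 2 <= d4 603 875 471 610 ^+ 2 by have [] := @expr_between 2 0 u _ (lexx 0) (ltac:(lra)) z2.
have q2 : d4 603 875 471 609 ^+ 2 <= u ^+ 2 by have [] := @expr_between 2 _ u u (ltac:(lra) : 0 <= d4 603 875 471 609 :> R) z1 (lexx u).
apply/andP; split; first by rewrite (ler_pdivlMr _ _ u0); clear -q1 q2 z1 z2; lra.
by rewrite (ler_pdivrMr _ _ u0); clear -q1 q2 z1 z2; lra.
Qed.

Lemma tip_level7 : (i3 12 469 796 / 10 ^+ 7) <= 2 * y ^+ 2 / (1 - y ^+ 2) <= (i3 12 469 797 / 10 ^+ 7).
Proof.
have /andP[z1 z2] := edgeT7_sqr R; have p7 : (7 <= 7)%N by [].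
rewrite (sqr_y_edgeT (yp_gt0 R p7) (yp_hi R p7)); clear p7; move: z1 z2; move: z => u z1 z2.
have -> : 2 * (1 / (2 + u)) / (1 - 1 / (2 + u)) = 2 / (1 + u).
  have u1 : 1 + u != 0 by rewrite gt_eqF //; lra.
  have u2 : 2 + u != 0 by rewrite gt_eqF //; lra.
  have u3 : 2 + u - 1 != 0 by rewrite gt_eqF //; lra.
  by field; rewrite u1 u2.
apply/andP; split; first by rewrite ler_pdivlMr; clear -z1 z2; lra.
by rewrite ler_pdivrMr; clear -z1 z2; lra.
Qed.

Lemma edgeK7_range : edgeK y ^+ 2 <= 232 / 10 ^+ 3.
Proof. by have /andP[_ h2] := edgeK7_sqr R; apply: le_trans h2 _; clear; lra. Qed.

(** The two products are about -9.776 and 10.102. Their difference is small and then multiplied by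
    24, which is why the data carry at least nine decimals. *)
Lemma volume7_lower_numeral (m ki u b w : R) : 16 + d3 300 513 910 <= m ->
  ki <= d4 1286 845 194 740 -> u <= d3 1037 992 913 -> d3 448 798 949 <= b -> b <= d3 448 798 952 ->
  d4 619 711 984 118 <= w -> 7 + d3 822 680 0 <= 24 * (b * (lower7_const * ki - u) + w * m).
Proof.
move=> m1 k2 h2 a1 a2 y1.
have e1 : - (21 + d3 781 866 1) <= lower7_const * ki - u by clear -k2 h2; lra.
have e2 : b * - (21 + d3 781 866 1) <= b * (lower7_const * ki - u) by apply: (ler_wpM2l _ e1); clear -a1; lra.
have e3 : d4 619 711 984 118 * (16 + d3 300 513 910) <= w * m by apply: (ler_pM _ _ y1 m1); clear; lra.
clear -e2 e3 a2; lra.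
Qed.

Lemma volume7_upper_numeral (m ki u b w : R) : m <= 16 + d3 300 689 349 ->
  d4 1286 845 194 730 <= ki -> d3 1037 992 911 <= u -> d3 448 798 949 <= b ->
  d4 619 711 984 118 <= w -> w <= d4 619 711 984 119 ->
  24 * (b * (upper7_const * ki - u) + w * m) <= 7 + d3 822 780 0.
Proof.
move=> m1 k1 h1 a1 y1 y2.
have e1 : upper7_const * ki - u <= - (21 + d3 782 99 820) by clear -k1 h1; lra.
have e2 : b * (upper7_const * ki - u) <= b * - (21 + d3 782 99 820) by apply: (ler_wpM2l _ e1); clear -a1; lra.
have e3 : w * m <= w * (16 + d3 300 689 349) by apply: (ler_wpM2l _ m1); clear -y1; lra.
clear -e2 e3 a1 y2; lra.
Qed.

Lemma V0_7_ge : 7 + d3 822 680 0 <= V0 R 7.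
Proof.
have p7 : (7 <= 7)%N by [].
have /andP[r1 r2] := tipSlope7; have /andP[l1 l2] := tip_level7.
have c0 : 0 < (i3 4 89 909 / 10 ^+ 7) :> R by clear; lra.
have c1 : 0 < d4 895 509 700 0 :> R by clear; lra.
have c2 : (i3 12 469 797 / 10 ^+ 7) * d4 895 509 700 0 ^+ 2 <= 1 :> R by clear; lra.
apply: le_trans (volume7_ge (yp_gt0 R p7) (yp_lo R p7) (yp_hi R p7) edgeK7_range c0 r1 l2 (@lower7_sign R) c1 c2 (anchor_lower R)).
have /andP[v1 v2] := edgeK7_sqr R; have [m1 _] := mean7_bounds v1 v2.
rewrite -(h_E R p7); have /andP[h1 h2] := h7 R; have /andP[k1 k2] := inv_edgeT7.
have /andP[a1 a2] := atan_edgeK7 R; have /andP[y1 y2] := yp7 R.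
exact: volume7_lower_numeral.
Qed.

Lemma V0_7_le : V0 R 7 <= 7 + d3 822 780 0.
Proof.
have p7 : (7 <= 7)%N by [].
have /andP[r1 r2] := tipSlope7; have /andP[l1 l2] := tip_level7.
have c0 : 0 < (i3 4 89 910 / 10 ^+ 7) :> R by clear; lra.
have c1 : 0 < (d4 895 509 800 0 : R) < 1 by clear; apply/andP; split; lra.
have c2 : 1 <= (i3 12 469 796 / 10 ^+ 7) * d4 895 509 800 0 ^+ 2 :> R by clear; lra.
have c3 : 1 < (i3 12 469 796 / 10 ^+ 7) - (i3 4 89 910 / 10 ^+ 7) * (232 / 10 ^+ 3) :> R by clear; lra.
apply: le_trans (volume7_le (yp_gt0 R p7) (yp_lo R p7) (yp_hi R p7) edgeK7_range c0 r2 l1 (@upper7_sign R) c1 c2 (anchor_upper R) c3) _.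
have /andP[v1 v2] := edgeK7_sqr R; have [_ m1] := mean7_bounds v1 v2.
rewrite -(h_E R p7); have /andP[h1 h2] := h7 R; have /andP[k1 k2] := inv_edgeT7.
have /andP[a1 a2] := atan_edgeK7 R; have /andP[y1 y2] := yp7 R.
exact: volume7_upper_numeral.
Qed.

(** From [cosh^2 s = 2 / (1 - k^2)] follows [tanh^2 s = (1 + k^2) / 2]. *)
Lemma s_7 : d3 1449 74 690 <= s <= d3 1449 74 920.
Proof.
have p7 : (7 <= 7)%N by []; have /andP[z1 z2] := edgeT7_sqr R; have [s0 sE] := s_props R p7.
set x := Num.sqrt ((1 + z) / 2).
have x2 : x ^+ 2 = (1 + z) / 2 by rewrite sqr_sqrtr //; clear -z1; lra.
have /andP[x1 x3] : d3 895 509 763 <= x <= d3 895 509 764.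
  apply: sqr_between; [exact: sqrtr_ge0|clear; lra| | |clear; lra]; rewrite x2.
    by clear -z1; lra.
  by clear -z2; lra.
have xx : -1 < x < 1 by clear -x1 x3; apply/andP; split; lra.
have x01 : 0 <= x < 1 by clear -x1 x3; apply/andP; split; lra.
have D0 := one_sub_sqr_gt0 R p7.
have -> : s = atanh x.
  apply: cosh_inj; [exact: s0|exact: atanh_ge0|].
  apply/eqP; rewrite -(@eqrXn2 _ 2) ?(ltW (cosh_gt0 _)) //; apply/eqP.
  have E : 1 - (1 + z) / 2 = (1 - z) / 2 by field.
  by rewrite sE (cosh_atanh_sqr xx) x2 E invf_div.
have kk : -1 < (17 / 19 : R) < 1 by clear; apply/andP; split; lra.
have := @atanh_near R x (17 / 19) (d4 3 888 800 0) (d4 3 889 0 0) 2 kk xx.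
move=> /(_ ltac:(clear; lra) ltac:(clear; lra) ltac:(clear -x1; lra) ltac:(clear -x3; lra) ltac:(clear; lra)).
by have /andP[h1 h2] := atanh_17_19 R; move=> /andP[b1 b2]; apply/andP; split; [clear -h1 b1|clear -h2 b2]; lra.
Qed.

Lemma cosh_2x7 : d3 1357 448 707 <= cosh (2 * (s - h)) <= d3 1357 448 710.
Proof.
have p7 : (7 <= 7)%N by []; have /andP[z1 z2] := edgeT7_sqr R.
rewrite (cosh_2s_sub_2h R p7).
have k0 := edgeT_pos R p7; set g := Num.sqrt _.
have g2 : g ^+ 2 = 2 * (1 + z) by rewrite sqr_sqrtr //; clear -z1; lra.
have gk : (k * g) ^+ 2 = 2 * (1 + z) * z by rewrite [LHS]exprMn g2 mulrC.
have g0 : 0 <= k * g by rewrite mulr_ge0 ?(ltW k0) ?sqrtr_ge0.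
have -> : 4 * k * g = 4 * (k * g) by rewrite mulrA.
move: gk g0 z1 z2; clear; move: (k * g) z => b u gk b0 z1 z2.
have q1 : u ^+ 2 <= d4 603 875 471 610 ^+ 2 by have [] := @expr_between 2 0 u _ (lexx 0) (ltac:(lra)) z2.
have q2 : d4 603 875 471 609 ^+ 2 <= u ^+ 2 by have [] := @expr_between 2 _ u u (ltac:(lra) : 0 <= d4 603 875 471 609 :> R) z1 (lexx u).
have /andP[b1 b2] : d4 1391 790 973 399 <= b <= d4 1391 790 973 404.
  apply: sqr_between; [exact: b0|clear; lra| | |clear; lra]; rewrite gk; [clear -z1 q2|clear -z2 q1]; lra.
have u1 : 0 < 1 - u by clear -z2; lra.
have D0 : 0 < (1 - u) ^+ 2 by rewrite exprn_gt0.
apply/andP; split; first by rewrite (ler_pdivlMr _ _ D0); clear -q1 q2 z1 z2 b1 b2; lra.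
by rewrite (ler_pdivrMr _ _ D0); clear -q1 q2 z1 z2 b1 b2; lra.
Qed.

Lemma sinh_2h7 : d3 3923 484 627 <= 2 * k / (1 - z) <= d3 3923 484 628.
Proof.
have /andP[z1 z2] := edgeT7_sqr R; have /andP[k1 k2] := edgeT7 R.
have D0 := one_sub_sqr_gt0 R (isT : 7 <= 7)%N; apply/andP; split.
  by rewrite (ler_pdivlMr _ _ D0); clear -z1 z2 k1 k2; lra.
by rewrite (ler_pdivrMr _ _ D0); clear -z1 z2 k1 k2; lra.
Qed.

Lemma truncation_area7 : truncation_area R 7 = a.
Proof. by rewrite (atan_edgeK R (isT : 7 <= 7)%N) /truncation_area; field. Qed.

Lemma numerator7_numeral (b c S u : R) : d3 448 798 949 <= b -> b <= d3 448 798 952 ->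
  d3 1357 448 707 <= c -> c <= d3 1357 448 710 -> d3 3923 484 627 <= S -> S <= d3 3923 484 628 ->
  d3 1037 992 911 <= u -> u <= d3 1037 992 913 ->
  6 + d3 643 943 200 <= 2 * b * (S * c + 2 * u) <= 6 + d3 643 943 500.
Proof.
move=> a1 a2 c1 c2 s1 s2 h1 h2.
have e1 : d3 3923 484 627 * d3 1357 448 707 <= S * c by apply: (ler_pM _ _ s1 c1); clear; lra.
have e2 : S * c <= d3 3923 484 628 * d3 1357 448 710 by apply: (ler_pM _ _ s2 c2); [clear -s1|clear -c1]; lra.
have q0 : 7 + d3 401 914 950 <= S * c + 2 * u by clear -e1 h1; lra.
have q1 : S * c + 2 * u <= 7 + d3 401 915 0 by clear -e2 h2; lra.
rewrite -mulrA; apply/andP; split.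
  have : d3 448 798 949 * (7 + d3 401 914 950) <= b * (S * c + 2 * u) by apply: (ler_pM _ _ a1 q0); clear; lra.
  by clear; lra.
have : b * (S * c + 2 * u) <= d3 448 798 952 * (7 + d3 401 915 0).
  by apply: (ler_pM _ _ a2 q1); [clear -a1|clear -q0]; lra.
by clear; lra.
Qed.

Lemma numerator7_bounds :
  6 + d3 643 943 200 <= 2 * truncation_area R 7 * (2 * k / (1 - z) * cosh (2 * (s - h)) + 2 * h) <= 6 + d3 643 943 500.
Proof.
rewrite truncation_area7; have /andP[a1 a2] := atan_edgeK7 R; have /andP[c1 c2] := cosh_2x7.
have /andP[s1 s2] := sinh_2h7; have /andP[h1 h2] := h7 R.
exact: numerator7_numeral.
Qed.
End order_7_volume.

(** * Optimality of the third family at order 7 *)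

Section order_7_density.
Variable R : realType.
Local Notation y := (yp (7%:R : R)).
Local Notation k := (edgeT y).
Local Notation z := (k ^+ 2).
Local Notation h := (h_ R 7).
Local Notation s := (s_ R 7).
Local Notation t := (t_ R 7).

Lemma adm3_7 : adm3 7 (s - h).
Proof.
have /andP[h1 h2] := h7 R; have /andP[s1 s2] := s_7 R; split.
  by clear -h2 s1; lra.
by rewrite le_min; apply/andP; split; [clear -h1 s2; lra|exact: lexx].
Qed.

Lemma V0_7_gt0 : 0 < V0 R 7.
Proof. by apply: lt_le_trans (V0_7_ge R); clear; lra. Qed.

(** At [x = s - h] the heights are [s] and [2 h - s], both at most [s], so the volumes are exact and
    the upper bound of the numerator is attained. *)
Lemma delta3_7 : delta3 7 (s - h) * V0 R 7 =
  2 * truncation_area R 7 * (2 * k / (1 - z) * cosh (2 * (s - h)) + 2 * h).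
Proof.
have p7 : (7 <= 7)%N by []; have /andP[y1 y2] := yp7 R.
rewrite /delta3 divfK ?(gt_eqF V0_7_gt0) //.
have [yl yu] : d4 619 711 984 118 ^+ 2 <= y ^+ 2 /\ y ^+ 2 <= d4 619 711 984 119 ^+ 2.
  by apply: (expr_between 2 _ y1 y2); clear; lra.
have [x0 xm] := adm3_7; have xh : 0 <= s - h <= h /\ h + (s - h) <= s.
  move: xm; rewrite le_min => /andP[a _]; split; first by rewrite x0.
  by clear; lra.
have n1 : 6 / 10 <= 1 - y ^+ 2 by clear -yu; lra.
have n2 : 1 - y ^+ 2 <= 63 / 100 by clear -yl; lra.
by rewrite (num3_eq p7 n1 n2 xh.1 xh.2) (sinh_2h R p7).
Qed.

Lemma delta3_7_bounds : d2 849 300 <= (delta3 7 (s - h) : R) <= d2 849 320.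
Proof.
have /andP[n1 n2] := numerator7_bounds R; have v1 := V0_7_ge R; have v2 := V0_7_le R.
have V00 := V0_7_gt0; rewrite -delta3_7 in n1 n2.
apply/andP; split; rewrite -(ler_pM2r V00).
  by clear -n1 v2; lra.
by clear -n2 v1; lra.
Qed.

Lemma order7_num2 (C : R) : C = (5 + z) / (1 - z) ->
  ((1 + k) / (1 - k)) ^+ 2 <= 226 / 100 * (2 * C - C^-1) /\
  (C + 3 * ((226 / 100 - (226 / 100)^-1) / 2)) * ((226 / 100 + (226 / 100)^-1) / 2) + (226 / 100 - (226 / 100)^-1) <=
    4 * (2 * k / (1 - z) * cosh (2 * (s - h)) + h).
Proof.
move=> CE; have /andP[k1 k2] := edgeT7 R; have /andP[z1 z2] := edgeT7_sqr R.
have /andP[s1 s2] := sinh_2h7 R; have /andP[c1 c2] := cosh_2x7 R; have /andP[h1 h2] := h7 R.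
have q3 : 1414 / 100 <= C by rewrite CE ler_pdivlMr; clear -z1 z2; lra.
have q5 : C <= 1415 / 100 by rewrite CE ler_pdivrMr; clear -z1 z2; lra.
have q1 : (1 + k) / (1 - k) <= 798 / 100 by rewrite ler_pdivrMr; clear -k1 k2; lra.
have q2 : 0 <= (1 + k) / (1 - k) by rewrite divr_ge0; clear -k1 k2; lra.
have q4 : C^-1 <= 8 / 100 by clear -q3; rewrite -div1r ler_pdivrMr; lra.
have e1 : d3 3923 484 627 * d3 1357 448 707 <= 2 * k / (1 - z) * cosh (2 * (s - h)).
  by apply: (ler_pM _ _ s1 c1); clear; lra.
have -> : (226 / 100 : R)^-1 = 100 / 226 by clear; field.
split; last by clear -e1 h1 q5; lra.
have := ler_square q2 q1; clear -q3 q4; lra.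
Qed.

Lemma order7_le x :
  (adm1 7 x -> delta1 7 x <= delta3 7 (s - h)) /\ (adm2 7 x -> delta2 7 x <= delta3 7 (s - h)) /\
    (adm3 7 x -> delta3 7 x <= delta3 7 (s - h) :> R).
Proof.
have p7 : (7 <= 7)%N by []; have V00 := V0_7_gt0; have hN := delta3_7.
have /andP[c1 c2] := cosh_2x7 R; have [x0 _] := adm3_7; have /andP[h1 h2] := h7 R.
have hN1 : 2 * truncation_area R 7 * (2 * k / (1 - z) * cosh (2 * (s - h)) + 2 * h) <= delta3 7 (s - h) * V0 R 7.
  by rewrite hN.
have ge1 : 1 <= cosh (2 * (s - h)) by clear -c1; lra.
(* Here [x <= t - h] is essential: it gives [exp (2 x) <= 2 cosh (2 t) / exp (2 h)], about 3.55,
   whereas [exp (2 h)], about 7.97, would violate [Ex + 3 / Ex <= 4 c]. *)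
apply: (@delta_bounds R 7 p7 (cosh (2 * (s - h))) (delta3 7 (s - h)) (36 / 10) V00 ge1); last first.
- have [g1 g2] := order7_num2 erefl.
  have g3 : 1 <= (226 / 100 : R) by clear; lra.
  by move=> u au; apply: le_trans (num2_dominated p7 au g1 g3 (lexx h) g2) hN1.
- exact: hN1.
- have -> : 36 / 10 + 3 / (36 / 10) = 36 / 10 + 30 / 36 :> R by clear; field.
  by clear -c1; lra.
- move=> u _ ut; have E : expR (2 * u) * expR (2 * h) <= expR (2 * t).
    by rewrite -expRD ler_expR -mulrDr; clear -ut; lra.
  have T1 : expR (2 * t) <= 2 * cosh (2 * t).
    by rewrite /cosh; have := expR_gt0 (- (2 * t)); clear; lra.
  move: (le_trans E T1); rewrite (expR_2h R p7) (cosh_2t R p7).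
  have /andP[k1 k2] := edgeT7 R; have /andP[z1 z2] := edgeT7_sqr R.
  have q3 : 796 / 100 <= (1 + k) / (1 - k) by rewrite ler_pdivlMr; clear -k1 k2; lra.
  have q5 : (5 + z) / (1 - z) <= 1415 / 100 by rewrite ler_pdivrMr; clear -z1 z2; lra.
  have q4 := ler_wpM2l (expR_ge0 (2 * u)) q3.
  by move: q4 q5; clear; lra.
- by move=> u /andP[u0 _] us; rewrite cosh_le; clear -u0 us x0; lra.
Qed.
End order_7_density.

Theorem theorem3p13 (R : realType) :
  let x7 : R := s_ R 7 - h_ R 7 in
  (forall p : nat, (7 <= p)%N -> forall x : R,
      (adm1 p x -> delta1 p x <= delta3 7 x7) /\
      (adm2 p x -> delta2 p x <= delta3 7 x7) /\
      (adm3 p x -> delta3 p x <= delta3 7 x7)) /\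
  adm3 7 x7 /\
  `|x7 - (41 * 10 ^+ 3 + 108) / 10 ^+ 5| <= 1 / 10 ^+ 5 /\
  `|delta3 7 x7 - (84 * 10 ^+ 3 + 931) / 10 ^+ 5| <= 1 / 10 ^+ 5.
Proof.
have /andP[d1 d2'] := delta3_7_bounds R; cbv zeta; split; last split; last split.
(* The threshold 0.8493 separates: it bounds every density of order at least 8 and lies below the
   optimum at order 7. *)
- have large (u v : R) (P : Prop) : (P -> u <= d2 849 300) -> d2 849 300 <= v -> P -> u <= v.
    by move=> h1 h2 /h1 h3; exact: le_trans h2.
  move=> p; rewrite leq_eqVlt => /orP[/eqP <-|]; first exact: order7_le.
  rewrite leq_eqVlt => /orP[/eqP <- x|].
    have [h1 [h2 h3]] := order8_le x.
    by split; [|split]; apply: large d1.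
  rewrite leq_eqVlt => /orP[/eqP <- x|p10 x].
    have [h1 [h2 h3]] := order9_le x.
    by split; [|split]; apply: large d1.
  have [h1 [h2 h3]] := order10_le x p10.
  by split; [|split]; apply: large d1.
- exact: adm3_7.
- have /andP[h1 h2] := h7 R; have /andP[s1 s2] := s_7 R.
  by rewrite ler_norml; clear -h1 h2 s1 s2; apply/andP; split; lra.
- by rewrite ler_norml; clear -d1 d2'; apply/andP; split; lra.
Qed.
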